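(* For almost all primes $p$ and all finite extensions $K/\mathbf{Q}_p$, writing $q=q_K$: $$\zeta_{\mathrm{U}_2^2(\mathfrak{O}_K)\curvearrowright\mathfrak{O}_K^4}(s)=\frac{1-q^{2-3s}}{(1-q^{3-3s})(1-q^{2-2s})^2(1-q^{1-s})(1-q^{-s})},$$ $$\zeta_{\mathrm{U}_2^3(\mathfrak{O}_K)\curvearrowright\mathfrak{O}_K^6}(s)=\frac{A(q,q^{-s})}{(1-q^{8-5s})(1-q^{5-4s})(1-q^{4-3s})(1-q^{3-2s})^3(1-q^{2-s})(1-q^{1-s})(1-q^{-s})},$$ $$\zeta_{(\mathrm{U}_3\times\mathrm{U}_2)(\mathfrak{O}_K)\curvearrowright\mathfrak{O}_K^5}(s)=\frac{B(q,q^{-s})}{(1-q^{6-6s})(1-q^{4-5s})(1-q^{3-4s})(1-q^{3-3s})(1-q^{2-3s})(1-q^{2-2s})^2(1-q^{1-s})(1-q^{-s})},$$ where $A=-X^{14}Y^{12}+3X^{11}Y^9-X^{11}Y^8-2X^{10}Y^9+2X^{10}Y^8-X^8Y^7+2X^7Y^7-2X^7Y^5+X^6Y^5-2X^4Y^4+2X^4Y^3+X^3Y^4-3X^3Y^3+1$ and $B=X^{13}Y^{18}-X^{11}Y^{15}-2X^{11}Y^{14}+X^{11}Y^{13}+X^{10}Y^{14}-2X^{10}Y^{13}+X^9Y^{12}-2X^8Y^{12}+3X^8Y^{11}-2X^7Y^{11}+X^8Y^9+X^7Y^{10}+X^6Y^8+X^5Y^9-2X^6Y^7+3X^5Y^7-2X^5Y^6+X^4Y^6-2X^3Y^5+X^3Y^4+X^2Y^5-2X^2Y^4-X^2Y^3+1$.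 Writing these zeta functions as $W(q_K,q_K^{-s})$ with $W\in\mathbf{Q}(X,Y)$ (and, for $\mathrm{U}_3^2$ acting on $\mathfrak{O}_K^6$, for a suitable such $W$ valid for almost all $p$ and all finite $K/\mathbf{Q}_p$), one has $W(X^{-1},Y^{-1})=X^6Y^6W$ for $\mathrm{U}_2^2$, $W(X^{-1},Y^{-1})=X^{15}Y^9W$ for $\mathrm{U}_2^3$, $W(X^{-1},Y^{-1})=-X^{10}Y^9W$ for $\mathrm{U}_3\times\mathrm{U}_2$, and $W(X^{-1},Y^{-1})=X^{15}Y^{12}W$ for $\mathrm{U}_3^2$.
   Context: $\mathrm{U}_n(R)$ is the group of upper unitriangular $n\times n$ matrices over a commutative ring $R$. A product $\mathrm{U}_{n_1}\times\dots\times\mathrm{U}_{n_r}$ is embedded block-diagonally in $\mathrm{U}_{n_1+\dots+n_r}$ and acts on $R^{n_1+\dots+n_r}$ (row vectors) by right multiplication. $\mathfrak{O}_K$ is the valuation ring of $K$, $q_K$ its residue field size. For a set $\Omega$ of endomorphisms of an $\mathfrak{O}_K$-module $\mathsf{V}$, $\zeta_{\Omega\curvearrowright\mathsf{V}}(s)=\sum_{\mathsf{U}}[\mathsf{V}:\mathsf{U}]^{-s}$, summing over $\Omega$-invariant $\mathfrak{O}_K$-submodules $\mathsf{U}$ with finite quotient of cardinality $[\mathsf{V}:\mathsf{U}]$. *)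

(* Defs.v *)
From HB Require Import structures.
From mathcomp Require Import all_boot all_order all_algebra.
Set Implicit Arguments. Unset Strict Implicit. Unset Printing Implicit Defensive.
Import Order.TTheory GRing.Theory Num.Theory.
Local Open Scope ring_scope.

Definition rdiv {R : comNzRingType} (a b : R) : Prop := exists c : R, b = c * a.

(* ---------- Rings of integers O_K of finite extensions K/Q_p ----------
   [padic_int_ring R p q] : R is a complete discrete valuation ring with
   uniformiser pi, residue field R/(pi) of cardinality q, and p = unit * pi^e
   with e >= 1 (so the residue characteristic is p and R has characteristic 0).
   These are exactly (up to isomorphism) the valuation rings O_K of finite
   extensions K/Q_p, and q = q_K. *)
Definition padic_int_ring (R : idomainType) (p q : nat) : Prop :=
  exists pi : R,
    [/\ pi != 0 /\ pi \notin GRing.unit,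
        (forall x : R, x != 0 ->
            exists u : R, exists k : nat, u \is a GRing.unit /\ x = u * pi ^+ k),
        (exists e : nat, exists u : R,
            [/\ (0 < e)%N, u \is a GRing.unit & (p%:R : R) = u * pi ^+ e]),
        (exists s : seq R, size s = q /\
            (forall x : R, exists2 i, (i < q)%N & rdiv pi (x - nth 0 s i)) /\
            (forall i j, (i < q)%N -> (j < q)%N ->
                 rdiv pi (nth 0 s i - nth 0 s j) -> i = j)) &
        (forall x : nat -> R, (forall n, rdiv (pi ^+ n) (x n.+1 - x n)) ->
            exists y : R, forall n, rdiv (pi ^+ n) (y - x n))].

Fixpoint blk (s : seq nat) (i : nat) : nat :=
  match s with
  | [::] => 0
  | n :: s' => if (i < n)%N then 0 else (blk s' (i - n)).+1
  end.

(* g is in (U_{n_1} x ... x U_{n_r})(R), embedded block-diagonally in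
   U_{n_1+...+n_r}(R), where s = [:: n_1; ...; n_r]. *)
Definition in_Ublocks (R : comNzRingType) (s : seq nat)
    (g : 'M[R]_(sumn s)) : Prop :=
  forall i j : 'I_(sumn s),
    [/\ (i == j :> nat) -> g i j = 1,
        (j < i)%N -> g i j = 0 &
        blk s i != blk s j -> g i j = 0].

Definition is_submod (R : comNzRingType) (N : nat) (U : 'rV[R]_N -> Prop) : Prop :=
  [/\ U 0, (forall u v, U u -> U v -> U (u + v)) & (forall (a : R) u, U u -> U (a *: u))].

Definition is_invariant (R : comNzRingType) (s : seq nat)
    (U : 'rV[R]_(sumn s) -> Prop) : Prop :=
  forall g, in_Ublocks g -> forall u, U u -> U (u *m g).

Definition has_index (R : comNzRingType) (N : nat) (U : 'rV[R]_N -> Prop) (k : nat) : Prop :=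
  exists reps : seq 'rV[R]_N,
    [/\ size reps = k,
        (forall v, exists2 i, (i < k)%N & U (v - nth 0 reps i)) &
        (forall i j, (i < k)%N -> (j < k)%N ->
            U (nth 0 reps i - nth 0 reps j) -> i = j)].

Definition count_is (T : Type) (P : (T -> Prop) -> Prop) (c : nat) : Prop :=
  exists L : seq (T -> Prop),
    [/\ size L = c,
        (forall i, (i < c)%N -> P (nth (fun _ => False) L i)),
        (forall i j, (i < c)%N -> (j < c)%N ->
            (forall v, nth (fun _ => False) L i v <-> nth (fun _ => False) L j v) -> i = j) &
        (forall U, P U -> exists2 i, (i < c)%N &
            forall v, U v <-> nth (fun _ => False) L i v)].

Definition zeta_coef (R : comNzRingType) (s : seq nat) (k c : nat) : Prop :=
  count_is (fun U : 'rV[R]_(sumn s) -> Prop =>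
              [/\ is_submod U, is_invariant U & has_index U k]) c.

Definition Xb : {poly {poly rat}} := ('X)%:P.
Definition Yb : {poly {poly rat}} := 'X.
Definition mon (a b : nat) : {poly {poly rat}} := Xb ^+ a * Yb ^+ b.

Definition evalX (q : nat) (P : {poly {poly rat}}) : {poly rat} :=
  map_poly (fun a : {poly rat} => a.[q%:R]) P.

(* zeta_{U_s(R) ~ R^N}(s) = W(q, q^{-s}) for W = Nm/Dn, as an identity of
   Dirichlet series in q^{-s}: the coefficients of index q^m are c m, all
   other coefficients vanish, and (sum_m c m T^m) * Dn(q,T) = Nm(q,T) as
   formal power series in T. *)
Definition zeta_eq (R : comNzRingType) (s : seq nat) (q : nat)
    (Nm Dn : {poly {poly rat}}) : Prop :=
  evalX q Dn != 0 /\
  exists c : nat -> nat,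
    [/\ (forall m, zeta_coef R s (q ^ m) (c m)),
        (forall k, (forall m, k <> (q ^ m)%N) -> zeta_coef R s k 0) &
        (forall m, \sum_(j < m.+1) (evalX q Dn)`_j * (c (m - j)%N)%:R
                   = (evalX q Nm)`_m)].

Notation QXY := {fraction {poly {poly rat}}}.
Definition tofr (P : {poly {poly rat}}) : QXY := @FracField.tofrac _ P.
Definition inv_sub (P : {poly {poly rat}}) : QXY :=
  (map_poly (fun a : {poly rat} =>
       (map_poly (fun r : rat => tofr ((r%:P)%:P)) a).[(tofr Xb)^-1]) P).[(tofr Yb)^-1].

Definition funeq (Nm Dn : {poly {poly rat}}) (eps : {poly {poly rat}}) (a b : nat) : Prop :=
  inv_sub Nm / inv_sub Dn = tofr (eps * mon a b) * (tofr Nm / tofr Dn).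

Definition fac (a b : nat) : {poly {poly rat}} := 1 - mon a b.

Definition N22 : {poly {poly rat}} := 1 - mon 2 3.
Definition D22 : {poly {poly rat}} := fac 3 3 * fac 2 2 ^+ 2 * fac 1 1 * fac 0 1.

Definition A_poly : {poly {poly rat}} :=
  - mon 14 12 + 3 * mon 11 9 - mon 11 8 - 2 * mon 10 9 + 2 * mon 10 8
  - mon 8 7 + 2 * mon 7 7 - 2 * mon 7 5 + mon 6 5 - 2 * mon 4 4
  + 2 * mon 4 3 + mon 3 4 - 3 * mon 3 3 + 1.
Definition D222 : {poly {poly rat}} :=
  fac 8 5 * fac 5 4 * fac 4 3 * fac 3 2 ^+ 3 * fac 2 1 * fac 1 1 * fac 0 1.

Definition B_poly : {poly {poly rat}} :=
  mon 13 18 - mon 11 15 - 2 * mon 11 14 + mon 11 13 + mon 10 14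
  - 2 * mon 10 13 + mon 9 12 - 2 * mon 8 12 + 3 * mon 8 11 - 2 * mon 7 11
  + mon 8 9 + mon 7 10 + mon 6 8 + mon 5 9 - 2 * mon 6 7 + 3 * mon 5 7
  - 2 * mon 5 6 + mon 4 6 - 2 * mon 3 5 + mon 3 4 + mon 2 5 - 2 * mon 2 4
  - mon 2 3 + 1.
Definition D32 : {poly {poly rat}} :=
  fac 6 6 * fac 4 5 * fac 3 4 * fac 3 3 * fac 2 3 * fac 2 2 ^+ 2
  * fac 1 1 * fac 0 1.

(* Main.v *)
From HB Require Import structures.
From mathcomp Require Import all_boot all_order all_algebra.
From mathcomp Require Import boolp ring zify.
Require Import Defs.

(* Over a discrete valuation ring with uniformiser pi, a submodule U of finite
   index in R x V is the same as a finite-index submodule L of V (its tail), an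
   exponent a such that pi^a generates the projection of U to R, and a coset of
   lifts of pi^a modulo L.  Invariance of U becomes a condition on a together with
   a condition that the lifts lie in some submodule C of V containing L, so that
   the number of U above L is the index of L in C.  The only invariants of L that
   enter are those of sublattices of R^2: the exponents c, b of the two projections
   and the common difference j between the exponents of the intersections with the
   axes and those of the projections.  There are phi(j) lattices for each (c, b, j),
   the quotient is R/pi^(j + max c b) + R/pi^(min c b), and this determines all
   torsion and homomorphism counts.  Every zeta function is therefore a sum over
   natural numbers of monomials times q to sums of minima.  These sums are
   evaluated in the ring of formal power series by splitting off the diagonal of
   pairs of indices, along which the summand is geometric.  For U_3 x U_3 the
   numerator N33 and denominator D33 are read off from the result. *)

Set Implicit Arguments. Unset Strict Implicit. Unset Printing Implicit Defensive.
Import Order.TTheory GRing.Theory Num.Theory.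
Local Open Scope ring_scope.

(** * Formal power series *)

(** The group moves the coordinates of a block only towards its last one. The coordinates are
    therefore reordered with the last vectors of the blocks at the end, and the span of each final
    segment is stable. For three blocks the core is a lattice of rank three, beyond the rank-two
    classification, so one more coordinate is peeled off: if it has exponent [d] and the vector
    acting onto it has exponent [d + k], invariance says that the lifts of [pi ^+ d] are killed by
    [pi ^+ k] modulo a rank-two lattice, which is a torsion count. The same device handles the
    middle vector of [U_3] in [U_3 x U_2]. For [U_3 x U_3] three rank-two layers are stacked, and
    the extensions joining the lower two are counted by homomorphisms between finite modules on two
    generators.

    Power series cannot be divided freely, and the partial fractions used for the sums bring in
    denominators such as [v - Q * w], which are not units. *)

Definition fps (K : Type) : Type := nat -> K.

(** Equality of coefficient functions is not decidable; these structures, which the ring hierarchy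
    requires, are classical. *)
HB.instance Definition _ (K : Type) := gen_eqMixin (fps K).
HB.instance Definition _ (K : Type) := gen_choiceMixin (fps K).

Section FpsRing.
Variable K : comNzRingType.
Implicit Types f g h : fps K.

Definition fps_add f g : fps K := fun m => f m + g m.
Definition fps_opp f : fps K := fun m => - f m.
Definition fps_zero : fps K := fun=> 0.
Definition fps_one : fps K := fun m => (m == 0%N)%:R.
Definition fps_mul f g : fps K := fun m => \sum_(i < m.+1) f i * g (m - i)%N.

Fact fps_addA : associative fps_add.
Proof. by move=> f g h; apply: funext => m; rewrite /fps_add addrA. Qed.
Fact fps_addC : commutative fps_add.
Proof. by move=> f g; apply: funext => m; rewrite /fps_add addrC. Qed.
Fact fps_add0 : left_id fps_zero fps_add.
Proof. by move=> f; apply: funext => m; rewrite /fps_add add0r. Qed.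
Fact fps_addN : left_inverse fps_zero fps_opp fps_add.
Proof. by move=> f; apply: funext => m; rewrite /fps_add addNr. Qed.

HB.instance Definition _ :=
  GRing.isZmodule.Build (fps K) fps_addA fps_addC fps_add0 fps_addN.

(* Commutativity and associativity are inherited from polynomials: the first
   [n] coefficients of a product only depend on truncations. *)
Lemma fps_mul_trunc n f g m : (m < n)%N ->
  fps_mul f g m = (\poly_(i < n) f i * \poly_(i < n) g i)`_m.
Proof.
move=> ltmn; rewrite coefM /fps_mul; apply: eq_bigr => i _.
rewrite !coef_poly (leq_ltn_trans (leq_subr _ _) ltmn).
by rewrite (leq_ltn_trans _ ltmn) // -ltnS.
Qed.

Lemma coef_poly_trunc n (p : {poly K}) g m : (m < n)%N ->
  (\poly_(i < n) p`_i * \poly_(i < n) g i)`_m = (p * \poly_(i < n) g i)`_m.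
Proof.
move=> ltmn; rewrite !coefM; apply: eq_bigr => i _.
by rewrite coef_poly (leq_ltn_trans _ ltmn) // -ltnS.
Qed.

Lemma fps_mul_truncl n f g :
  \poly_(i < n) fps_mul f g i =
  \poly_(i < n) (\poly_(i < n) f i * \poly_(i < n) g i)`_i.
Proof.
apply/polyP => i; rewrite !coef_poly; case: ifP => // lt_in.
exact: fps_mul_trunc.
Qed.

Fact fps_mulC : commutative fps_mul.
Proof.
move=> f g; apply: funext => m.
by rewrite !(@fps_mul_trunc m.+1) // mulrC.
Qed.

Fact fps_mulA : associative fps_mul.
Proof.
move=> f g h; apply: funext => m.
rewrite [RHS](@fps_mul_trunc m.+1) // fps_mul_truncl coef_poly_trunc // -mulrA.
rewrite fps_mulC (@fps_mul_trunc m.+1) // fps_mul_truncl coef_poly_trunc //.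
by rewrite mulrC.
Qed.

Fact fps_mul1 : left_id fps_one fps_mul.
Proof.
move=> f; apply: funext => m; rewrite /fps_mul big_ord_recl /= mul1r subn0.
by rewrite big1 ?addr0 // => i _; rewrite /fps_one mul0r.
Qed.

Fact fps_mulD : left_distributive fps_mul fps_add.
Proof.
move=> f g h; apply: funext => m; rewrite /fps_mul /fps_add -big_split.
by apply: eq_bigr => i _; rewrite mulrDl.
Qed.

Fact fps_one_neq0 : fps_one != (0 : fps K).
Proof.
apply/eqP => /(congr1 (fun f : fps K => f 0%N)) /eqP.
by rewrite /fps_one /= oner_eq0.
Qed.

HB.instance Definition _ := GRing.Zmodule_isComNzRing.Build (fps K)
  fps_mulA fps_mulC fps_mul1 fps_mulD fps_one_neq0.

Lemma fpsD f g m : (f + g) m = f m + g m. Proof. by []. Qed.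
Lemma fpsN f m : (- f) m = - f m. Proof. by []. Qed.
Lemma fpsB f g m : (f - g) m = f m - g m. Proof. by []. Qed.
Lemma fps0 m : (0 : fps K) m = 0. Proof. by []. Qed.
Lemma fps1 m : (1 : fps K) m = (m == 0%N)%:R. Proof. by []. Qed.
Lemma fpsM f g m : (f * g) m = \sum_(i < m.+1) f i * g (m - i)%N.
Proof. by []. Qed.

Definition fps_poly (p : {poly K}) : fps K := fun m => p`_m.

Fact fps_poly_is_additive : zmod_morphism fps_poly.
Proof. by move=> p r; apply: funext => m; rewrite /fps_poly coefB. Qed.
Fact fps_poly_is_multiplicative : monoid_morphism fps_poly.
Proof.
by split=> [|p r]; apply: funext => m; rewrite /fps_poly ?coefM // coef1 fps1.
Qed.
HB.instance Definition _ := GRing.isZmodMorphism.Build {poly K} (fps K) fps_poly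
  fps_poly_is_additive.
HB.instance Definition _ := GRing.isMonoidMorphism.Build {poly K} (fps K)
  fps_poly fps_poly_is_multiplicative.

Definition fpsX : fps K := fps_poly 'X.
Definition fpsC (c : K) : fps K := fps_poly c%:P.

Lemma fpsCM_coef c f m : (fpsC c * f) m = c * f m.
Proof.
rewrite fpsM big_ord_recl /= subn0 /fpsC /fps_poly coefC /=.
by rewrite big1 ?addr0 // => i _; rewrite coefC mul0r.
Qed.

Lemma fpsXM_coef f m : (fpsX * f) m.+1 = f m.
Proof.
rewrite fpsM 2!big_ord_recl /= /fpsX /fps_poly !coefX /= mul0r mul1r add0r.
rewrite subSS subn0 big1 ?addr0 // => i _.
by rewrite coefX /= mul0r.
Qed.

Lemma fpsXn_coef n m : (fpsX ^+ n) m = (m == n)%:R.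
Proof. by rewrite /fpsX -rmorphXn /= /fps_poly coefXn. Qed.

Lemma fpsX_inj : injective ( *%R fpsX).
Proof.
move=> f g e; apply: funext => m.
by rewrite -(fpsXM_coef f) -(fpsXM_coef g) e.
Qed.

Definition fps_small f := f 0%N = 0.

Lemma fpsM_coef0 f g : (f * g) 0%N = f 0%N * g 0%N.
Proof. by rewrite fpsM big_ord_recl big_ord0 addr0. Qed.

Lemma smallM f g : fps_small g -> fps_small (f * g).
Proof. by move=> g0; rewrite /fps_small fpsM_coef0 g0 mulr0. Qed.

(** Since [z] has no constant term, degree [m] of the product sees only lower degrees of the other
    factor. This drives the inductions on the degree. *)
Lemma fps_small_coef z f f' m : fps_small z ->
  (forall i, (i < m)%N -> f i = f' i) -> (z * f) m = (z * f') m.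
Proof.
move=> z0 eqf; rewrite !fpsM !big_ord_recl z0 !mul0r; congr (_ + _).
apply: eq_bigr => i _; rewrite eqf // lift0 ltn_subrL /=.
by apply: leq_ltn_trans (ltn_ord i).
Qed.

Lemma smallX_coef x n m : fps_small x -> (m < n)%N -> (x ^+ n) m = 0.
Proof.
move=> x0; elim: n m => // n IHn m ltmn; rewrite exprS.
rewrite (@fps_small_coef _ _ 0) ?mulr0 ?fps0 // => i ltim.
by rewrite IHn // (leq_trans ltim).
Qed.

(** Stands in for the invertibility of [1 - f]: in degree [m] the products with [f] involve only
    lower coefficients, which agree by induction. *)
Lemma fps_unitK f g g' : fps_small f -> (1 - f) * g = (1 - f) * g' -> g = g'.
Proof.
move=> f0 e; apply: funext => m; elim/ltn_ind: m => m IHm.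
have := congr1 (fun h : fps K => h m) e.
rewrite /= !mulrBl !mul1r !fpsB (@fps_small_coef f g g') // => /eqP.
by rewrite subr_eq subrK => /eqP.
Qed.

(** * Weighted sums over the natural numbers *)

(** The infinite sum of the [x ^+ n * G n]. When [x] has no constant term, the terms with [n > m] do
    not reach degree [m], so the cut-off is exact. *)
Definition gsum x (G : nat -> fps K) : fps K :=
  fun m => \sum_(n < m.+1) (x ^+ n * G n) m.

Lemma eq_gsum x G G' : G =1 G' -> gsum x G = gsum x G'.
Proof. by move/funext=> ->. Qed.

Lemma gsumD x G G' : gsum x (fun n => G n + G' n) = gsum x G + gsum x G'.
Proof.
apply: funext => m; rewrite fpsD /gsum -big_split; apply: eq_bigr => i _.
by rewrite mulrDr.
Qed.

Lemma gsum_coefE x G m N : fps_small x -> (m < N)%N ->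
  gsum x G m = \sum_(n < N) (x ^+ n * G n) m.
Proof.
move=> x0 ltmN; rewrite /gsum (big_ord_widen N (fun n => (x ^+ n * G n) m)) //.
rewrite [RHS](bigID (fun i : 'I_N => (i < m.+1)%N)) /= [X in _ = _ + X]big1 ?addr0 //.
move=> i; rewrite -leqNgt => ltmi; rewrite fpsM big1 // => j _.
by rewrite smallX_coef ?mul0r // (leq_trans _ ltmi).
Qed.

Lemma gsumZ x a G : fps_small x -> gsum x (fun n => a * G n) = a * gsum x G.
Proof.
move=> x0; apply: funext => m; rewrite fpsM.
under eq_bigr => i _ do rewrite (@gsum_coefE x G _ m.+1) ?ltnS ?leq_subr // mulr_sumr.
rewrite exchange_big /=; apply: eq_bigr => n _; rewrite mulrCA fpsM.
by apply: eq_bigr.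
Qed.

Lemma gsum_recl x G : fps_small x ->
  gsum x G = G 0%N + x * gsum x (fun n => G n.+1).
Proof.
move=> x0; apply: funext => m.
rewrite -gsumZ // fpsD (@gsum_coefE x G m m.+2) // big_ord_recl expr0 mul1r.
congr (_ + _); rewrite /gsum; apply: eq_bigr => i _.
by rewrite lift0 exprSr mulrA.
Qed.

Lemma gsum_geo x k G : fps_small x -> (forall n, G n.+1 = k * G n) ->
  (1 - x * k) * gsum x G = G 0%N.
Proof.
move=> x0 GS; rewrite mulrBl mul1r {1}gsum_recl // (eq_gsum _ GS) gsumZ //.
by rewrite mulrA addrK.
Qed.

(** The quadrant of pairs consists of its diagonal translate, where terms pick up the factor
    [x * y * k], and of the two axes, whose common point is counted twice. *)
Lemma gsum_diag x y k (F : nat -> nat -> fps K) : fps_small x -> fps_small y ->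
  (forall a n, F a.+1 n.+1 = k * F a n) ->
  (1 - x * y * k) * gsum x (fun a => gsum y (F a)) =
  gsum x (F^~ 0%N) + gsum y (F 0%N) - F 0%N 0%N.
Proof.
move=> x0 y0 FS; rewrite mulrBl mul1r.
have E : gsum x (fun a => gsum y (F a.+1)) =
    gsum x (fun a => F a.+1 0%N) + y * (k * gsum x (fun a => gsum y (F a))).
  rewrite -!gsumZ // -gsumD; apply: eq_gsum => a.
  rewrite gsum_recl //; congr (_ + y * _).
  by rewrite -gsumZ //; apply: eq_gsum => n; rewrite FS.
rewrite {1}gsum_recl // E [gsum x (F^~ _)]gsum_recl //; ring.
Qed.

(** Degree [m] at [F] reduces to lower degrees at the shifted family, so the induction has to run
    over all families at once. *)
Lemma gsum2_coef_ind z (Psi : (nat -> nat -> fps K) -> fps K) : fps_small z ->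
  (forall F, Psi F = z * Psi (fun a b => F a.+1 b.+1)) -> forall F, Psi F = 0.
Proof.
move=> z0 PsiS F; apply: funext => m; elim/ltn_ind: m F => m IHm F.
by rewrite PsiS (@fps_small_coef z _ 0) ?mulr0 // => i ltim; rewrite IHm.
Qed.

(** Pairs are indexed by minimum and difference; the successor in the second term leaves the
    diagonal to the first. The defect of the identity reproduces itself with factor [x * y] when
    both indices are shifted, so it vanishes. *)
Lemma gsum_minmax x y (F : nat -> nat -> fps K) : fps_small x -> fps_small y ->
  gsum x (fun a => gsum y (F a)) =
  gsum (x * y) (fun a => gsum x (fun l => F (a + l)%N a) +
                         y * gsum y (fun l => F a (a + l).+1)).
Proof.
move=> x0 y0; pose Psi G := gsum x (fun a => gsum y (G a)) -
  gsum (x * y) (fun a => gsum x (fun l => G (a + l)%N a) +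
                         y * gsum y (fun l => G a (a + l).+1)).
have xy0 : fps_small (x * y) by exact: smallM.
apply/eqP; rewrite -subr_eq0; apply/eqP; rewrite -/(Psi F).
apply: (gsum2_coef_ind xy0) => {}F; rewrite /Psi.
rewrite [in LHS]gsum_recl // [gsum (x * y) _]gsum_recl //=.
have E : gsum x (fun a => gsum y (F a.+1)) = gsum x (fun a => F a.+1 0%N) +
    y * gsum x (fun a => gsum y (fun b => F a.+1 b.+1)).
  by rewrite -gsumZ // -gsumD; apply: eq_gsum => a; rewrite gsum_recl.
rewrite E [gsum y (F 0%N)]gsum_recl // [gsum x (fun l => F (0 + l)%N 0%N)]gsum_recl //.
under [gsum x (fun n => F (0 + n.+1)%N 0%N)]eq_gsum do rewrite add0n.
under [gsum y (fun l => F 0%N (0 + l).+1)]eq_gsum do rewrite add0n.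
rewrite add0n; ring.
Qed.

(** The expansion by minimum and difference is symmetric in the two variables, except for the half
    to which the diagonal is given. *)
Lemma gsum_exchange x y (F : nat -> nat -> fps K) : fps_small x -> fps_small y ->
  gsum x (fun a => gsum y (F a)) = gsum y (fun b => gsum x (F^~ b)).
Proof.
move=> x0 y0; rewrite (gsum_minmax _ x0 y0) (gsum_minmax (fun b a => F a b) y0 x0).
rewrite mulrC; apply: eq_gsum => a.
rewrite [gsum x _ in LHS]gsum_recl // [gsum y _ in RHS]gsum_recl // !addn0.
rewrite -!addrA; congr (_ + _); rewrite addrC.
by congr (y * _ + x * _); apply: eq_gsum => l; rewrite addnS.
Qed.

End FpsRing.

(** * Counting *)

Definition counts (T : eqType) (P : T -> Prop) (n : nat) : Prop :=
  exists s : seq T, [/\ uniq s, size s = n & forall x, P x <-> x \in s].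

Lemma eq_counts (T : eqType) (P Q : T -> Prop) n :
  (forall x, P x <-> Q x) -> counts P n -> counts Q n.
Proof.
by move=> PQ [s [us ss Ps]]; exists s; split=> // x; rewrite -PQ.
Qed.

Lemma counts0 (T : eqType) (P : T -> Prop) : (forall x, ~ P x) -> counts P 0.
Proof. by move=> nP; exists [::]; split=> // x; split=> // /nP. Qed.

Lemma countsU (T : eqType) (P Q : T -> Prop) n m :
  counts P n -> counts Q m -> (forall x, P x -> ~ Q x) ->
  counts (fun x => P x \/ Q x) (n + m).
Proof.
move=> [s [us <- Ps]] [t [ut <- Qt]] dPQ; exists (s ++ t).
rewrite size_cat cat_uniq us ut andbT; split=> // [|x].
  by apply/hasPn => x /Qt Qx; apply/negP => /Ps Px; apply: dPQ Px Qx.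
rewrite mem_cat; split=> [[/Ps->//|/Qt->]|/orP[/Ps|/Qt]]; first by rewrite orbT.
  by left.
by right.
Qed.

Lemma counts_fib (T S : eqType) (P : T -> Prop) (Q : S -> Prop) (f : T -> S) n k :
  (forall x, P x -> Q (f x)) -> counts Q n ->
  (forall y, Q y -> counts (fun x => P x /\ f x = y) k) -> counts P (n * k).
Proof.
move=> PQ [s [us <- Qs]] fib.
have {}PQ x : P x -> f x \in s by move/PQ/Qs.
have {fib Qs Q}fib y : y \in s -> counts (fun x => P x /\ f x = y) k.
  by move/Qs/fib.
elim: s us P PQ fib => [|y s IHs] /= => [_|/andP[y's us]] P PQ fib.
  by apply: counts0 => x /PQ.
have Pn : counts (fun x => P x /\ f x <> y) (size s * k).
  apply: (IHs us) => [x [Px fx]|z zs].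
    by have := PQ _ Px; rewrite inE => /orP[/eqP|].
  have z'y : z <> y by move=> zy; rewrite -zy zs in y's.
  have := fib z; rewrite inE zs orbT => /(_ isT); apply: eq_counts => x.
  by split=> [[Px fx]|[[Px _] fx]]; rewrite ?fx.
have := countsU (fib y (mem_head _ _)) Pn; rewrite mulSn => cU.
apply: eq_counts (cU _) => [x|x [_ ->] [//]].
by have [->|] := pselect (f x = y); tauto.
Qed.

Lemma counts_bigU (T : eqType) (P : nat -> T -> Prop) (n : nat -> nat) N :
  (forall i, (i < N)%N -> counts (P i) (n i)) ->
  (forall i j x, P i x -> P j x -> i = j) ->
  counts (fun x => exists2 i, (i < N)%N & P i x) (\sum_(i < N) n i).
Proof.
move=> cP disj; elim: N cP => [|N IHN] cP.
  by rewrite big_ord0; apply: counts0 => x [].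
rewrite big_ord_recr /=.
have cU := countsU (IHN (fun i iN => cP i (ltnW iN))) (cP N (ltnSn N)).
apply: eq_counts (cU _) => x; last first.
  by case=> i iN Pi PN; rewrite (disj _ _ _ Pi PN) ltnn in iN.
split=> [[[i iN Pi]|PN]|[i]].
- by exists i => //; rewrite ltnS ltnW.
- by exists N.
- by rewrite ltnS leq_eqVlt => /orP[/eqP->|iN] Pi; [right|left; exists i].
Qed.

Fixpoint msumn (m k : nat) (F : seq nat -> nat) : nat :=
  if k is k'.+1 then \sum_(i < m.+1) msumn m k' (fun t => F (nat_of_ord i :: t)) else F [::].

Lemma counts_msumn (T : eqType) m k (P : seq nat -> T -> Prop) (n : seq nat -> nat) :
  (forall t, size t = k -> counts (P t) (n t)) ->
  (forall t t' x, size t = k -> size t' = k -> P t x -> P t' x -> t = t') ->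
  counts (fun x => exists t, [/\ size t = k, all (fun i => i <= m)%N t & P t x])
         (msumn m k n).
Proof.
elim: k P n => [|k IHk] P n cP disj /=.
  apply: eq_counts (cP [::] erefl) => x; split=> [Px|[t [/size0nil-> _ //]]].
  by exists [::].
have disj2 i j t t' x : size t = k -> size t' = k -> P (i :: t) x ->
    P (j :: t') x -> i = j /\ t = t'.
  move=> st st' Pt Pt'.
  suff [-> ->] : i :: t = j :: t' by [].
  by apply: (disj _ _ x) => //=; rewrite ?st ?st'.
have cN i : (i < m.+1)%N -> counts (fun x => exists t, [/\ size t = k,
    all (fun i => i <= m)%N t & P (i :: t) x]) (msumn m k (fun t => n (i :: t))).
  move=> iN; apply: (IHk (fun t => P (i :: t)) (fun t => n (i :: t))) => [t st|].
    by apply: cP; rewrite /= st.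
  by move=> t t' x st st' Pt Pt'; case: (disj2 i i t t' x st st' Pt Pt').
have [s [us ss Ps]] : counts (fun x => exists2 i, (i < m.+1)%N & exists t,
    [/\ size t = k, all (fun i => i <= m)%N t & P (i :: t) x])
    (\sum_(i < m.+1) msumn m k (fun t => n (nat_of_ord i :: t))).
  apply: (counts_bigU cN) => i j x [t [st _ Pt]] [t' [st' _ Pt']].
  by case: (disj2 i j t t' x st st' Pt Pt').
exists s; split=> // x; rewrite -Ps; split=> [[[|i t] [//= [st] tm Pt]]|].
  by case/andP: tm => im tm; exists i => //; exists t.
by case=> i im [t [st tm Pt]]; exists (i :: t); rewrite /= st -ltnS im.
Qed.

(* Each index is cut off at [m]: this does not affect the coefficient of index
   [m] when [F t] has order at least every entry of [t]. *)
Definition msum (K : comNzRingType) :=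
  fix loop (k : nat) (F : seq nat -> fps K) : fps K :=
  if k is k'.+1 then fun m => \sum_(i < m.+1) loop k' (fun t => F (nat_of_ord i :: t)) m
  else F [::].

Lemma msum_coef (K : comNzRingType) k (F : seq nat -> fps K) m n :
  (forall t, size t = k -> F t m = (n t)%:R) -> msum k F m = (msumn m k n)%:R.
Proof.
elim: k F n => [|k IHk] F n Fn /=; first exact: Fn.
rewrite natr_sum; apply: eq_bigr => i _; apply: IHk => t st.
by apply: Fn; rewrite /= st.
Qed.

(** * Submodules and indices *)

Section Index.
Variable R : comNzRingType.

Definition submod (V : lmodType R) (U : V -> Prop) : Prop :=
  [/\ U 0, (forall u v, U u -> U v -> U (u + v)) & (forall a u, U u -> U (a *: u))].

Section Submod.
Variables (V : lmodType R) (U : V -> Prop).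
Hypothesis sU : submod U.

Lemma submod0 : U 0. Proof. by case: sU. Qed.
Lemma submodD u v : U u -> U v -> U (u + v). Proof. by case: sU => ? D ?; apply: D. Qed.
Lemma submodZ a u : U u -> U (a *: u). Proof. by case: sU => ? ? Z; apply: Z. Qed.
Lemma submodN u : U u -> U (- u).
Proof. by rewrite -scaleN1r; apply: submodZ. Qed.
Lemma submodB u v : U u -> U v -> U (u - v).
Proof. by move=> Uu Uv; apply: submodD => //; apply: submodN. Qed.
Lemma submodDr u v : U v -> U (u + v) <-> U u.
Proof.
move=> Uv; split=> Uu; last exact: submodD.
by rewrite -[u](addrK v); apply: submodB.
Qed.
Lemma submodBC u v : U (u - v) -> U (v - u).
Proof. by move/submodN; rewrite opprB. Qed.
Lemma submodB_trans v u w : U (u - v) -> U (v - w) -> U (u - w).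
Proof. by move=> uv vw; rewrite -(subrK v u) -addrA; apply: submodD. Qed.

End Submod.

Lemma submodT (V : lmodType R) : submod (fun _ : V => True).
Proof. by []. Qed.

Definition transversal (V : lmodType R) (L C : V -> Prop) (s : seq V) : Prop :=
  [/\ uniq s, (forall x, x \in s -> C x),
      (forall v, C v -> exists2 x, x \in s & L (v - x)) &
      {in s &, forall x y, L (x - y) -> x = y}].

(* [C] is a union of cosets of [L]; it need not be a submodule. *)
Definition idx (V : lmodType R) (L C : V -> Prop) (n : nat) : Prop :=
  exists2 s, size s = n & transversal L C s.

Section IdxTheory.
Variables (V : lmodType R).
Implicit Types (L C D U M : V -> Prop).

(** Sending each representative of one transversal to the representative of its coset in the other
    is injective. *)
Lemma idx_leq L C n m : submod L -> idx L C n -> idx L C m -> (n <= m)%N.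
Proof.
move=> sL [s <- [us sC _ sinj]] [t <- [_ _ tcov _]].
have /choice[f fP] x : exists y, x \in s -> (y \in t) /\ L (x - y).
  case: (boolP (x \in s)) => [/sC/tcov[y yt Ly]|_]; last by exists 0.
  by exists y.
rewrite -(size_map f); apply: uniq_leq_size => [|_ /mapP[x xs ->]]; last by case: (fP x).
rewrite map_inj_in_uniq // => x y xs ys efxy.
have [_ Lx] := fP x xs; have [_ Ly] := fP y ys.
apply: sinj => //; apply: (submodB_trans sL Lx).
by rewrite efxy; apply: submodBC.
Qed.

Lemma idx_inj L C n m : submod L -> idx L C n -> idx L C m -> n = m.
Proof. by move=> sL Cn Cm; apply/eqP; rewrite eqn_leq !(@idx_leq L C). Qed.

Lemma eq_idx L C L' C' n : (forall v, L v <-> L' v) -> (forall v, C v <-> C' v) ->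
  idx L C n -> idx L' C' n.
Proof.
move=> eL eC; suff [-> ->] : L = L' /\ C = C' by [].
by split; apply: funext => v; apply: propext.
Qed.

Lemma idx_refl L : submod L -> idx L L 1.
Proof.
move=> sL; exists [:: 0] => //; split=> // [x|v Lv|x y].
- by rewrite inE => /eqP->; apply: submod0.
- by exists 0; rewrite ?mem_head ?subr0.
- by rewrite !inE => /eqP-> /eqP->.
Qed.

Lemma idx_coset L C x : submod L -> (forall v, C v <-> L (v - x)) -> idx L C 1.
Proof.
move=> sL CE; exists [:: x] => //; split=> // [y|v /CE Lv|y z].
- by rewrite inE => /eqP->; apply/CE; rewrite subrr; apply: submod0.
- by exists x; rewrite ?mem_head.
- by rewrite !inE => /eqP-> /eqP->.
Qed.

Lemma idx_tower L M C n m : submod L -> submod M -> (forall v, L v -> M v) ->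
  (forall u v, C u -> M v -> C (u + v)) ->
  idx L M n -> idx M C m -> idx L C (n * m).
Proof.
move=> sL sM LM CM [s <- [us sMs scov sinj]] [t <- [ut tC tcov tinj]].
have inj : {in [seq (x, y) | x <- s, y <- t] &, forall p p',
    L ((p.1 + p.2) - (p'.1 + p'.2)) -> p = p'}.
  move=> _ _ /allpairsP[[x y] [/= xs yt ->]] /allpairsP[[x' y'] [/= xs' yt' ->]] /= Lxy.
  have Myy : M (y - y').
    move/LM: Lxy; rewrite opprD addrACA addrC.
    have Mx : M (x - x') by apply: (submodB sM); apply: sMs.
    by case: (submodDr sM (y - y') Mx).
  have yy' : y = y' by apply: tinj.
  congr (_, _) => //; apply: sinj => //.
  by move: Lxy; rewrite yy' opprD addrACA subrr addr0.
exists [seq p.1 + p.2 | p <- [seq (x, y) | x <- s, y <- t]].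
  by rewrite size_map size_allpairs.
split.
- rewrite map_inj_in_uniq => [|p p' ps ps' e]; last first.
    by apply: inj => //; rewrite e subrr; apply: submod0.
  by apply: allpairs_uniq => // -[x y] [x' y'].
- move=> _ /mapP[_ /allpairsP[[x y] [/= xs yt ->]] ->] /=.
  by rewrite addrC; apply: CM; [apply: tC|apply: sMs].
- move=> v /tcov[y yt /scov[x xs Lx]]; exists (x + y).
    by apply/mapP; exists (x, y) => //; apply/allpairsP; exists (x, y).
  by rewrite opprD addrCA addrC -addrA addrC in Lx *; move: Lx; rewrite -addrA [- x + _]addrC addrA.
- move=> _ _ /mapP[p ps ->] /mapP[p' ps' ->] /inj-> //.
Qed.

Lemma idx_diff L C D n m : submod L -> (forall u v, C u -> L v -> C (u + v)) ->
  (forall u v, D u -> L v -> D (u + v)) ->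
  (forall v, D v -> C v) -> idx L C n -> idx L D m ->
  idx L (fun v => C v /\ ~ D v) (n - m).
Proof.
move=> sL CL DL DC [s <- [us sC scov sinj]] Dm.
(* As [E] is a union of cosets of [L], the representatives lying in [E] already form a transversal
   of [E]. *)
have subP (E : V -> Prop) : (forall v, E v -> C v) ->
    (forall u v, E u -> L v -> E (u + v)) ->
    transversal L E [seq x <- s | `[< E x >]].
  move=> EC EL; split; first exact: filter_uniq.
  - by move=> x; rewrite mem_filter => /andP[/asboolP].
  - move=> v Ev; have [x xs Lx] := scov v (EC _ Ev); exists x => //.
    rewrite mem_filter xs andbT; apply/asboolP.
    by rewrite -(subrK v x) addrC; apply: EL => //; apply: submodBC.
  - by move=> x y; rewrite !mem_filter => /andP[_ xs] /andP[_ ys]; apply: sinj.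
exists [seq x <- s | `[< C x /\ ~ D x >]]; last first.
  apply: subP => [v []//|u v [Cu nDu] Lv]; split; first exact: CL.
  move=> Duv; apply: nDu; rewrite -(addrK v u).
  by apply: DL => //; apply: submodN.
have -> : m = size [seq x <- s | `[< D x >]].
  by apply: (idx_inj sL Dm); exists [seq x <- s | `[< D x >]] => //; apply: subP.
rewrite !size_filter -(count_predC (fun x => `[< D x >]) s) addKn.
apply: eq_in_count => x /sC Cx /=; apply/asboolP/negP => [[_ nD] /asboolP//|nD].
by split=> // Dx; apply: nD; apply/asboolP.
Qed.

End IdxTheory.
End Index.

Definition tail (A : nmodType) (B : Type) (U : A * B -> Prop) : B -> Prop :=
  fun v => U (0, v).

Section Extensions.
Variables (R : comNzRingType) (A B : lmodType R).

Lemma submod_tail (U : A * B -> Prop) : submod U -> submod (tail U).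
Proof.
move=> sU; split; first exact: (submod0 sU).
  move=> u v Uu Uv; have := submodD sU Uu Uv.
  by congr U; congr (_, _); rewrite /= addr0.
by move=> a u Uu; have := submodZ sU a Uu; congr U; congr (_, _); rewrite /= scaler0.
Qed.

(** A pair is reduced in two steps: subtracting an element of [U] brings the first coordinate to a
    representative, then the second is reduced modulo the tail. The subtracted lift must lie in [C]
    so that the second step stays there. *)
Lemma idx_ext (U : A * B -> Prop) (M X : A -> Prop) (C : B -> Prop) n1 n2 :
  submod U -> submod C -> (forall a z, U (a, z) -> M a) ->
  (forall a, M a -> exists2 z, C z & U (a, z)) ->
  idx M X n1 -> idx (tail U) C n2 ->
  idx U (fun p => X p.1 /\ C p.2) (n1 * n2).
Proof.
move=> sU sC UM MU [s <- [us sX scov sinj]] [t <- [ut tC tcov tinj]].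
exists [seq (x, y) | x <- s, y <- t]; first by rewrite size_allpairs.
split.
- by apply: allpairs_uniq => // -[x y] [x' y'].
- by move=> _ /allpairsP[[x y] [/= xs yt ->]] /=; split; [apply: sX|apply: tC].
- move=> [r z] [/= /scov[x xs /MU[z0 Cz0 Uz0]] Cz].
  have /tcov[y yt Ly] : C (z - z0) by apply: submodB.
  exists (x, y); first by apply/allpairsP; exists (x, y).
  have := submodD sU Uz0 Ly; congr U; congr (_, _); rewrite /= ?addr0 //.
  by rewrite addrA [z0 + _]addrC subrK.
- move=> _ _ /allpairsP[[x y] [/= xs yt ->]] /allpairsP[[x' y'] [/= xs' yt' ->]] Ud.
  have xx' : x = x' by apply: sinj => //; apply: UM Ud.
  congr (_, _) => //; apply: tinj => //; move: Ud; rewrite xx' /tail.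
  by congr U; congr (_, _); rewrite /= subrr.
Qed.

(** As [M] is free on [m1] and [m2], such a [U] amounts to an independent choice of a coset of lifts
    modulo [L] for each of the two basis vectors. *)
Lemma counts_ext2 (m1 m2 : A) (M : A -> Prop) (L C1 C2 : B -> Prop) n1 n2 :
  (forall a, M a <-> exists r1 r2, a = r1 *: m1 + r2 *: m2) ->
  (forall r1 r2, r1 *: m1 + r2 *: m2 = 0 -> r1 = 0 /\ r2 = 0) ->
  submod L -> (forall z l, C1 z -> L l -> C1 (z + l)) ->
  (forall z l, C2 z -> L l -> C2 (z + l)) -> idx L C1 n1 -> idx L C2 n2 ->
  counts (fun U : A * B -> Prop => [/\ submod U, tail U = L,
    (forall a, M a <-> exists z, U (a, z)), (forall z, U (m1, z) -> C1 z) &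
    (forall z, U (m2, z) -> C2 z)]) (n1 * n2).
Proof.
move=> ME indep sL C1L C2L [s <- [us sC1 scov sinj]] [t <- [ut tC2 tcov tinj]].
(* [f z] is the span of [L], placed in the second factor, and the two lifts [(m1, z.1)] and
   [(m2, z.2)]. *)
pose f (z : B * B) (p : A * B) := exists r1 r2,
  p.1 = r1 *: m1 + r2 *: m2 /\ L (p.2 - (r1 *: z.1 + r2 *: z.2)).
have indep' r1 r2 r1' r2' : r1 *: m1 + r2 *: m2 = r1' *: m1 + r2' *: m2 ->
    r1 = r1' /\ r2 = r2'.
  move/eqP; rewrite -subr_eq0 opprD addrACA -!scalerBl => /eqP/indep[/eqP + /eqP].
  by rewrite !subr_eq0 => /eqP-> /eqP->.
have f1 z y : f z (m1, y) <-> L (y - z.1).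
  split=> [[r1 [r2 [/= e Lz]]]|Ly]; last first.
    by exists 1, 0; rewrite !scale1r !scale0r !addr0.
  have [|e1 e2] := indep' 1 0 r1 r2; first by rewrite -e scale1r scale0r addr0.
  by move: Lz; rewrite -e1 -e2 scale1r scale0r addr0.
have f2 z y : f z (m2, y) <-> L (y - z.2).
  split=> [[r1 [r2 [/= e Lz]]]|Ly]; last first.
    by exists 0, 1; rewrite !scale1r !scale0r !add0r.
  have [|e1 e2] := indep' 0 1 r1 r2; first by rewrite -e scale1r scale0r add0r.
  by move: Lz; rewrite -e1 -e2 scale1r scale0r add0r.
have sf z : submod (f z).
  split; first by exists 0, 0; rewrite !scale0r !addr0 subr0; split=> //; apply: submod0.
    move=> u v [r1 [r2 [e Lu]]] [r1' [r2' [e' Lv]]]; exists (r1 + r1'), (r2 + r2').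
    rewrite /= e e' !scalerDl; split; first by rewrite addrACA.
    by have := submodD sL Lu Lv; congr L; rewrite addrACA -opprD addrACA [_ *: z.2 + _ in RHS]addrC; congr (_ - _); rewrite [r2' *: _ + _]addrC.
  move=> a u [r1 [r2 [e Lu]]]; exists (a * r1), (a * r2).
  rewrite /= e scalerDr !scalerA; split=> //.
  by have := submodZ sL a Lu; rewrite scalerBr scalerDr !scalerA.
exists [seq f z | z <- [seq (x, y) | x <- s, y <- t]]; split.
- rewrite map_inj_in_uniq.
    by apply: allpairs_uniq => // -[x y] [x' y'].
  move=> _ _ /allpairsP[[x y] [/= xs yt ->]] /allpairsP[[x' y'] [/= xs' yt' ->]] ef.
  congr (_, _).
    apply: sinj => //; have := f1 (x', y') x; rewrite -ef => -[+ _]; apply.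
    by apply/f1; rewrite subrr; apply: submod0.
  apply: tinj => //; have := f2 (x', y') y; rewrite -ef => -[+ _]; apply.
  by apply/f2; rewrite subrr; apply: submod0.
- by rewrite size_map size_allpairs.
move=> U; split; last first.
  case/mapP => _ /allpairsP[[x y] [/= xs yt ->]] ->; split=> //.
  - apply: funext => v; apply: propext; split=> [[r1 [r2 [/= e Lv]]]|Lv]; last first.
      by exists 0, 0; rewrite !scale0r !addr0 subr0.
    by have [e1 e2] := indep _ _ (esym e); move: Lv; rewrite e1 e2 !scale0r addr0 subr0.
  - move=> a; rewrite ME; split=> [[r1 [r2 e]]|[z [r1 [r2 [e _]]]]]; last by exists r1, r2.
    exists (r1 *: x + r2 *: y), r1, r2; split=> //=.
    by rewrite subrr; apply: submod0.
  - by move=> z /f1 Lz; rewrite -(subrK x z) addrC; apply: C1L => //; apply: sC1.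
  - by move=> z /f2 Lz; rewrite -(subrK y z) addrC; apply: C2L => //; apply: tC2.
case=> sU tU MU U1 U2.
have [z1 Uz1] : exists z, U (m1, z).
  by apply/MU/ME; exists 1, 0; rewrite scale1r scale0r addr0.
have [z2 Uz2] : exists z, U (m2, z).
  by apply/MU/ME; exists 0, 1; rewrite scale1r scale0r add0r.
have [x xs Lx] := scov _ (U1 _ Uz1); have [y yt Ly] := tcov _ (U2 _ Uz2).
apply/mapP; exists (x, y); first by apply/allpairsP; exists (x, y).
have LU l : L l <-> U (0, l) by rewrite -tU.
have Ux : U (m1, x).
  have := submodB sU Uz1 (proj1 (LU _) Lx); congr U; congr (_, _); rewrite /= ?subr0 //.
  by rewrite opprB addrC subrK.
have Uy : U (m2, y).
  have := submodB sU Uz2 (proj1 (LU _) Ly); congr U; congr (_, _); rewrite /= ?subr0 //.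
  by rewrite opprB addrC subrK.
have Uxy r1 r2 : U (r1 *: m1 + r2 *: m2, r1 *: x + r2 *: y).
  exact: (submodD sU (submodZ sU r1 Ux) (submodZ sU r2 Uy)).
apply: funext => -[a z]; apply: propext; split=> [Uaz|[r1 [r2 [/= -> /LU Lz]]]].
  have /ME[r1 [r2 e]] : M a by apply/MU; exists z.
  exists r1, r2; split=> //=; apply/LU.
  have := submodB sU Uaz (Uxy r1 r2); congr U; congr (_, _).
  by rewrite /= e subrr.
have := submodD sU Lz (Uxy r1 r2); congr U; congr (_, _); rewrite /= ?add0r //.
by rewrite subrK.
Qed.

End Extensions.

Lemma idx_bij (R : comNzRingType) (V W : lmodType R) (h : W -> V) (g : V -> W)
    (L C : V -> Prop) n :
  (forall u v, h (u - v) = h u - h v) -> cancel g h -> cancel h g ->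
  idx (fun w => L (h w)) (fun w => C (h w)) n -> idx L C n.
Proof.
move=> hB gK hK [s <- [us sC scov sinj]]; exists (map h s); first by rewrite size_map.
split.
- by rewrite map_inj_uniq //; apply: can_inj hK.
- by move=> _ /mapP[x xs ->]; apply: sC.
- move=> v Cv; have [|x xs Lx] := scov (g v); first by rewrite gK.
  by exists (h x); [apply: map_f|move: Lx; rewrite hB gK].
- move=> _ _ /mapP[x xs ->] /mapP[y ys ->]; rewrite -hB => Lxy.
  by congr (h _); apply: sinj.
Qed.

(** * Discrete valuation rings *)

Definition dvr (R : idomainType) (pi : R) (q : nat) : Prop :=
  [/\ pi != 0, pi \notin GRing.unit,
      (forall x : R, x != 0 -> exists u : R, exists k : nat,
        u \is a GRing.unit /\ x = u * pi ^+ k) &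
      idx (rdiv pi : R^o -> Prop) (fun=> True) q].

(* Number of units modulo [pi ^+ j]. *)
Definition phi (q j : nat) : nat := if j is j'.+1 then (q ^ j - q ^ j')%N else 1%N.

Section DVR.
Variables (R : idomainType) (pi : R) (q : nat).
Hypothesis Rdvr : dvr pi q.

Let pi0 : pi != 0. Proof. by case: Rdvr. Qed.
Let piNunit : pi \notin GRing.unit. Proof. by case: Rdvr. Qed.
Let piX0 k : pi ^+ k != 0. Proof. exact: expf_neq0. Qed.

Definition pdiv (k : nat) : R^o -> Prop := rdiv (pi ^+ k).

Lemma submod_pdiv k : submod (pdiv k).
Proof.
split; first by exists 0; rewrite mul0r.
  by move=> u v [c ->] [d ->]; exists (c + d); rewrite mulrDl.
by move=> a u [c ->]; exists (a * c); rewrite /GRing.scale /= mulrA.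
Qed.

Lemma pdiv0 r : pdiv 0 r. Proof. by exists r; rewrite mulr1. Qed.

Lemma pdiv_scale k a r : pdiv k r -> pdiv k (a * r : R).
Proof. exact: (submodZ (submod_pdiv k)). Qed.

Lemma pdiv_leq a b r : (a <= b)%N -> pdiv b r -> pdiv a r.
Proof. by move=> ab [c ->]; exists (c * pi ^+ (b - a)); rewrite -mulrA -exprD subnK. Qed.

Lemma pdivX a b : pdiv a (pi ^+ b) <-> (a <= b)%N.
Proof.
split=> [[c e]|ab]; last by apply: pdiv_leq ab _; exists 1; rewrite mul1r.
rewrite leqNgt; apply/negP => ltba.
suff: pi \is a GRing.unit by rewrite (negPf piNunit).
apply/unitrPr; exists (c * pi ^+ (a - b).-1).
apply: (mulIf (piX0 b)); rewrite mul1r {2}e mulrCA -!mulrA; congr (_ * _).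
by rewrite mulrA -exprS -exprD; congr (_ ^+ _); lia.
Qed.

Lemma pdiv_unit a u r : u \is a GRing.unit -> pdiv a (u * r : R) <-> pdiv a r.
Proof.
move=> Uu; split=> [|ar]; last exact: pdiv_scale.
by move/(pdiv_scale u^-1); rewrite mulKr.
Qed.

Lemma pdivMX a k r : pdiv a (pi ^+ k * r : R) <-> pdiv (a - k) r.
Proof.
have [ka|ak] := leqP k a.
  split=> -[c e]; exists c; last by rewrite e mulrCA -exprD subnKC.
  by apply: (mulfI (piX0 k)); rewrite e mulrCA -exprD subnKC.
have -> : (a - k = 0)%N by lia.
split=> _; first exact: pdiv0.
by rewrite mulrC; apply: pdiv_scale; apply/pdivX; lia.
Qed.

Lemma pdiv_unitX a u b : u \is a GRing.unit -> pdiv a (u * pi ^+ b : R) <-> (a <= b)%N.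
Proof. by move=> Uu; rewrite -pdivX; apply: pdiv_unit. Qed.

Lemma pdiv_inj a b : (forall r, pdiv a r <-> pdiv b r) -> a = b.
Proof.
move=> e; apply/eqP; rewrite eqn_leq; apply/andP; split; apply/pdivX.
  by apply/e/pdivX.
by apply/e/pdivX.
Qed.

(** The least power of [pi] in [I] generates it, since every nonzero element is a unit times a power
    of [pi]. The given power keeps [I] from being zero. *)
Lemma ideal_pdiv (I : R^o -> Prop) a : submod I -> I (pi ^+ a : R) ->
  exists k, forall r, I r <-> pdiv k r.
Proof.
move=> sI Ia; have exI : exists k, `[< I (pi ^+ k : R) >] by exists a; apply/asboolP.
case: (ex_minnP exI) => k /asboolP Ik kmin; exists k => r; split=> [Ir|[c ->]]; last first.
  exact: (submodZ sI c Ik).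
have [->|r0] := eqVneq r 0; first exact: (submod0 (submod_pdiv k)).
have [_ _ fact _] := Rdvr; have [u [j [Uu e]]] := fact _ r0.
rewrite e; apply/(pdiv_unitX _ _ Uu); apply: kmin; apply/asboolP.
have := submodZ sI u^-1 Ir; rewrite e /GRing.scale /=.
by rewrite mulKr.
Qed.

Lemma idx_pdivS a : idx (pdiv a.+1) (pdiv a) q.
Proof.
have [_ _ _ [s <- [us _ scov sinj]]] := Rdvr.
exists [seq (x : R) * pi ^+ a : R^o | x <- s]; first by rewrite size_map.
split.
- by rewrite map_inj_uniq //; apply: mulIf.
- by move=> _ /mapP[x _ ->]; exists x.
- move=> _ [c ->]; have [//|x xs [d e]] := scov c; exists (x * pi ^+ a); first exact: map_f.
  by exists d; rewrite -mulrBl e exprS mulrA.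
- move=> _ _ /mapP[x xs ->] /mapP[y ys ->] [d]; rewrite -mulrBl exprS mulrA => e.
  by congr (_ * _); apply: sinj => //; exists d; apply: mulIf e.
Qed.

Lemma idx_pdivD a k : idx (pdiv (a + k)) (pdiv a) (q ^ k).
Proof.
elim: k => [|k IHk]; first by rewrite addn0; apply: idx_refl; apply: submod_pdiv.
rewrite addnS expnS; apply: idx_tower (idx_pdivS _) IHk; try exact: submod_pdiv.
- by move=> v; apply: pdiv_leq.
- move=> u v au av; apply: (submodD (submod_pdiv a)) => //.
  by apply: pdiv_leq av; apply: leq_addr.
Qed.

Lemma idx_pdiv a b : (a <= b)%N -> idx (pdiv b) (pdiv a) (q ^ (b - a)).
Proof. by move=> ab; have := idx_pdivD a (b - a); rewrite subnKC. Qed.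

Lemma idx_pdivT a : idx (pdiv a) (fun=> True) (q ^ a).
Proof.
have := idx_pdivD 0 a; rewrite add0n; apply: eq_idx => // v.
by split=> // _; apply: pdiv0.
Qed.

(** For [j > 0] this says that [x] has valuation exactly [b]; for [j = 0] it only says that
    [pi ^+ b] divides [x]. This is why [phi q 0] is [1]. *)
Definition unitX (b j : nat) (x : R^o) : Prop :=
  exists2 u : R, u \is a GRing.unit & pdiv (b + j) (x - u * pi ^+ b : R).

Lemma unitXD b j x l : unitX b j x -> pdiv (b + j) l -> unitX b j (x + l).
Proof.
move=> [u Uu px] pl; exists u => //; rewrite addrAC.
exact: (submodD (submod_pdiv _)).
Qed.

Lemma unitX_pdiv b j x : unitX b j x -> pdiv b x.
Proof.
move=> [u Uu px]; rewrite -(subrK (u * pi ^+ b : R) x).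
apply: (submodD (submod_pdiv b)); first by apply: pdiv_leq px; apply: leq_addr.
by apply/(pdiv_unitX _ _ Uu).
Qed.

Lemma idx_unitX b j : idx (pdiv (b + j)) (unitX b j) (phi q j).
Proof.
case: j => [|j].
  apply: (idx_coset (x := 0)); first exact: submod_pdiv.
  move=> v; rewrite subr0 addn0; split=> [/unitX_pdiv //|bv].
  exists 1; first exact: unitr1.
  by rewrite addn0 mul1r; apply: (submodB (submod_pdiv b)) => //; apply/pdivX.
have i2 : idx (pdiv (b + j.+1)) (pdiv b.+1) (q ^ j).
  by have := idx_pdivD b.+1 j; rewrite addSnnS.
have bD u v : pdiv b u -> pdiv (b + j.+1) v -> pdiv b (u + v).
  by move=> bu bv; apply: (submodD (submod_pdiv b)) => //; apply: pdiv_leq bv; lia.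
have b1D u v : pdiv b.+1 u -> pdiv (b + j.+1) v -> pdiv b.+1 (u + v).
  by move=> bu bv; apply: (submodD (submod_pdiv b.+1)) => //; apply: pdiv_leq bv; lia.
have b1b v : pdiv b.+1 v -> pdiv b v by apply: pdiv_leq.
apply: (eq_idx _ _ (idx_diff (submod_pdiv (b + j.+1)) bD b1D b1b (idx_pdivD b j.+1) i2)) => //.
move=> v; split=> [[bv nbv]|ux]; last first.
    split; first exact: unitX_pdiv ux.
    case: ux => u Uu px bv.
    suff /(pdiv_unitX _ _ Uu) : pdiv b.+1 (u * pi ^+ b : R) by rewrite ltnn.
    rewrite -[_ * _](subKr (v : R)); apply: (submodB (submod_pdiv b.+1)) => //.
    by apply: pdiv_leq px; lia.
  have v0 : v != 0 by apply/eqP => v0; apply: nbv; rewrite v0; apply: (submod0 (submod_pdiv _)).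
  have [_ _ fact _] := Rdvr; have [u [k [Uu e]]] := fact _ v0.
  have kb : k = b.
    move: bv nbv; rewrite e => /(pdiv_unitX _ _ Uu) bk nbk.
    by apply/eqP; rewrite eqn_leq bk andbT leqNgt; apply/negP => ltbk; apply/nbk/pdiv_unitX.
  by exists u => //; rewrite e kb subrr; apply: (submod0 (submod_pdiv _)).
Qed.

Lemma unit_1subX k : 1 - pi ^+ k.+1 \is a GRing.unit.
Proof.
have [_ _ fact _] := Rdvr.
have [e|/fact[u [[|j] [Uu e]]]] := eqVneq (1 - pi ^+ k.+1) 0; last 2 first.
- by rewrite e expr0 mulr1.
- suff /pdivX : pdiv 1 (pi ^+ 0 : R) by [].
  rewrite expr0 -(subrK (pi ^+ k.+1) 1) e.
  apply: (submodD (submod_pdiv 1)); last exact/pdivX.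
  by apply/(pdiv_unitX _ _ Uu).
suff /pdivX : pdiv 1 (pi ^+ 0 : R) by [].
by move/eqP: e; rewrite expr0 subr_eq0 => /eqP e; rewrite {1}e; apply/pdivX.
Qed.

Definition full (V : lmodType R) (U : V -> Prop) : Prop :=
  forall v, exists a, U (pi ^+ a *: v).

(** By pigeonhole two multiples [pi ^+ i *: v] and [pi ^+ j *: v] with [i < j] are congruent modulo
    [U]. Their difference is [pi ^+ i *: v] times the unit [1 - pi ^+ (j - i)]. *)
Lemma idx_full (V : lmodType R) (U : V -> Prop) k : submod U ->
  idx U (fun=> True) k -> full U.
Proof.
move=> sU [s _ [_ _ scov _]] v.
have /choice[f fP] (i : nat) : exists x, x \in s /\ U (pi ^+ i *: v - x).
  by have [//|x xs Ux] := scov (pi ^+ i *: v); exists x.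
have [|/(uniqPn 0)] := boolP (uniq [seq f i | i <- iota 0 (size s).+1]).
  move/uniq_leq_size => /(_ s); rewrite size_map size_iota ltnn.
  by case/(_ _)/Bool.diff_false_true => _ /mapP[i _ ->]; case: (fP i).
case=> i [j [ltij]]; rewrite size_map size_iota => ltjs.
rewrite !(nth_map 0%N) ?size_iota ?(ltn_trans ltij) // !nth_iota ?(ltn_trans ltij) //.
rewrite !add0n => efij; exists i.
have := submodB_trans sU (proj2 (fP i)) (submodBC sU (eq_ind _ (fun x => U (_ - x)) (proj2 (fP j)) _ (esym efij))).
rewrite -scalerBl -(subnKC ltij) addSnnS exprD -{1}[pi ^+ i]mulr1 -mulrBr mulrC -scalerA.
by move/(submodZ sU (1 - pi ^+ (j - i.+1).+1)^-1); rewrite scalerA mulVr ?scale1r // unit_1subX.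
Qed.

Lemma full_tail (A B : lmodType R) (U : A * B -> Prop) : full U -> full (tail U).
Proof.
move=> fU v; have [a Ua] := fU (0, v); exists a.
by move: Ua; congr U; congr (_, _); rewrite /= scaler0.
Qed.

(** * Extensions of rank-one lattices *)

Definition Ext (V : lmodType R) (a : nat) (C : V -> Prop) (U : R^o * V -> Prop) : Prop :=
  [/\ submod U, (forall r v, U (r, v) -> pdiv a r),
      (exists z, U (pi ^+ a : R, z)) & (forall z, U (pi ^+ a : R, z) -> C z)].

Lemma Ext_exists (V : lmodType R) (U : R^o * V -> Prop) : submod U -> full U ->
  exists a, Ext a (fun=> True) U.
Proof.
move=> sU fU; pose I (r : R^o) := exists v, U (r, v).
have sI : submod I.
  split; first by exists 0; apply: (submod0 sU).
    by move=> r r' [v Uv] [v' Uv']; exists (v + v'); apply: (submodD sU Uv Uv').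
  by move=> a r [v Uv]; exists (a *: v); apply: (submodZ sU a Uv).
have [a0 Ua0] := fU (1, 0).
have [|a Ia] := @ideal_pdiv I a0 sI.
  by exists (pi ^+ a0 *: 0); move: Ua0; congr U; congr (_, _); rewrite /GRing.scale /= mulr1.
exists a; split=> // [r v Uv|]; first by apply/Ia; exists v.
by apply/Ia/pdivX.
Qed.

Lemma ExtW (V : lmodType R) a (C C' : V -> Prop) U :
  (forall z, U (pi ^+ a : R, z) -> C' z) -> Ext a C U -> Ext a C' U.
Proof. by move=> CC' [sU Ua exU UC]; split. Qed.

Lemma Ext_inj (V : lmodType R) a a' (C C' : V -> Prop) U :
  Ext a C U -> Ext a' C' U -> a = a'.
Proof.
move=> [sU Ua [z Uz] _] [_ Ua' [z' Uz'] _].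
apply/eqP; rewrite eqn_leq; apply/andP; split; apply/pdivX.
  exact: Ua Uz'.
exact: Ua' Uz.
Qed.

Lemma idx_Ext (V : lmodType R) a (C0 C : V -> Prop) U X n1 n2 : Ext a C0 U -> submod C ->
  (forall z, C0 z -> C z) -> idx (pdiv a) X n1 -> idx (tail U) C n2 ->
  idx U (fun p => X p.1 /\ C p.2) (n1 * n2).
Proof.
move=> [sU Ua [z Uz] UC] sC C0C; apply: idx_ext => // r [c ->].
exists (c *: z); first by apply: submodZ => //; apply/C0C/UC.
exact: (submodZ sU c Uz).
Qed.

Lemma idx_ExtT (V : lmodType R) a (C : V -> Prop) U n : Ext a C U ->
  idx (tail U) (fun=> True) n -> idx U (fun=> True) (q ^ a * n).
Proof.
move=> EU tn; have := idx_Ext EU (submodT V) (fun _ _ => I) (idx_pdivT a) tn.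
by apply: eq_idx => // -[].
Qed.

(** [U] is recovered from any lift [z] as the span of [L] and [(pi ^+ a, z)], and two lifts give the
    same [U] exactly when they are congruent modulo [L]. *)
Lemma counts_Ext_fib (V : lmodType R) a (L C : V -> Prop) n : submod L ->
  (forall z l, C z -> L l -> C (z + l)) -> idx L C n ->
  counts (fun U => Ext a C U /\ tail U = L) n.
Proof.
move=> sL CL [s <- [us sC scov sinj]].
pose f z (p : R^o * V) := exists r, p.1 = r * pi ^+ a /\ L (p.2 - r *: z).
have f1 z y : f z (pi ^+ a : R, y) <-> L (y - z).
  split=> [[r [/= e Lz]]|Ly]; last by exists 1; rewrite mul1r scale1r.
  have e1 : r = 1 by apply: (mulIf (piX0 a)); rewrite mul1r.
  by move: Lz; rewrite e1 scale1r.
have sf z : submod (f z).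
  split; first by exists 0; rewrite mul0r scale0r subr0; split=> //; apply: submod0.
    move=> u v [r [e Lu]] [r' [e' Lv]]; exists (r + r').
    rewrite /= e e' mulrDl scalerDl; split=> //.
    by rewrite opprD addrACA; apply: submodD.
  move=> b u [r [e Lu]]; exists (b * r); rewrite /= e; split.
    by rewrite /GRing.scale /= mulrA.
  by rewrite -scalerA -scalerBr; apply: submodZ.
exists (map f s); split; last 2 first.
- by rewrite size_map.
- move=> U; split=> [[[sU Ua [z Uz] UC] tU]|/mapP[x xs ->]].
    have [x xs Lx] := scov z (UC _ Uz).
    apply/mapP; exists x => //.
    have LU l : L l <-> U (0, l) by rewrite -tU.
    have Ux : U (pi ^+ a : R, x).
      have := submodB sU Uz (proj1 (LU _) Lx); congr U; congr (_, _); rewrite /= ?subr0 //.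
      by rewrite opprB addrC subrK.
    apply: funext => -[r v]; apply: propext; split=> [Uv|[c [/= -> /LU Uv]]].
      have [c e] := Ua _ _ Uv; exists c; split=> //=; apply/LU.
      have := submodB sU Uv (submodZ sU c Ux); congr U; congr (_, _).
      by rewrite /= e /GRing.scale /= subrr.
    have := submodD sU Uv (submodZ sU c Ux); congr U; congr (_, _).
      by rewrite /= add0r.
    by rewrite /= subrK.
  split; [split=> //|].
  - by move=> r v [c [/= -> _]]; exists c.
  - by exists x; apply/f1; rewrite subrr; apply: submod0.
  - by move=> z /f1 Lz; rewrite -(subrK x z) addrC; apply: CL => //; apply: sC.
  apply: funext => v; apply: propext; split=> [[c [/= /esym/eqP]]|Lv]; last first.
    by exists 0; rewrite mul0r scale0r subr0.
  by rewrite mulf_eq0 (negPf (piX0 a)) orbF => /eqP->; rewrite scale0r subr0.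
- rewrite map_inj_in_uniq // => x y xs ys efxy; apply: sinj => //.
  by apply/f1; rewrite -efxy; apply/f1; rewrite subrr; apply: submod0.
Qed.

Lemma counts_Ext (V : lmodType R) a (C : (V -> Prop) -> V -> Prop) (Q : (V -> Prop) -> Prop)
    n k : counts Q n -> (forall L, Q L -> submod L) ->
  (forall L, Q L -> forall z l, C L z -> L l -> C L (z + l)) ->
  (forall L, Q L -> idx L (C L) k) ->
  counts (fun U => Ext a (C (tail U)) U /\ Q (tail U)) (n * k).
Proof.
move=> cQ sQ CQ iQ; apply: (counts_fib (f := @tail _ V)) cQ _ => [U []//|L QL].
apply: eq_counts (counts_Ext_fib a (sQ _ QL) (CQ _ QL) (iQ _ QL)) => U.
by split=> [[EU tU]|[[EU QU] tU]]; rewrite ?tU; [split=> //; split; rewrite ?tU|split; rewrite -?tU].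
Qed.

End DVR.

(** * Lattices of rank two *)

(* [q ^ tors c b j k] counts the elements killed by [pi ^+ k] in the quotient of
   [R^2] by a lattice [L] with [Lat2 c b j L]. *)
Definition tors (c b j k : nat) : nat := (minn k (j + maxn c b) + minn k (minn c b))%N.

Section Lat2.
Variables (R : idomainType) (pi : R) (q : nat).
Hypothesis Rdvr : dvr pi q.

Local Notation pdiv := (pdiv pi).
Local Notation Ext := (Ext pi).

Let pi0 : pi != 0. Proof. by case: Rdvr. Qed.
Let piX0 k : pi ^+ k != 0. Proof. exact: expf_neq0. Qed.

Implicit Types L M : R^o * R^o -> Prop.

(* [pi ^+ c] and [pi ^+ b] generate the two projections of [L], while
   [pi ^+ (c + j)] and [pi ^+ (b + j)] generate its intersections with the axes. *)
Definition Lat2 (c b j : nat) L : Prop :=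
  [/\ submod L, (forall r s, L (r, s) -> pdiv c r /\ pdiv b s),
      (forall r, L (r, 0) <-> pdiv (c + j) r), (forall s, L (0, s) <-> pdiv (b + j) s) &
      exists2 u : R, u \is a GRing.unit & L (pi ^+ c : R, u * pi ^+ b : R)].

Lemma Lat2_submod c b j L : Lat2 c b j L -> submod L. Proof. by case. Qed.

(** The intersection with the first axis need not be imposed: subtracting a multiple of the
    generator [(pi ^+ c, u * pi ^+ b)] shows that [(t * pi ^+ c, 0)] lies in [L] exactly when
    [pi ^+ (b + j)] divides [t * u * pi ^+ b], that is, when [pi ^+ j] divides [t]. *)
Lemma Lat2_Ext c b j L :
  Lat2 c b j L <-> Ext c (unitX pi b j) L /\ tail L = pdiv (b + j).
Proof.
split=> [[sL Lcb L1 L2 [u Uu Lu]]|[[sL Lc [z Lz] LU] tL]].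
  split; last by apply: funext => s; apply: propext; apply: L2.
  split=> // [r s /Lcb[]//||z Lz]; first by exists (u * pi ^+ b : R).
  exists u => //; apply/L2.
  by have := submodB sL Lz Lu; congr L; congr (_, _); rewrite /= subrr.
have L2 s : L (0, s) <-> pdiv (b + j) s by rewrite -tL.
have [u Uu /L2 Lzu] := LU z Lz.
have Lu : L (pi ^+ c : R, u * pi ^+ b : R).
  have := submodB sL Lz Lzu; congr L; congr (_, _); rewrite /= ?subr0 //.
  by rewrite opprB addrC subrK.
have L1 t s : L (t * pi ^+ c : R, s) <-> L (0, s - t * (u * pi ^+ b) : R).
  split=> Lts.
    have := submodB sL Lts (submodZ sL t Lu); congr L; congr (_, _).
    by rewrite /GRing.scale /= subrr.
  have := submodD sL Lts (submodZ sL t Lu); congr L; congr (_, _).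
    by rewrite /GRing.scale /= add0r.
  by rewrite /GRing.scale /= subrK.
split=> //; last by exists u.
  move=> r s Lrs; split; first exact: Lc Lrs.
  have [t e] := Lc _ _ Lrs; move: Lrs; rewrite e => /L1/L2 ps.
  rewrite -[s](subrK (t * (u * pi ^+ b) : R)); apply: (submodD (submod_pdiv pi b)).
    by apply: pdiv_leq ps; apply: leq_addr.
  by do 2!apply: pdiv_scale; apply/(pdivX Rdvr).
move=> r; split=> [Lr|[t ->]].
  have [t e] := Lc _ _ Lr; move: Lr; rewrite e => /L1/L2.
  rewrite sub0r => /(submodN (submod_pdiv pi _)); rewrite opprK.
  have -> : t * (u * pi ^+ b) = u * (pi ^+ b * t) by ring.
  move/(pdiv_unit _ _ _ Uu)/(pdivMX Rdvr); rewrite addKn => jt.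
  by rewrite mulrC; apply/(pdivMX Rdvr); rewrite addKn.
rewrite addnC exprD mulrA; apply/L1/L2; rewrite sub0r.
apply: (submodN (submod_pdiv pi _)).
by exists (t * u); rewrite exprD; ring.
Qed.

Lemma counts_Lat2 c b j : counts (Lat2 c b j) (phi q j).
Proof.
apply: eq_counts (counts_Ext_fib Rdvr c (submod_pdiv pi (b + j)) _ (idx_unitX Rdvr b j)).
  by move=> L; rewrite Lat2_Ext.
exact: unitXD.
Qed.

Lemma Lat2_exists L : submod L -> full pi L -> exists c b j, Lat2 c b j L.
Proof.
move=> sL fL; have [c Lc] := Ext_exists Rdvr sL fL.
have [a tLa] := full_tail fL (1 : R^o).
have [|B tL] := ideal_pdiv Rdvr (submod_tail sL) (a := a).
  by move: tLa; rewrite /GRing.scale /= mulr1.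
have etL : tail L = pdiv B by apply: funext => s; apply: propext.
have [_ _ [z Lz] _] := Lc.
have Lz' z' : L (pi ^+ c : R, z') -> pdiv B (z' - z).
  move=> Lz'; apply/tL; have := submodB sL Lz' Lz; congr L; congr (_, _).
  by rewrite /= subrr.
(* [B] is to become [b + j]. If [z] lies in the axis part, the whole lattice is a product and
   [j = 0]; otherwise [b] is the valuation of [z], which is below [B]. *)
have [pz|npz] := pselect (pdiv B z).
  exists c, B, 0%N; apply/Lat2_Ext; rewrite addn0 etL; split=> //.
  apply: ExtW Lc => z' /Lz' pz'; exists 1; first exact: unitr1.
  rewrite addn0 mul1r; apply: (submodB (submod_pdiv pi B)); last exact/(pdivX Rdvr).
  by rewrite -[z'](subrK z); apply: (submodD (submod_pdiv pi B)).
have z0 : z != 0.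
  by apply/eqP => z0; apply: npz; rewrite z0; apply: (submod0 (submod_pdiv pi B)).
have [_ _ fact _] := Rdvr; have [u [b [Uu e]]] := fact _ z0.
have ltbB : (b < B)%N.
  by rewrite ltnNge; apply/negP => Bb; apply: npz; rewrite e; apply/(pdiv_unitX Rdvr).
exists c, b, (B - b)%N; apply/Lat2_Ext; rewrite subnKC ?(ltnW ltbB) // etL; split=> //.
by apply: ExtW Lc => z' /Lz' pz'; exists u => //; rewrite subnKC ?(ltnW ltbB) // -e.
Qed.

Lemma Lat2_inj c b j c' b' j' L : Lat2 c b j L -> Lat2 c' b' j' L ->
  [/\ c = c', b = b' & j = j'].
Proof.
move=> L1 L2; have [E1 _] := (proj1 (Lat2_Ext _ _ _ _) L1).
have [E2 _] := (proj1 (Lat2_Ext _ _ _ _) L2).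
have cc' := Ext_inj Rdvr E1 E2.
case: L1 L2 => [_ _ L1 L1' _] [_ _ L2 L2' _].
have cj : (c + j = c' + j')%N by apply: (pdiv_inj Rdvr) => r; rewrite -L1 -L2.
have bj : (b + j = b' + j')%N by apply: (pdiv_inj Rdvr) => r; rewrite -L1' -L2'.
by split; lia.
Qed.

Lemma idx_Lat2 c b j a a' L : Lat2 c b j L -> (a <= c)%N -> (a' <= b)%N ->
  idx L (fun p => pdiv a p.1 /\ pdiv a' p.2) (q ^ (c - a + (b + j - a'))).
Proof.
move=> L2 ac ab; have [E tL] := (proj1 (Lat2_Ext _ _ _ _) L2).
rewrite expnD; apply: (idx_Ext E (submod_pdiv pi a') _ (idx_pdiv Rdvr ac)).
  by move=> z /(unitX_pdiv Rdvr); apply: pdiv_leq.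
by rewrite tL; apply: idx_pdiv => //; apply: leq_trans (leq_addr _ _).
Qed.

Lemma idx_Lat2T c b j L : Lat2 c b j L -> idx L (fun=> True) (q ^ (c + b + j)).
Proof.
move=> L2; have := idx_Lat2 L2 (leq0n c) (leq0n b); rewrite !subn0 addnA.
by apply: eq_idx => // v; split=> // _; split; apply: pdiv0.
Qed.

(** The coordinate of the generator [(pi ^+ c, u * pi ^+ b)] with the smaller exponent divides the
    other one. A shear then turns the generator into [pi ^+ minn c b] times a basis vector, and the
    axis with the larger exponent contributes [j + maxn c b]. *)
Lemma Lat2_smith c b j L : Lat2 c b j L ->
  exists (h g : R^o * R^o -> R^o * R^o), [/\ forall u v, h (u - v) = h u - h v,
    forall a u, h (a *: u) = a *: h u, cancel g h, cancel h g &
    forall p, L (h p) <-> pdiv (j + maxn c b) p.1 /\ pdiv (minn c b) p.2].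
Proof.
move=> [sL Lcb L1 L2 [u Uu Lu]].
have [lecb|ltbc] := leqP c b.
  pose h (p : R^o * R^o) : R^o * R^o := (p.2, p.2 * (u * pi ^+ (b - c)) + p.1 : R).
  pose g (p : R^o * R^o) : R^o * R^o := (p.2 - p.1 * (u * pi ^+ (b - c)) : R, p.1).
  exists h, g; split.
  - by move=> [x y] [x' y']; congr (_, _) => /=; ring.
  - by move=> a [x y]; congr (_, _); rewrite /= /GRing.scale /=; ring.
  - by move=> [x y]; congr (_, _) => /=; ring.
  - by move=> [x y]; congr (_, _) => /=; ring.
  have Lf t : L (t * pi ^+ c : R, t * pi ^+ c * (u * pi ^+ (b - c)) : R).
    have := submodZ sL t Lu; congr L; congr (_, _); rewrite /GRing.scale /=.
    by rewrite -{1}(subnKC lecb) exprD; ring.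
  case=> x y; rewrite /h /= addnC; split=> [Lh|[px [t ->]]].
    have [[t e] _] := Lcb _ _ Lh; split; last by exists t.
    apply/L2; have := submodB sL Lh (Lf t); congr L; congr (_, _); rewrite /= e ?subrr //.
    by ring.
  have := submodD sL (Lf t) (proj2 (L2 _) px); congr L; congr (_, _); rewrite /= ?addr0 //.
have lebc := ltnW ltbc.
pose h (p : R^o * R^o) : R^o * R^o := (p.1 + p.2 * pi ^+ (c - b) : R, p.2 * u : R).
pose g (p : R^o * R^o) : R^o * R^o := (p.1 - p.2 * u^-1 * pi ^+ (c - b) : R, p.2 * u^-1 : R).
exists h, g; split.
- by move=> [x y] [x' y']; congr (_, _) => /=; ring.
- by move=> a [x y]; congr (_, _); rewrite /= /GRing.scale /=; ring.
- by move=> [x y]; congr (_, _) => /=; rewrite ?subrK // mulrVK.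
- by move=> [x y]; congr (_, _) => /=; rewrite mulrK // addrK.
have Lf t : L (t * pi ^+ b * pi ^+ (c - b) : R, t * pi ^+ b * u : R).
  have := submodZ sL t Lu; congr L; congr (_, _); rewrite /GRing.scale /=.
    by rewrite -{1}(subnKC lebc) exprD; ring.
  by ring.
case=> x y; rewrite /h /= addnC; split=> [Lh|[px [t ->]]].
  have [_ + ] := Lcb _ _ Lh; rewrite mulrC => /(pdiv_unit _ _ _ Uu) [t e].
  split; last by exists t.
  apply/L1; have := submodB sL Lh (Lf t); congr L; congr (_, _); rewrite /= e ?subrr //.
  by ring.
by have := submodD sL (proj2 (L1 _) px) (Lf t); congr L; congr (_, _); rewrite /= ?add0r.
Qed.

Lemma idx_tors c b j k L : Lat2 c b j L ->
  idx L (fun z => L (pi ^+ k *: z)) (q ^ tors c b j k).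
Proof.
move=> L2; have [h [g [hB hZ gK hK hL]]] := Lat2_smith L2.
apply: (idx_bij hB gK hK).
set l1 := (j + maxn c b)%N in hL; set l2 := minn c b in hL.
pose U (p : R^o * R^o) := pdiv l1 p.1 /\ pdiv l2 p.2.
have sU : submod U.
  split; first by split; apply: (submod0 (submod_pdiv pi _)).
    move=> p p' [p1 p2] [p1' p2'].
    by split; apply: (submodD (submod_pdiv pi _)).
  by move=> a p [p1 p2]; split; apply: (submodZ (submod_pdiv pi _)).
(* Truncated subtraction does the work: the condition [pi ^+ k * r] in the ideal of exponent [l1] is
   the ideal of exponent [l1 - k], which is everything once [k] exceeds [l1]. *)
have l1E : (l1 - (l1 - k) = minn k l1)%N by lia.
have l2E : (l2 - (l2 - k) = minn k l2)%N by lia.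
have i1 := idx_pdiv Rdvr (leq_subr k l1); have i2 := idx_pdiv Rdvr (leq_subr k l2).
have := idx_ext sU (submod_pdiv pi (l2 - k)) (M := pdiv l1) _ _ i1 _.
move=> /(_ (q ^ (l2 - (l2 - k)))%N); rewrite -expnD l1E l2E => iU.
apply: eq_idx (iU _ _ _) => [p|p|a z [] //|a pa|].
- by rewrite hL.
- by rewrite -hZ hL /= /GRing.scale /= !(pdivMX Rdvr).
- by exists 0; [|split]; rewrite //=; apply: (submod0 (submod_pdiv pi _)).
rewrite -l2E; apply: eq_idx i2 => // z; split=> [pz|[]//].
by split=> //; apply: (submod0 (submod_pdiv pi _)).
Qed.

(* A basis of [M] adapted to the sublattice spanned by [(pi ^+ (c + j + d1), 0)]
   and [(0, pi ^+ (b + j + d2))]. *)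
Lemma Lat2_basis c b j d1 d2 M : Lat2 c b j M ->
  exists m1 m2 : R^o * R^o, [/\ forall a, M a <-> exists r1 r2, a = r1 *: m1 + r2 *: m2,
    forall r1 r2, r1 *: m1 + r2 *: m2 = 0 -> r1 = 0 /\ r2 = 0 &
    forall N : R^o * R^o -> Prop, submod N ->
      (N (pi ^+ (c + j + d1) : R, 0) /\ N (0, pi ^+ (b + j + d2) : R)) <->
      (N (pi ^+ (j + maxn d1 d2) *: m1) /\ N (pi ^+ minn d1 d2 *: m2))].
Proof.
move=> [sM Mcb M1 M2 [u Uu Mu]].
pose v : R^o * R^o := (pi ^+ c : R, u * pi ^+ b : R).
pose w : R^o * R^o := (0, pi ^+ (b + j) : R).
pose w' : R^o * R^o := (pi ^+ (c + j) : R, 0).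
have vw : pi ^+ j *: v = w' + u *: w.
  by rewrite /v /w /w'; congr (_, _); rewrite /= /GRing.scale /= ?exprD; ring.
have p1E : (pi ^+ (c + j + d1) : R, 0) = pi ^+ d1 *: w' :> R^o * R^o.
  by rewrite /w'; congr (_, _); rewrite /= /GRing.scale /= ?exprD; ring.
have p2E : (0, pi ^+ (b + j + d2) : R) = pi ^+ d2 *: w :> R^o * R^o.
  by rewrite /w; congr (_, _); rewrite /= /GRing.scale /= ?exprD; ring.
have Mw : M w by apply/M2/(pdivX Rdvr).
have Mw' : M w' by apply/M1/(pdivX Rdvr).
have spanw a : M a <-> exists r1 r2, a = r1 *: v + r2 *: w.
  split=> [|[r1 [r2 ->]]]; last by apply: submodD => //; apply: submodZ.
  case: a => r s Mrs; have [[t e] _] := Mcb _ _ Mrs.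
  have /M2[t' e'] : M (0, s - t * (u * pi ^+ b) : R).
    have := submodB sM Mrs (submodZ sM t Mu); congr M; congr (_, _).
    by rewrite /GRing.scale /= e subrr.
  exists t, t'; congr (_, _); rewrite /= /GRing.scale /=; first by rewrite e mulr0 addr0.
  by rewrite -e' addrC subrK.
(* The relation [vw] replaces the axis generator with the larger exponent by [v]. If [d1 <= d2], the
   sum of [pi ^+ d2 *: w'] and [u] times [pi ^+ d2 *: w] is [pi ^+ (j + d2) *: v], and its first
   summand is a multiple of [pi ^+ d1 *: w']. *)
have [le12|lt21] := leqP d1 d2.
  exists v, w'; split.
  - move=> a; rewrite spanw; split=> -[r1 [r2 ->]].
      exists (r1 + r2 * u^-1 * pi ^+ j), (- (r2 * u^-1)).
      rewrite scalerDl -(scalerA _ (pi ^+ j)) vw scalerDr scalerA mulrVK //.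
      by rewrite scaleNr addrA addrAC addrK.
    exists (r1 + r2 * pi ^+ j), (- (r2 * u)).
    by rewrite scalerDl -(scalerA r2) vw scalerDr -!addrA scalerA scaleNr subrr addr0.
  - move=> r1 r2 e.
    have := congr1 snd e; rewrite /= /GRing.scale /= mulr0 addr0 => /eqP.
    rewrite !mulf_eq0 (negPf (piX0 b)) orbF orbC.
    have u0 : u != 0 by apply: contraTneq Uu => ->; rewrite unitr0.
    rewrite (negPf u0) /= => /eqP r10.
    have := congr1 fst e; rewrite /= /GRing.scale /= r10 mul0r add0r => /eqP.
    by rewrite mulf_eq0 (negPf (piX0 _)) orbF => /eqP.
  move=> N sN; rewrite p1E p2E exprD mulrC -scalerA vw scalerDr.
  have -> : pi ^+ d2 *: w' = pi ^+ (d2 - d1) *: (pi ^+ d1 *: w').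
    by rewrite scalerA -exprD subnK.
  have -> : pi ^+ d2 *: (u *: w) = u *: (pi ^+ d2 *: w) by rewrite !scalerA mulrC.
  split=> [[N1 N2]|[N1 N2]]; split=> //; first by apply: submodD => //; apply: submodZ.
  have := submodZ sN u^-1 (submodB sN N1 (submodZ sN (pi ^+ (d2 - d1)) N2)).
  by rewrite [X in X - _]addrC addrK (scalerA u^-1) mulVr // scale1r.
have le21 := ltnW lt21.
exists v, w; split=> //.
- move=> r1 r2 e.
  have := congr1 fst e; rewrite /= /GRing.scale /= mulr0 addr0 => /eqP.
  rewrite !mulf_eq0 (negPf (piX0 c)) orbF => /eqP r10.
  have := congr1 snd e; rewrite /= /GRing.scale /= r10 mul0r add0r => /eqP.
  by rewrite mulf_eq0 (negPf (piX0 _)) orbF => /eqP.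
move=> N sN; rewrite p1E p2E exprD mulrC -scalerA vw scalerDr.
have -> : pi ^+ d1 *: (u *: w) = u *: (pi ^+ (d1 - d2) *: (pi ^+ d2 *: w)).
  by rewrite (scalerA (pi ^+ (d1 - d2))) -exprD subnK // !scalerA mulrC.
split=> [[N1 N2]|[N1 N2]]; split=> //.
  by apply: submodD => //; apply: (submodZ sN _ (submodZ sN _ N2)).
have := submodB sN N1 (submodZ sN u (submodZ sN (pi ^+ (d1 - d2)) N2)).
by rewrite addrK.
Qed.

End Lat2.

(** * From invariant submodules to classes *)

Lemma dvr_gt1 (R : idomainType) (pi : R) q : dvr pi q -> (1 < q)%N.
Proof.
move=> Rdvr; have [_ _ _ [s <- [us _ scov _]]] := Rdvr.
case: s us scov => [|x [|y s]] // us scov; first by case: (scov 0 I).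
have pE : rdiv pi = pdiv pi 1 by rewrite /pdiv expr1.
have [x0 x0s p0] := scov 0 I; have [x1 x1s p1] := scov 1 I.
move: x0s x1s p0 p1; rewrite !inE pE => /eqP-> /eqP-> p0 p1.
suff /(pdivX Rdvr) : pdiv pi 1 (pi ^+ 0 : R) by [].
have := submodB (submod_pdiv pi 1) p1 p0.
by rewrite sub0r opprK subrK.
Qed.

Lemma padic_int_ring_dvr (R : idomainType) p q : padic_int_ring R p q ->
  exists pi : R, dvr pi q.
Proof.
case=> pi [[pi0 piN] fact _ [s [ss [scov sinj]]] _]; exists pi; split=> //.
exists s => //; split=> // [|v _|].
- apply/(uniqP 0) => i j; rewrite !inE ss => iq jq e; apply: sinj => //.
  by exists 0; rewrite mul0r e subrr.
- by have [i iq pv] := scov v; exists (nth 0 s i) => //; rewrite mem_nth ?ss.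
- move=> x y /(nthP 0)[i iq <-] /(nthP 0)[j jq <-] pxy; rewrite ss in iq jq.
  by rewrite (sinj _ _ iq jq pxy).
Qed.

Lemma has_index_idx (R : comNzRingType) N (U : 'rV[R]_N -> Prop) k :
  submod U -> has_index U k <-> idx U (fun=> True) k.
Proof.
move=> sU; split=> [[s [ss scov sinj]]|[s ss [us _ scov sinj]]]; exists s => //.
  split=> // [|v _|].
  - apply/(uniqP 0) => i j; rewrite !inE ss => iq jq e; apply: sinj => //.
    by rewrite e subrr; apply: submod0.
  - by have [i iq pv] := scov v; exists (nth 0 s i) => //; rewrite mem_nth ?ss.
  - move=> x y /(nthP 0)[i iq <-] /(nthP 0)[j jq <-] pxy; rewrite ss in iq jq.
    by rewrite (sinj _ _ iq jq pxy).
split=> // [v|i j ik jk Uij].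
  have [//|x xs Ux] := scov v; exists (index x s); first by rewrite -ss index_mem.
  by rewrite nth_index.
apply/eqP; rewrite -(nth_uniq 0 _ _ us) ?ss //; apply/eqP.
by apply: sinj => //; rewrite mem_nth ?ss.
Qed.

(** Applying the elementary matrix [1%:M + delta_mx i j] and subtracting [u] isolates one vector.
    Conversely [u *m g] is [u] plus the combination of these vectors with the entries of [g] above
    the diagonal as coefficients. *)
Lemma invariantP (R : comNzRingType) s (U : 'rV[R]_(sumn s) -> Prop) : submod U ->
  is_invariant U <-> forall i j : 'I_(sumn s), (i < j)%N -> blk s i = blk s j ->
    forall u, U u -> U (u 0 i *: delta_mx 0 j).
Proof.
move=> sU; split=> [inv i j ltij bij u Uu|inv g gU u Uu].
  have dE : u *m delta_mx i j = u 0 i *: delta_mx 0 j.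
    apply/rowP => l; rewrite !mxE (bigD1 i) //= mxE eqxx andTb big1 ?addr0 // => m /negPf mi.
    by rewrite mxE mi mulr0.
  have -> : u 0 i *: delta_mx 0 j = u *m (1%:M + delta_mx i j) - u.
    by rewrite mulmxDr mulmx1 addrC addKr dE.
  apply: submodB => //; apply: inv => // a b; rewrite !mxE.
  have jNi : (j == i) = false by apply/eqP => ji; rewrite ji ltnn in ltij.
  split=> [/eqP/val_inj->|ltba|nab].
  - rewrite eqxx; case: eqP => [->|]; last by rewrite addr0.
    by rewrite eq_sym jNi addr0.
  - have -> : (a == b) = false by apply/eqP => ab; rewrite ab ltnn in ltba.
    case: eqP => [ai|]; last by rewrite addr0.
    by case: eqP => [bj|]; rewrite ?addr0 //; move: ltba; rewrite ai bj ltnNge ltnW.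
  - case: eqP => [ab|_]; first by rewrite ab eqxx in nab.
    case: eqP => [ai|_]; last by rewrite addr0.
    by case: eqP => [bj|_]; rewrite ?addr0 //; move: nab; rewrite ai bj bij eqxx.
have -> : u *m g = u + \sum_(i < sumn s) \sum_(j < sumn s | (i < j)%N && (blk s i == blk s j))
    g i j *: (u 0 i *: delta_mx 0 j).
  apply/rowP => l; rewrite !mxE summxE.
  have -> : u 0 l = \sum_i u 0 i * (i == l)%:R.
    by rewrite -{1}(mulmx1 u) mxE; apply: eq_bigr => i _; rewrite mxE.
  rewrite -big_split /=; apply: eq_bigr => i _; rewrite summxE.
  have [g1 g0 gb] := gU i l.
  have [il|] := eqVneq (i : nat) l.
    rewrite g1 ?il // -(val_inj il) eqxx big1 ?addr0 // => j /andP[ltij _].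
    rewrite !mxE eqxx /=; case: eqP => [ij|_]; rewrite ?mulr0 //.
    by rewrite ij ltnn in ltij.
  rewrite -val_eqE /= => /negPf il; rewrite il mulr0 add0r.
  case: (boolP ((i < l)%N && (blk s i == blk s l))) => [il'|].
    rewrite (bigD1 l) //= !mxE !eqxx mulr1 big1 ?addr0 1?mulrC // => j /andP[_ /negPf jl].
    by rewrite !mxE eqxx [l == j]eq_sym jl !mulr0.
  rewrite negb_and => nil; have -> : g i l = 0.
    case/orP: nil => [|/gb//]; rewrite -leqNgt => li; apply: g0.
    by rewrite ltn_neqAle li andbT eq_sym il.
  rewrite mulr0 big1 // => j ijb; rewrite !mxE eqxx; case: eqP => [lj|_]; rewrite ?mulr0 //.
  by case/andP: ijb; rewrite -lj; case/orP: nil => /negPf->.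
apply: submodD => //; apply: big_ind => [||i _]; [exact: submod0|exact: submodD|].
apply: big_ind => [||j /andP[ltij /eqP bij]]; [exact: submod0|exact: submodD|].
by apply: submodZ => //; apply: inv.
Qed.

(** * Zeta coefficients from disjoint classes of constant size and index *)

Section Classes.
Variables (R : idomainType) (pi : R) (q : nat).
Hypothesis Rdvr : dvr pi q.
Variables (s : seq nat) (V : lmodType R).
Variables (h : V -> 'rV[R]_(sumn s)) (g : 'rV[R]_(sumn s) -> V).
Hypotheses (hD : forall u v, h (u + v) = h u + h v) (hZ : forall a u, h (a *: u) = a *: h u).
Hypotheses (gK : cancel g h) (hK : cancel h g).
Variable inv : (V -> Prop) -> Prop.
Hypothesis invP : forall U, submod U -> is_invariant (fun v => U (g v)) <-> inv U.
Variables (k : nat) (S : seq nat -> (V -> Prop) -> Prop) (n w : seq nat -> nat).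
Hypothesis countsS : forall t, size t = k -> counts (S t) (n t).
Hypothesis S_inv : forall t U, size t = k -> S t U ->
  [/\ submod U, inv U & idx U (fun=> True) (q ^ w t)].
Hypothesis S_exists : forall U, submod U -> full pi U -> inv U ->
  exists2 t, size t = k & S t U.
Hypothesis S_inj : forall t t' U, size t = k -> size t' = k -> S t U -> S t' U -> t = t'.
Hypothesis w_leq : forall t, size t = k -> all (fun i => i <= w t)%N t.

Let hN u : h (- u) = - h u.
Proof. by rewrite -scaleN1r hZ scaleN1r. Qed.
Let hB u v : h (u - v) = h u - h v.
Proof. by rewrite hD hN. Qed.
Let gD u v : g (u + v) = g u + g v.
Proof. by apply: (can_inj hK); rewrite hD !gK. Qed.
Let gZ a u : g (a *: u) = a *: g u.
Proof. by apply: (can_inj hK); rewrite hZ !gK. Qed.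
Let gB u v : g (u - v) = g u - g v.
Proof. by apply: (can_inj hK); rewrite hB !gK. Qed.

Let submod_g U : submod U -> submod (fun v => U (g v)).
Proof.
move=> sU; split; first by have := submod0 sU; congr U; rewrite -(subrr (0 : 'rV[R]_(sumn s))) gB subrr.
  by move=> u v Uu Uv; rewrite gD; apply: submodD.
by move=> a u Uu; rewrite gZ; apply: submodZ.
Qed.

Let submod_h U : submod U -> submod (fun v => U (h v)).
Proof.
move=> sU; split; first by have := submod0 sU; congr U; rewrite -(subrr (0 : V)) hB subrr.
  by move=> u v Uu Uv; rewrite hD; apply: submodD.
by move=> a u Uu; rewrite hZ; apply: submodZ.
Qed.

Let ghE (U : 'rV[R]_(sumn s) -> Prop) : (fun v => U (h (g v))) = U.
Proof. by apply: funext => v; rewrite gK. Qed.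
Let hgE (U : V -> Prop) : (fun v => U (g (h v))) = U.
Proof. by apply: funext => v; rewrite hK. Qed.

Let idx_g U m : idx U (fun=> True) m -> idx (fun v => U (g v)) (fun=> True) m.
Proof. by move=> iU; apply: (idx_bij hB gK hK); rewrite (hgE U). Qed.

Let idx_h U m : idx U (fun=> True) m -> idx (fun v => U (h v)) (fun=> True) m.
Proof. by move=> iU; apply: (idx_bij gB hK gK); rewrite (ghE U). Qed.

Let P m U := [/\ submod U, inv U & idx U (fun=> True) m].

Let P_class m U : P m U <-> exists t, [/\ size t = k, (q ^ w t)%N = m & S t U].
Proof.
split=> [[sU iU xU]|[t [st <- SU]]]; last exact: S_inv st SU.
have [t st SU] := S_exists sU (idx_full Rdvr sU xU) iU.
have [_ _ xU'] := S_inv st SU; exists t; split=> //.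
exact: idx_inj sU xU' xU.
Qed.

(** Only tuples with entries at most [m] are summed. By [w_leq] no class of index [q ^ m] is
    lost. *)
Let c m := msumn m k (fun t => if w t == m then n t else 0%N).

Let counts_c m : counts (P (q ^ m)) (c m).
Proof.
have := @counts_msumn _ m k (fun t U => w t = m /\ S t U) (fun t => if w t == m then n t else 0%N).
move=> cS; apply: eq_counts (cS _ _) => [U|t st|t t' U st st' [_ SU] [_ SU']].
- rewrite P_class; split=> [[t [st tm [wt SU]]]|[t [st wt SU]]]; exists t; split=> //.
    by rewrite wt.
  have {}wt : w t = m by apply/eqP; rewrite -(eqn_exp2l _ _ (dvr_gt1 Rdvr)) wt.
    by rewrite -wt; apply: w_leq.
  by split=> //; apply/eqP; rewrite -(eqn_exp2l _ _ (dvr_gt1 Rdvr)) wt.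
- case: eqP => [wt|nwt]; last by apply: counts0 => U [].
  by apply: eq_counts (countsS st) => U; split=> // -[].
- exact: S_inj SU SU'.
Qed.

Let P_rV m (U : 'rV[R]_(sumn s) -> Prop) :
  [/\ is_submod U, is_invariant U & has_index U m] <-> P m (fun v => U (h v)).
Proof.
split=> [[sU iU xU]|[sU iU xU]].
  have shU := submod_h sU; split=> //.
    by apply/invP => //; rewrite ghE.
  by apply: idx_h; apply/has_index_idx.
have sU' : submod U by rewrite -(ghE U); apply: (submod_g sU).
split=> //; last by apply/has_index_idx => //; rewrite -(ghE U); apply: idx_g xU.
by rewrite -(ghE U); apply: (proj2 (invP sU)).
Qed.

Lemma zeta_coef_classes : exists c : nat -> nat,
  [/\ forall m, zeta_coef R s (q ^ m) (c m),
      forall m, (forall i, m <> (q ^ i)%N) -> zeta_coef R s m 0 &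
      (fun m => (c m)%:R) = msum k (fun t => fpsC (n t)%:R * fpsX _ ^+ w t) :> fps rat].
Proof.
exists c; split; last 1 first.
- apply: funext => m; symmetry; apply: msum_coef => t st.
  rewrite fpsCM_coef fpsXn_coef eq_sym; case: eqP => _; first by rewrite mulr1.
  by rewrite mulr0.
- move=> m; have [l [ul sl Pl]] := counts_c m.
  have lE i : (i < c m)%N -> nth (fun=> False) [seq (fun v => U (g v)) | U <- l] i =
      fun v => nth (fun=> False) l i (g v).
    by move=> ic; rewrite (nth_map (fun=> False)) // sl.
  exists [seq (fun v => U (g v)) | U <- l]; split; first by rewrite size_map.
  - move=> i ic; rewrite lE //; apply/P_rV; rewrite hgE; apply/Pl.
    by rewrite mem_nth ?sl.
  - move=> i j ic jc; rewrite !lE // => e.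
    apply/eqP; rewrite -(nth_uniq (fun=> False) _ _ ul) ?sl //; apply/eqP.
    by apply: funext => v; apply: propext; have := e (h v); rewrite hK.
  - move=> U /P_rV/Pl Ul; exists (index (fun v => U (h v)) l).
      by rewrite -sl index_mem.
    by move=> v; rewrite lE -?sl ?index_mem // nth_index // gK.
- move=> m mq; exists [::]; split=> // U /P_rV/P_class[t [_ wt _]].
  by case: (mq (w t)).
Qed.

End Classes.

Definition rowv (R : pzRingType) N (l : seq R) : 'rV[R]_N := \row_i nth 0 l i.

Ltac ord_cases i := case: i => [[|[|[|[|[|[|]]]]]] //= ?].

Lemma Ext_lift (R : idomainType) (pi : R) (V : lmodType R) a (C : V -> Prop) (U : R^o * V -> Prop) :
  Ext pi a C U -> submod C -> (forall z, tail U z -> C z) -> forall r z, U (r, z) -> C z.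
Proof.
move=> [sU Ua [z0 Uz0] UC] sC tC r z Uz; have [t e] := Ua _ _ Uz.
rewrite -(subrK (t *: z0) z); apply: submodD => //; last by apply: submodZ => //; apply: UC.
apply: tC; have := submodB sU Uz (submodZ sU t Uz0); congr U; congr (_, _).
by rewrite /= e /GRing.scale /= subrr.
Qed.

Lemma submod_comp (R : comNzRingType) (V W : lmodType R) (f : V -> W) (U : W -> Prop) :
  (forall u v, f (u + v) = f u + f v) -> (forall a u, f (a *: u) = a *: f u) ->
  submod U -> submod (fun v => U (f v)).
Proof.
move=> fD fZ sU; split.
- by have := submodZ sU 0 (submod0 sU); rewrite scaler0 -(scale0r (f 0)) -fZ scale0r.
- by move=> u v Uu Uv; rewrite fD; apply: submodD.
- by move=> a u Uu; rewrite fZ; apply: submodZ.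
Qed.

Section Cases.
Variables (R : idomainType) (pi : R) (q : nat).
Hypothesis Rdvr : dvr pi q.

Local Notation pdiv := (pdiv pi).
Local Notation Ext := (Ext pi).
Local Notation Lat2 := (Lat2 pi).

(** ** U_2 x U_2 *)

(* With bases [(e_i, f_i)] of the blocks, the coordinates are listed as
   [(e_1, (e_2, (f_1, f_2)))], so that [tail] intersects with the span of all but
   the first vector. *)

Local Notation V22 := (R^o * (R^o * (R^o * R^o)))%type.

Definition row22 (p : V22) : 'rV[R]_(sumn [:: 2; 2]) :=
  rowv _ [:: p.1; p.2.2.1; p.2.1; p.2.2.2].
Definition vec22 (u : 'rV[R]_(sumn [:: 2; 2])) : V22 :=
  (u 0 (inord 0), (u 0 (inord 2), (u 0 (inord 1), u 0 (inord 3)))).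

Definition inv22 (U : V22 -> Prop) : Prop := forall r1 r2 x, U (r1, (r2, x)) ->
  U (0, (0, (r1, 0))) /\ U (0, (0, (0, r2))).

Lemma row22D u v : row22 (u + v) = row22 u + row22 v.
Proof. by apply/rowP => i; rewrite !mxE; ord_cases i. Qed.
Lemma row22Z a u : row22 (a *: u) = a *: row22 u.
Proof. by apply/rowP => i; rewrite !mxE; ord_cases i. Qed.
Lemma vec22K : cancel vec22 row22.
Proof.
move=> u; apply/rowP => i; rewrite !mxE; ord_cases i; congr (u _ _); apply: val_inj;
 by rewrite /= inordK.
Qed.
Lemma row22K : cancel row22 vec22.
Proof. by move=> [a [b [c d]]]; rewrite /vec22 !mxE !inordK. Qed.


Lemma inv22P U : submod U -> is_invariant (fun v => U (vec22 v)) <-> inv22 U.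
Proof.
move=> sU; rewrite invariantP; last first.
  by apply: submod_comp sU => [u v|a u]; rewrite /vec22 !mxE.
have rowE p k : (k < 4)%N -> row22 p 0 (inord k) =
    nth 0 [:: p.1; p.2.2.1; p.2.1; p.2.2.2] k by move=> k4; rewrite mxE inordK.
have E1 a : vec22 (a *: delta_mx 0 (inord 1)) = (0, (0, (a, 0))).
  by rewrite /vec22 !mxE -!val_eqE /= !inordK //= !(mulr0, mulr1).
have E3 a : vec22 (a *: delta_mx 0 (inord 3)) = (0, (0, (0, a))).
  by rewrite /vec22 !mxE -!val_eqE /= !inordK //= !(mulr0, mulr1).
split=> [inv r1 r2 x Ux|inv i j].
  have Ux' : U (vec22 (row22 (r1, (r2, x)))) by rewrite row22K.
  split.
    by have := inv (inord 0) (inord 1); rewrite !inordK // => /(_ isT erefl _ Ux'); rewrite E1 rowE.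
  by have := inv (inord 2) (inord 3); rewrite !inordK // => /(_ isT erefl _ Ux'); rewrite E3 rowE.
rewrite -[i]inord_val -[j]inord_val; move: (val i) (val j) (ltn_ord i) (ltn_ord j).
move=> {i j} i j i4 j4; rewrite !inordK // => ij bij u Uu; have [H1 H3] := inv _ _ _ Uu.
by case: i j i4 j4 ij bij => [|[|[|[|]]]] [|[|[|[|]]]] //=; rewrite ?E1 ?E3.
Qed.


(** Invariance forces the exponents of [e_1] and [e_2] to be at least those of the axis
    intersections, [c + j] and [b + j]; [i1] and [i2] are the excesses. The [e_2]-coordinate of a
    lift of [e_1] must be divisible by [pi ^+ (b + j)]. *)
Definition class22 (t : seq nat) (U : V22 -> Prop) : Prop :=
  if t is [:: i1; i2; c; b; j] then
    Ext (c + j + i1) (fun z => pdiv (b + j) z.1) U /\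
    Ext (b + j + i2) (fun=> True) (tail U) /\ Lat2 c b j (tail (tail U))
  else False.

(** The factors count the lattices, the lifts of [e_2], which are free modulo the lattice, and the
    lifts of [e_1], where the divisibility condition leaves [q ^ i2] residues for the
    [e_2]-coordinate. *)
Definition num22 (t : seq nat) : nat :=
  if t is [:: i1; i2; c; b; j] then
    (phi q j * q ^ (c + b + j) * (q ^ i2 * q ^ (c + b + j)))%N else 0%N.

Definition wt22 (t : seq nat) : nat :=
  if t is [:: i1; i2; c; b; j] then
    ((c + j + i1) + ((b + j + i2) + (c + b + j)))%N else 0%N.

Lemma zeta22 : exists c : nat -> nat,
  [/\ forall m, zeta_coef R [:: 2; 2]%N (q ^ m) (c m),
      forall m, (forall i, m <> (q ^ i)%N) -> zeta_coef R [:: 2; 2]%N m 0 &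
      (fun m => (c m)%:R) =
        msum 5 (fun t => fpsC (num22 t)%:R * fpsX _ ^+ wt22 t) :> fps rat].
Proof.
apply: (zeta_coef_classes Rdvr row22D row22Z vec22K row22K inv22P (S := class22)).
- case=> [|i1 [|i2 [|c [|b [|j []]]]]] //= _.
  apply: (counts_Ext Rdvr _ (C := fun _ z => pdiv (b + j) z.1)
    (Q := fun U => Ext (b + j + i2) (fun=> True) U /\ Lat2 c b j (tail U))).
  + apply: (counts_Ext Rdvr _ (C := fun _ _ => True) (Q := Lat2 c b j)) => //.
    * exact: counts_Lat2.
    * by move=> L /Lat2_submod.
    * by move=> L L2; apply: (idx_Lat2T Rdvr L2).
  + by move=> L [[]].
  + move=> L [[_ La _ _] _] [z1 z2] [l1 l2] /= pz Ll.
    apply: (submodD (submod_pdiv pi _)) => //; apply: pdiv_leq (La _ _ Ll).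
    exact: leq_addr.
  + move=> L [E L2]; have le := leq_addr i2 (b + j).
    have := idx_Ext E (submodT _) (fun _ _ => I) (idx_pdiv Rdvr le) (idx_Lat2T Rdvr L2).
    by rewrite addKn; apply: eq_idx => // -[z1 z2]; split=> // -[].
- case=> [|i1 [|i2 [|c [|b [|j []]]]]] //= U _ [E1 [E2 L2]].
  have [sU Ua _ _] := E1; split=> //.
    move=> r1 r2 x Ux; have [_ _ L1 L1' _] := L2; split.
      by apply/L1; apply: pdiv_leq (Ua _ _ Ux); apply: leq_addr.
    apply/L1'; apply: (Ext_lift E1 (C := fun z => pdiv (b + j) z.1)) Ux.
      by apply: submod_comp (submod_pdiv pi (b + j)).
    case=> z1 z2 /= Uz; have [_ Ua2 _ _] := E2.
    by apply: pdiv_leq (Ua2 _ _ Uz); apply: leq_addr.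
  rewrite expnD [in X in (_ * X)%N]expnD.
  exact: (idx_ExtT Rdvr E1 (idx_ExtT Rdvr E2 (idx_Lat2T Rdvr L2))).
- move=> U sU fU iU.
  have [a1 E1] := Ext_exists Rdvr sU fU.
  have [a2 E2] := Ext_exists Rdvr (submod_tail sU) (full_tail fU).
  have [c [b [j L2]]] := Lat2_exists Rdvr (submod_tail (submod_tail sU)) (full_tail (full_tail fU)).
  have [_ _ L1 L1' _] := L2.
  have le1 : (c + j <= a1)%N.
    have [_ _ [[r x] Ux] _] := E1; have [Ur _] := iU _ _ _ Ux.
    by apply/(pdivX Rdvr)/L1.
  have le2 : (b + j <= a2)%N.
    have [_ _ [x Ux] _] := E2; have [_ Ur] := iU _ _ _ Ux.
    by apply/(pdivX Rdvr)/L1'.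
  exists [:: (a1 - (c + j))%N; (a2 - (b + j))%N; c; b; j] => //=.
  rewrite !subnKC //; split=> //; apply: ExtW E1 => -[r x] Ux.
  by have [_ Ur] := iU _ _ _ Ux; apply/L1'.
- case=> [|i1 [|i2 [|c [|b [|j []]]]]] // [|i1' [|i2' [|c' [|b' [|j' []]]]]] // U _ _.
  move=> [E1 [E2 L2]] [E1' [E2' L2']].
  have [-> -> ->] := Lat2_inj Rdvr L2 L2'.
  have := Ext_inj Rdvr E1 E1'; have := Ext_inj Rdvr E2 E2'.
  have [-> -> ->] := Lat2_inj Rdvr L2 L2'.
  by move=> /addnI-> /addnI->.
- case=> [|i1 [|i2 [|c [|b [|j []]]]]] //= _; lia.
Qed.

End Cases.

Section Cases.
Variables (R : idomainType) (pi : R) (q : nat).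
Hypothesis Rdvr : dvr pi q.

Local Notation pdiv := (pdiv pi).
Local Notation Ext := (Ext pi).
Local Notation Lat2 := (Lat2 pi).

(** With the next lemma: for a lift [z] of [pi ^+ d], multiplying [(pi ^+ d, z)] by [pi ^+ k] shows
    that [(pi ^+ (d + k), 0)] lies in [U] exactly when [pi ^+ k *: z] lies in the tail. *)
Lemma Ext_tors (V : lmodType R) d k (U : R^o * V -> Prop) r :
  Ext d (fun z => tail U (pi ^+ k *: z)) U -> pdiv (d + k) r -> U (r, 0).
Proof.
move=> [sU _ [z Uz] Uk] [t ->].
have := submodZ sU t (submodB sU (submodZ sU (pi ^+ k) Uz) (Uk _ Uz)).
congr U; congr (_, _); last by rewrite /= subrr scaler0.
by rewrite /= /GRing.scale /= subr0 exprD [pi ^+ k * _]mulrC.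
Qed.

Lemma tors_Ext (V : lmodType R) d k (U : R^o * V -> Prop) z : submod U ->
  U (pi ^+ (d + k) : R, 0) -> U (pi ^+ d : R, z) -> tail U (pi ^+ k *: z).
Proof.
move=> sU U0 Uz; have := submodB sU (submodZ sU (pi ^+ k) Uz) U0.
congr U; congr (_, _); last by rewrite /= subr0.
by rewrite /= /GRing.scale /= exprD mulrC subrr.
Qed.

Lemma idx_Ext_pdiv (V : lmodType R) a a' (C0 C : V -> Prop) U n : Ext a C0 U -> submod C ->
  (forall z, C0 z -> C z) -> (a' <= a)%N -> idx (tail U) C n ->
  idx U (fun p => pdiv a' p.1 /\ C p.2) (q ^ (a - a') * n).
Proof. by move=> E sC C0C le; apply: (idx_Ext E sC C0C (idx_pdiv Rdvr le)). Qed.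

Lemma idx_Ext_pdivT (V : lmodType R) a a' (C0 : V -> Prop) U n : Ext a C0 U ->
  (a' <= a)%N -> idx (tail U) (fun=> True) n ->
  idx U (fun p => pdiv a' p.1) (q ^ (a - a') * n).
Proof.
move=> E le iU; have := idx_Ext_pdiv E (submodT V) (fun _ _ => I) le iU.
by apply: eq_idx => // p; split=> // -[].
Qed.

Lemma Ext_pdiv (V : lmodType R) a a' (C : V -> Prop) U r z : Ext a C U -> (a' <= a)%N ->
  U (r, z) -> pdiv a' r.
Proof. by move=> [_ Ua _ _] le Uz; apply: pdiv_leq le (Ua _ _ Uz). Qed.

Lemma submodI (V : lmodType R) (C D : V -> Prop) : submod C -> submod D ->
  submod (fun z => C z /\ D z).
Proof.
move=> sC sD; split; first by split; apply: submod0.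
  by move=> u v [Cu Du] [Cv Dv]; split; apply: submodD.
by move=> a u [Cu Du]; split; apply: submodZ.
Qed.

Lemma submod_fst (V : lmodType R) k : submod (fun z : R^o * V => pdiv k z.1).
Proof. by apply: submod_comp (submod_pdiv pi k). Qed.

Lemma submod_fst_snd (V : lmodType R) k k' :
  submod (fun z : R^o * (R^o * V) => pdiv k z.1 /\ pdiv k' z.2.1).
Proof.
by apply: submodI; [exact: submod_fst|apply: submod_comp (submod_pdiv pi k')].
Qed.

(** ** U_2 x U_2 x U_2 *)

(* Coordinates [(e_1, (e_2, (e_3, (f_1, (f_2, f_3)))))]. *)

Local Notation V222 := (R^o * (R^o * (R^o * (R^o * (R^o * R^o)))))%type.

Definition row222 (p : V222) : 'rV[R]_(sumn [:: 2; 2; 2]) :=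
  rowv _ [:: p.1; p.2.2.2.1; p.2.1; p.2.2.2.2.1; p.2.2.1; p.2.2.2.2.2].
Definition vec222 (u : 'rV[R]_(sumn [:: 2; 2; 2])) : V222 :=
  (u 0 (inord 0), (u 0 (inord 2), (u 0 (inord 4), (u 0 (inord 1), (u 0 (inord 3), u 0 (inord 5)))))).

Definition inv222 (U : V222 -> Prop) : Prop := forall r1 r2 r3 x, U (r1, (r2, (r3, x))) ->
  [/\ U (0, (0, (0, (r1, 0)))), U (0, (0, (0, (0, (r2, 0))))) &
      U (0, (0, (0, (0, (0, r3)))))].

Lemma row222D u v : row222 (u + v) = row222 u + row222 v.
Proof. by apply/rowP => i; rewrite !mxE; ord_cases i. Qed.
Lemma row222Z a u : row222 (a *: u) = a *: row222 u.
Proof. by apply/rowP => i; rewrite !mxE; ord_cases i. Qed.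
Lemma vec222K : cancel vec222 row222.
Proof.
move=> u; apply/rowP => i; rewrite !mxE; ord_cases i; congr (u _ _); apply: val_inj;
 by rewrite /= inordK.
Qed.
Lemma row222K : cancel row222 vec222.
Proof. by move=> [a [b [c [d [e f]]]]]; rewrite /vec222 !mxE !inordK. Qed.

Lemma inv222P U : submod U -> is_invariant (fun v => U (vec222 v)) <-> inv222 U.
Proof.
move=> sU; rewrite invariantP; last first.
  by apply: submod_comp sU => [u v|a u]; rewrite /vec222 !mxE.
have rowE p k : (k < 6)%N -> row222 p 0 (inord k) =
    nth 0 [:: p.1; p.2.2.2.1; p.2.1; p.2.2.2.2.1; p.2.2.1; p.2.2.2.2.2] k.
  by move=> k6; rewrite mxE inordK.
have E1 a : vec222 (a *: delta_mx 0 (inord 1)) = (0, (0, (0, (a, 0)))).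
  by rewrite /vec222 !mxE -!val_eqE /= !inordK //= !(mulr0, mulr1).
have E3 a : vec222 (a *: delta_mx 0 (inord 3)) = (0, (0, (0, (0, (a, 0))))).
  by rewrite /vec222 !mxE -!val_eqE /= !inordK //= !(mulr0, mulr1).
have E5 a : vec222 (a *: delta_mx 0 (inord 5)) = (0, (0, (0, (0, (0, a))))).
  by rewrite /vec222 !mxE -!val_eqE /= !inordK //= !(mulr0, mulr1).
split=> [inv r1 r2 r3 x Ux|inv i j].
  have Ux' : U (vec222 (row222 (r1, (r2, (r3, x))))) by rewrite row222K.
  split.
  - by have := inv (inord 0) (inord 1); rewrite !inordK // => /(_ isT erefl _ Ux'); rewrite E1 rowE.
  - by have := inv (inord 2) (inord 3); rewrite !inordK // => /(_ isT erefl _ Ux'); rewrite E3 rowE.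
  - by have := inv (inord 4) (inord 5); rewrite !inordK // => /(_ isT erefl _ Ux'); rewrite E5 rowE.
rewrite -[i]inord_val -[j]inord_val; move: (val i) (val j) (ltn_ord i) (ltn_ord j).
move=> {i j} i j i4 j4; rewrite !inordK // => ij bij u Uu; have [H1 H3 H5] := inv _ _ _ _ Uu.
by case: i j i4 j4 ij bij => [|[|[|[|[|[|]]]]]] [|[|[|[|[|[|]]]]]] //=; rewrite ?E1 ?E3 ?E5.
Qed.

(** The lattice [Lat2 c b j] lives on [f_2] and [f_3], and [f_1] is an extra layer of exponent [d].
    The exponent of [e_1] exceeds [d] by [k], and the torsion condition on the lifts of [f_1]
    expresses that [pi ^+ (d + k)] times [f_1] lies in [U]. *)
Definition class222 (t : seq nat) (U : V222 -> Prop) : Prop :=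
  if t is [:: d; i2; i3; c; b; j; k] then
    Ext (d + k) (fun z => pdiv (c + j) z.1 /\ pdiv (b + j) z.2.1) U /\
    Ext (c + j + i2) (fun z => pdiv (b + j) z.1) (tail U) /\
    Ext (b + j + i3) (fun=> True) (tail (tail U)) /\
    Ext d (fun z => tail (tail (tail (tail U))) (pi ^+ k *: z)) (tail (tail (tail U))) /\
    Lat2 c b j (tail (tail (tail (tail U))))
  else False.

(** Here [m] is the index of the lattice in the span of [f_1], [f_2], [f_3]. The factors count, in
    order, the rank-two lattices and the lifts of [f_1], [e_3], [e_2] and [e_1]. *)
Definition num222 (t : seq nat) : nat :=
  if t is [:: d; i2; i3; c; b; j; k] then
    let m := (q ^ d * q ^ (c + b + j))%N in
    (phi q j * q ^ tors c b j k * m * (q ^ i3 * m) * (q ^ i2 * (q ^ i3 * m)))%N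
  else 0%N.

Definition wt222 (t : seq nat) : nat :=
  if t is [:: d; i2; i3; c; b; j; k] then
    ((d + k) + ((c + j + i2) + ((b + j + i3) + (d + (c + b + j)))))%N else 0%N.

Lemma zeta222 : exists c : nat -> nat,
  [/\ forall m, zeta_coef R [:: 2; 2; 2]%N (q ^ m) (c m),
      forall m, (forall i, m <> (q ^ i)%N) -> zeta_coef R [:: 2; 2; 2]%N m 0 &
      (fun m => (c m)%:R) =
        msum 7 (fun t => fpsC (num222 t)%:R * fpsX _ ^+ wt222 t) :> fps rat].
Proof.
apply: (zeta_coef_classes Rdvr row222D row222Z vec222K row222K inv222P (S := class222)).
- case=> [|d [|i2 [|i3 [|c [|b [|j [|k []]]]]]]] //= _.
  pose Q0 := Lat2 c b j.
  pose Q1 U := Ext d (fun z => tail U (pi ^+ k *: z)) U /\ Q0 (tail U).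
  pose Q2 U := Ext (b + j + i3) (fun=> True) U /\ Q1 (tail U).
  pose Q3 U := Ext (c + j + i2) (fun z => pdiv (b + j) z.1) U /\ Q2 (tail U).
  have idx1 U : Q1 U -> idx U (fun=> True) (q ^ d * q ^ (c + b + j)).
    by move=> [E L2]; apply: (idx_ExtT Rdvr E (idx_Lat2T Rdvr L2)).
  have idx2 U : Q2 U -> idx U (fun p => pdiv (b + j) p.1)
      (q ^ i3 * (q ^ d * q ^ (c + b + j))).
    move=> [E /idx1 iU]; have := idx_Ext_pdivT E (leq_addr i3 (b + j)) iU.
    by rewrite addKn.
  apply: (counts_Ext Rdvr _ (C := fun _ z => pdiv (c + j) z.1 /\ pdiv (b + j) z.2.1) (Q := Q3)).
  + apply: (counts_Ext Rdvr _ (C := fun _ z => pdiv (b + j) z.1) (Q := Q2)) => //.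
    * apply: (counts_Ext Rdvr _ (C := fun _ _ => True) (Q := Q1)) => // [|L [[]] //].
      apply: (counts_Ext Rdvr _ (C := fun L z => L (pi ^+ k *: z)) (Q := Q0)).
      - exact: counts_Lat2.
      - by move=> L /Lat2_submod.
      - move=> L /Lat2_submod sL z l Lz Ll; rewrite scalerDr.
        by apply: submodD => //; apply: submodZ.
      - by move=> L; apply: idx_tors.
    * by move=> L [[]].
    * move=> L [E _] [z1 z2] [l1 l2] /= pz Ll.
      apply: (submodD (submod_pdiv pi _)) => //.
      by apply: Ext_pdiv E _ Ll; apply: leq_addr.
  + by move=> L [[]].
  + move=> L [E [E' _]] [z1 z2] [l1 l2] /= [pz1 pz2] Ll; split.
      apply: (submodD (submod_pdiv pi _)) => //.
      by apply: Ext_pdiv E _ Ll; apply: leq_addr.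
    apply: (submodD (submod_pdiv pi _)) => //.
    apply: (Ext_lift E (C := fun z => pdiv (b + j) z.1)) Ll.
      by apply: submod_comp (submod_pdiv pi (b + j)).
    by case=> y1 y2 Ly; apply: Ext_pdiv E' _ Ly; apply: leq_addr.
  + move=> L [E /idx2 iL].
    have sC : submod (fun z : R^o * (R^o * (R^o * R^o)) => pdiv (b + j) z.1).
      by apply: submod_comp (submod_pdiv pi (b + j)).
    have := idx_Ext_pdiv E sC (fun _ => id) (leq_addr i2 (c + j)) iL.
    by rewrite addKn.
- case=> [|d [|i2 [|i3 [|c [|b [|j [|k []]]]]]]] //= U _ [E1 [E2 [E3 [E4 L2]]]].
  have [sU Ua _ _] := E1; split=> //.
    have lift r1 r2 r3 x : U (r1, (r2, (r3, x))) -> pdiv (c + j) r2 /\ pdiv (b + j) r3.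
      apply: (Ext_lift E1 (submod_fst_snd _ _ _)) => -[y1 [y2 y3]] /= Ty.
      split; first by apply: Ext_pdiv E2 _ Ty; apply: leq_addr.
      apply: (Ext_lift E2 (submod_fst _ _)) Ty => -[z1 z2] Tz.
      by apply: Ext_pdiv E3 _ Tz; apply: leq_addr.
    move=> r1 r2 r3 x Ux; have [_ _ L1 L1' _] := L2; have [p2 p3] := lift _ _ _ _ Ux.
    by split; [apply: Ext_tors E4 _; apply: Ua Ux|apply/L1|apply/L1'].
  rewrite (expnD _ (d + k)) (expnD _ (c + j + i2)) (expnD _ (b + j + i3)) (expnD _ d (c + _ + _)).
  exact: (idx_ExtT Rdvr E1 (idx_ExtT Rdvr E2 (idx_ExtT Rdvr E3 (idx_ExtT Rdvr E4 (idx_Lat2T Rdvr L2))))).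
- move=> U sU fU iU.
  have [a1 E1] := Ext_exists Rdvr sU fU.
  have [sU1 fU1] := (submod_tail sU, full_tail fU).
  have [a2 E2] := Ext_exists Rdvr sU1 fU1.
  have [sU2 fU2] := (submod_tail sU1, full_tail fU1).
  have [a3 E3] := Ext_exists Rdvr sU2 fU2.
  have [sU3 fU3] := (submod_tail sU2, full_tail fU2).
  have [d E4] := Ext_exists Rdvr sU3 fU3.
  have [c [b [j L2]]] := Lat2_exists Rdvr (submod_tail sU3) (full_tail fU3).
  have [_ _ L1 L1' _] := L2.
  (* Invariance applied to a vector with [e_1]-coordinate [pi ^+ a1] gives this multiple of [f_1];
     it yields both [d <= a1] and the torsion condition with [k] equal to [a1 - d]. *)
  have T1 : tail (tail (tail U)) (pi ^+ a1 : R, 0).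
    by have [_ _ [[r [r' x]] Ux] _] := E1; have [] := iU _ _ _ _ Ux.
  have le1 : (d <= a1)%N by have [_ Ua4 _ _] := E4; apply/(pdivX Rdvr); apply: Ua4 T1.
  have le2 : (c + j <= a2)%N.
    have [_ _ [[r x] Ux] _] := E2; have [_ Ur _] := iU _ _ _ _ Ux.
    by apply/(pdivX Rdvr)/L1.
  have le3 : (b + j <= a3)%N.
    have [_ _ [x Ux] _] := E3; have [_ _ Ur] := iU _ _ _ _ Ux.
    by apply/(pdivX Rdvr)/L1'.
  exists [:: d; (a2 - (c + j))%N; (a3 - (b + j))%N; c; b; j; (a1 - d)%N] => //=.
  rewrite !subnKC //; split; [|split; [|split; [|split]]] => //.
  + apply: ExtW E1 => -[r [r' x]] Ux; have [_ Ur Ur'] := iU _ _ _ _ Ux.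
    by split; [apply/L1|apply/L1'].
  + by apply: ExtW E2 => -[r x] Ux; have [_ _ Ur] := iU _ _ _ _ Ux; apply/L1'.
  + by apply: ExtW E4 => z; apply: tors_Ext; rewrite ?subnKC.
- case=> [|d [|i2 [|i3 [|c [|b [|j [|k []]]]]]]] // [|d' [|i2' [|i3' [|c' [|b' [|j' [|k' []]]]]]]] // U _ _.
  move=> [E1 [E2 [E3 [E4 L2]]]] [E1' [E2' [E3' [E4' L2']]]].
  have := (Ext_inj Rdvr E1 E1', Ext_inj Rdvr E2 E2', Ext_inj Rdvr E3 E3', Ext_inj Rdvr E4 E4').
  have [-> -> ->] := Lat2_inj Rdvr L2 L2'.
  move=> [[[e1 e2] e3] e4]; rewrite e4 in e1 *.
  by rewrite (addnI e1) (addnI e2) (addnI e3).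
- case=> [|d [|i2 [|i3 [|c [|b [|j [|k []]]]]]]] //= _; lia.
Qed.

End Cases.

Definition proj (A B : Type) (U : A * B -> Prop) : A -> Prop := fun a => exists z, U (a, z).

Lemma submod_proj (R : comNzRingType) (A B : lmodType R) (U : A * B -> Prop) :
  submod U -> submod (proj U).
Proof.
move=> sU; split; first by exists 0; apply: (submod0 sU).
  by move=> u v [z Uz] [z' Uz']; exists (z + z'); apply: (submodD sU Uz Uz').
by move=> a u [z Uz]; exists (a *: z); apply: (submodZ sU a Uz).
Qed.

Lemma full_proj (R : idomainType) (pi : R) (A B : lmodType R) (U : A * B -> Prop) :
  full pi U -> full pi (proj U).
Proof.
move=> fU v; have [a Ua] := fU (v, 0); exists a, 0.
by move: Ua; congr U; congr (_, _); rewrite /= scaler0.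
Qed.

Lemma idx_projT (R : comNzRingType) (A B : lmodType R) (U : A * B -> Prop) n1 n2 :
  submod U -> idx (proj U) (fun=> True) n1 -> idx (tail U) (fun=> True) n2 ->
  idx U (fun=> True) (n1 * n2).
Proof.
move=> sU i1 i2.
have h1 a z : U (a, z) -> proj U a by exists z.
have h2 a : proj U a -> exists2 z, True & U (a, z) by move=> [z Uz]; exists z.
have := idx_ext sU (submodT B) h1 h2 i1 i2; exact: eq_idx.
Qed.

Section Cases.
Variables (R : idomainType) (pi : R) (q : nat).
Hypothesis Rdvr : dvr pi q.

Local Notation pdiv := (pdiv pi).
Local Notation Ext := (Ext pi).
Local Notation Lat2 := (Lat2 pi).

(** ** U_3 x U_2 *)

(* Coordinates [(e_1, (g_1, (e_2, (e_3, g_2))))] for bases [(e_1, e_2, e_3)] and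
   [(g_1, g_2)] of the blocks. *)

Local Notation V32 := (R^o * (R^o * (R^o * (R^o * R^o))))%type.

Definition row32 (p : V32) : 'rV[R]_(sumn [:: 3; 2]) :=
  rowv _ [:: p.1; p.2.2.1; p.2.2.2.1; p.2.1; p.2.2.2.2].
Definition vec32 (u : 'rV[R]_(sumn [:: 3; 2])) : V32 :=
  (u 0 (inord 0), (u 0 (inord 3), (u 0 (inord 1), (u 0 (inord 2), u 0 (inord 4))))).

Definition inv32 (U : V32 -> Prop) : Prop := forall r1 s1 r2 x, U (r1, (s1, (r2, x))) ->
  [/\ U (0, (0, (r1, 0))), U (0, (0, (0, (r1, 0)))), U (0, (0, (0, (r2, 0)))) &
      U (0, (0, (0, (0, s1))))].

Lemma row32D u v : row32 (u + v) = row32 u + row32 v.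
Proof. by apply/rowP => i; rewrite !mxE; ord_cases i. Qed.
Lemma row32Z a u : row32 (a *: u) = a *: row32 u.
Proof. by apply/rowP => i; rewrite !mxE; ord_cases i. Qed.
Lemma vec32K : cancel vec32 row32.
Proof.
move=> u; apply/rowP => i; rewrite !mxE; ord_cases i; congr (u _ _); apply: val_inj;
 by rewrite /= inordK.
Qed.
Lemma row32K : cancel row32 vec32.
Proof. by move=> [a [b [c [d e]]]]; rewrite /vec32 !mxE !inordK. Qed.

Lemma inv32P U : submod U -> is_invariant (fun v => U (vec32 v)) <-> inv32 U.
Proof.
move=> sU; rewrite invariantP; last first.
  by apply: submod_comp sU => [u v|a u]; rewrite /vec32 !mxE.
have rowE p k : (k < 5)%N -> row32 p 0 (inord k) =
    nth 0 [:: p.1; p.2.2.1; p.2.2.2.1; p.2.1; p.2.2.2.2] k.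
  by move=> k5; rewrite mxE inordK.
have E1 a : vec32 (a *: delta_mx 0 (inord 1)) = (0, (0, (a, 0))).
  by rewrite /vec32 !mxE -!val_eqE /= !inordK //= !(mulr0, mulr1).
have E2 a : vec32 (a *: delta_mx 0 (inord 2)) = (0, (0, (0, (a, 0)))).
  by rewrite /vec32 !mxE -!val_eqE /= !inordK //= !(mulr0, mulr1).
have E4 a : vec32 (a *: delta_mx 0 (inord 4)) = (0, (0, (0, (0, a)))).
  by rewrite /vec32 !mxE -!val_eqE /= !inordK //= !(mulr0, mulr1).
split=> [inv r1 s1 r2 x Ux|inv i j].
  have Ux' : U (vec32 (row32 (r1, (s1, (r2, x))))) by rewrite row32K.
  split.
  - by have := inv (inord 0) (inord 1); rewrite !inordK // => /(_ isT erefl _ Ux'); rewrite E1 rowE.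
  - by have := inv (inord 0) (inord 2); rewrite !inordK // => /(_ isT erefl _ Ux'); rewrite E2 rowE.
  - by have := inv (inord 1) (inord 2); rewrite !inordK // => /(_ isT erefl _ Ux'); rewrite E2 rowE.
  - by have := inv (inord 3) (inord 4); rewrite !inordK // => /(_ isT erefl _ Ux'); rewrite E4 rowE.
rewrite -[i]inord_val -[j]inord_val; move: (val i) (val j) (ltn_ord i) (ltn_ord j).
move=> {i j} i j i5 j5; rewrite !inordK // => ij bij u Uu; have [H1 H2 H3 H4] := inv _ _ _ _ Uu.
by case: i j i5 j5 ij bij => [|[|[|[|[|]]]]] [|[|[|[|[|]]]]] //=; rewrite ?E1 ?E2 ?E4.
Qed.

(** The lattice lives on [e_3] and [g_2]; the layer of [e_2] has exponent [c + j + i], and that of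
    [e_1] exceeds it by [k]. The action of [e_1] onto [e_2] is the torsion condition, and its action
    onto [e_3] then follows, since the exponent of [e_1] is at least [c + j]. *)
Definition class32 (t : seq nat) (U : V32 -> Prop) : Prop :=
  if t is [:: i; i'; c; b; j; k] then
    Ext (c + j + i + k) (fun z => pdiv (b + j) z.1 /\ pdiv (c + j) z.2.1) U /\
    Ext (b + j + i') (fun z => pdiv (c + j) z.1) (tail U) /\
    Ext (c + j + i) (fun z => tail (tail (tail U)) (pi ^+ k *: z)) (tail (tail U)) /\
    Lat2 c b j (tail (tail (tail U)))
  else False.

(** After the lattices come the lifts of [e_2], then those of [g_1], of which [m] have an admissible
    [e_2]-coordinate, then those of [e_1]. *)
Definition num32 (t : seq nat) : nat :=
  if t is [:: i; i'; c; b; j; k] then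
    let m := (q ^ i * q ^ (c + b + j))%N in
    (phi q j * q ^ tors c b j k * m * (q ^ i' * m))%N
  else 0%N.

Definition wt32 (t : seq nat) : nat :=
  if t is [:: i; i'; c; b; j; k] then
    ((c + j + i + k) + ((b + j + i') + ((c + j + i) + (c + b + j))))%N else 0%N.

Lemma zeta32 : exists c : nat -> nat,
  [/\ forall m, zeta_coef R [:: 3; 2]%N (q ^ m) (c m),
      forall m, (forall i, m <> (q ^ i)%N) -> zeta_coef R [:: 3; 2]%N m 0 &
      (fun m => (c m)%:R) =
        msum 6 (fun t => fpsC (num32 t)%:R * fpsX _ ^+ wt32 t) :> fps rat].
Proof.
apply: (zeta_coef_classes Rdvr row32D row32Z vec32K row32K inv32P (S := class32)).
- case=> [|i [|i' [|c [|b [|j [|k []]]]]]] //= _.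
  pose Q0 := Lat2 c b j.
  pose Q1 U := Ext (c + j + i) (fun z => tail U (pi ^+ k *: z)) U /\ Q0 (tail U).
  pose Q2 U := Ext (b + j + i') (fun z => pdiv (c + j) z.1) U /\ Q1 (tail U).
  have idx1 U : Q1 U -> idx U (fun p => pdiv (c + j) p.1) (q ^ i * q ^ (c + b + j)).
    move=> [E L2]; have := idx_Ext_pdivT Rdvr E (leq_addr i (c + j)) (idx_Lat2T Rdvr L2).
    by rewrite addKn.
  apply: (counts_Ext Rdvr _ (C := fun _ z => pdiv (b + j) z.1 /\ pdiv (c + j) z.2.1) (Q := Q2)).
  + apply: (counts_Ext Rdvr _ (C := fun _ z => pdiv (c + j) z.1) (Q := Q1)) => //.
    * apply: (counts_Ext Rdvr _ (C := fun L z => L (pi ^+ k *: z)) (Q := Q0)).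
      - exact: counts_Lat2.
      - by move=> L /Lat2_submod.
      - move=> L /Lat2_submod sL z l Lz Ll; rewrite scalerDr.
        by apply: submodD => //; apply: submodZ.
      - by move=> L; apply: idx_tors.
    * by move=> L [[]].
    * move=> L [E _] [z1 z2] [l1 l2] /= pz Ll.
      apply: (submodD (submod_pdiv pi _)) => //.
      by apply: Ext_pdiv E _ Ll; apply: leq_addr.
  + by move=> L [[]].
  + move=> L [E [E' _]] [z1 z2] [l1 l2] /= [pz1 pz2] Ll; split.
      apply: (submodD (submod_pdiv pi _)) => //.
      by apply: Ext_pdiv E _ Ll; apply: leq_addr.
    apply: (submodD (submod_pdiv pi _)) => //.
    apply: (Ext_lift E (submod_fst _ _ _)) Ll => -[y1 y2] Ly.
    by apply: Ext_pdiv E' _ Ly; apply: leq_addr.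
  + move=> L [E /idx1 iL].
    have := idx_Ext_pdiv Rdvr E (submod_fst pi _ (c + j)) (fun _ => id) (leq_addr i' (b + j)) iL.
    by rewrite addKn.
- case=> [|i [|i' [|c [|b [|j [|k []]]]]]] //= U _ [E1 [E2 [E3 L2]]].
  have [sU Ua _ _] := E1; split=> //.
    have lift r1 s1 r2 x : U (r1, (s1, (r2, x))) -> pdiv (b + j) s1 /\ pdiv (c + j) r2.
      apply: (Ext_lift E1 (submod_fst_snd _ _ _ _)) => -[y1 [y2 y3]] /= Ty.
      split; first by apply: Ext_pdiv E2 _ Ty; apply: leq_addr.
      apply: (Ext_lift E2 (submod_fst _ _ _)) Ty => -[z1 z2] Tz.
      by apply: Ext_pdiv E3 _ Tz; apply: leq_addr.
    move=> r1 s1 r2 x Ux; have [_ _ L1 L1' _] := L2; have [p1 p2] := lift _ _ _ _ Ux.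
    split; [|apply/L1|apply/L1|apply/L1'] => //.
      by apply: Ext_tors E3 _; apply: Ua Ux.
    by apply: Ext_pdiv E1 _ Ux; rewrite -addnA leq_addr.
  rewrite (expnD _ (c + j + i + k)) (expnD _ (b + j + i')) (expnD _ (c + j + i) (c + _ + _)).
  exact: (idx_ExtT Rdvr E1 (idx_ExtT Rdvr E2 (idx_ExtT Rdvr E3 (idx_Lat2T Rdvr L2)))).
- move=> U sU fU iU.
  have [a1 E1] := Ext_exists Rdvr sU fU.
  have [sU1 fU1] := (submod_tail sU, full_tail fU).
  have [a2 E2] := Ext_exists Rdvr sU1 fU1.
  have [sU2 fU2] := (submod_tail sU1, full_tail fU1).
  have [a3 E3] := Ext_exists Rdvr sU2 fU2.
  have [c [b [j L2]]] := Lat2_exists Rdvr (submod_tail sU2) (full_tail fU2).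
  have [_ _ L1 L1' _] := L2.
  have T1 : tail (tail U) (pi ^+ a1 : R, 0).
    by have [_ _ [[r [r' x]] Ux] _] := E1; have [] := iU _ _ _ _ Ux.
  have le1 : (a3 <= a1)%N by have [_ Ua3 _ _] := E3; apply/(pdivX Rdvr); apply: Ua3 T1.
  have le2 : (b + j <= a2)%N.
    have [_ _ [[r x] Ux] _] := E2; have [_ _ _ Ur] := iU _ _ _ _ Ux.
    by apply/(pdivX Rdvr)/L1'.
  have le3 : (c + j <= a3)%N.
    have [_ _ [x Ux] _] := E3; have [_ _ Ur _] := iU _ _ _ _ Ux.
    by apply/(pdivX Rdvr)/L1.
  exists [:: (a3 - (c + j))%N; (a2 - (b + j))%N; c; b; j; (a1 - a3)%N] => //=.
  rewrite !subnKC //; split; [|split; [|split]] => //.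
  + apply: ExtW E1 => -[r [r' x]] Ux; have [_ _ Ur Ur'] := iU _ _ _ _ Ux.
    by split; [apply/L1'|apply/L1].
  + by apply: ExtW E2 => -[r x] Ux; have [_ _ Ur _] := iU _ _ _ _ Ux; apply/L1.
  + by apply: ExtW E3 => z; apply: tors_Ext; rewrite ?subnKC.
- case=> [|i [|i' [|c [|b [|j [|k []]]]]]] // [|l [|l' [|c' [|b' [|j' [|k' []]]]]]] // U _ _.
  move=> [E1 [E2 [E3 L2]]] [E1' [E2' [E3' L2']]].
  have := (Ext_inj Rdvr E1 E1', Ext_inj Rdvr E2 E2', Ext_inj Rdvr E3 E3').
  have [-> -> ->] := Lat2_inj Rdvr L2 L2'.
  move=> [[e1 e2] e3]; rewrite e3 in e1.
  by rewrite (addnI e1) (addnI e2) (addnI e3).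
- case=> [|i [|i' [|c [|b [|j [|k []]]]]]] //= _; lia.
Qed.

(** ** U_3 x U_3 *)

(* Coordinates [((e_1, g_1), ((e_2, g_2), (e_3, g_3)))]. *)

Local Notation V33 := ((R^o * R^o) * ((R^o * R^o) * (R^o * R^o)))%type.

Definition row33 (p : V33) : 'rV[R]_(sumn [:: 3; 3]) :=
  rowv _ [:: p.1.1; p.2.1.1; p.2.2.1; p.1.2; p.2.1.2; p.2.2.2].
Definition vec33 (u : 'rV[R]_(sumn [:: 3; 3])) : V33 :=
  ((u 0 (inord 0), u 0 (inord 3)),
   ((u 0 (inord 1), u 0 (inord 4)), (u 0 (inord 2), u 0 (inord 5)))).

Definition inv33 (U : V33 -> Prop) : Prop :=
  forall r1 s1 r2 s2 x, U ((r1, s1), ((r2, s2), x)) ->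
  [/\ U (0, ((r1, 0), 0)) /\ U (0, ((0, s1), 0)),
      U (0, (0, (r1, 0))) /\ U (0, (0, (0, s1))) &
      U (0, (0, (r2, 0))) /\ U (0, (0, (0, s2)))].

Lemma row33D u v : row33 (u + v) = row33 u + row33 v.
Proof. by apply/rowP => i; rewrite !mxE; ord_cases i. Qed.
Lemma row33Z a u : row33 (a *: u) = a *: row33 u.
Proof. by apply/rowP => i; rewrite !mxE; ord_cases i. Qed.
Lemma vec33K : cancel vec33 row33.
Proof.
move=> u; apply/rowP => i; rewrite !mxE; ord_cases i; congr (u _ _); apply: val_inj;
 by rewrite /= inordK.
Qed.
Lemma row33K : cancel row33 vec33.
Proof. by move=> [[a b] [[c d] [e f]]]; rewrite /vec33 !mxE !inordK. Qed.

Lemma inv33P U : submod U -> is_invariant (fun v => U (vec33 v)) <-> inv33 U.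
Proof.
move=> sU; rewrite invariantP; last first.
  by apply: submod_comp sU => [u v|a u]; rewrite /vec33 !mxE.
have rowE p k : (k < 6)%N -> row33 p 0 (inord k) =
    nth 0 [:: p.1.1; p.2.1.1; p.2.2.1; p.1.2; p.2.1.2; p.2.2.2] k.
  by move=> k6; rewrite mxE inordK.
have E1 a : vec33 (a *: delta_mx 0 (inord 1)) = (0, ((a, 0), 0)).
  by rewrite /vec33 !mxE -!val_eqE /= !inordK //= !(mulr0, mulr1).
have E2 a : vec33 (a *: delta_mx 0 (inord 2)) = (0, (0, (a, 0))).
  by rewrite /vec33 !mxE -!val_eqE /= !inordK //= !(mulr0, mulr1).
have E4 a : vec33 (a *: delta_mx 0 (inord 4)) = (0, ((0, a), 0)).
  by rewrite /vec33 !mxE -!val_eqE /= !inordK //= !(mulr0, mulr1).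
have E5 a : vec33 (a *: delta_mx 0 (inord 5)) = (0, (0, (0, a))).
  by rewrite /vec33 !mxE -!val_eqE /= !inordK //= !(mulr0, mulr1).
split=> [inv r1 s1 r2 s2 x Ux|inv i j].
  have Ux' : U (vec33 (row33 ((r1, s1), ((r2, s2), x)))) by rewrite row33K.
  have I (i j : 'I_6) : (i < j)%N -> blk [:: 3; 3]%N i = blk [:: 3; 3]%N j ->
      U (vec33 (row33 ((r1, s1), ((r2, s2), x)) 0 i *: delta_mx 0 j)).
    by move=> ij bij; apply: inv.
  split; split.
  - by have := I (inord 0) (inord 1); rewrite !inordK // E1 rowE //; apply.
  - by have := I (inord 3) (inord 4); rewrite !inordK // E4 rowE //; apply.
  - by have := I (inord 0) (inord 2); rewrite !inordK // E2 rowE //; apply.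
  - by have := I (inord 3) (inord 5); rewrite !inordK // E5 rowE //; apply.
  - by have := I (inord 1) (inord 2); rewrite !inordK // E2 rowE //; apply.
  - by have := I (inord 4) (inord 5); rewrite !inordK // E5 rowE //; apply.
rewrite -[i]inord_val -[j]inord_val; move: (val i) (val j) (ltn_ord i) (ltn_ord j).
move=> {i j} i j i6 j6; rewrite !inordK // => ij bij u Uu.
have [[H1 H1'] [H2 H2'] [H3 H3']] := inv _ _ _ _ _ Uu.
by case: i j i6 j6 ij bij => [|[|[|[|[|[|]]]]]] [|[|[|[|[|[|]]]]]] //=;
  rewrite ?E1 ?E2 ?E4 ?E5.
Qed.

Lemma counts_over_Lat2 (B : lmodType R) (L : B -> Prop) c b j
    (P : ((R^o * R^o) * B -> Prop) -> Prop) n :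
  (forall M, Lat2 c b j M -> counts (fun U : (R^o * R^o) * B -> Prop =>
    [/\ submod U, tail U = L, (forall a, M a <-> exists z, U (a, z)) & P U]) n) ->
  counts (fun U => [/\ submod U, tail U = L, Lat2 c b j (proj U) & P U]) (phi q j * n).
Proof.
move=> cM; apply: (counts_fib (f := @proj _ _) _ (counts_Lat2 Rdvr c b j)) => [U []//|M LM].
apply: eq_counts (cM M LM) => U; split=> [[sU tU MU PU]|[[sU tU _ PU] <-]]; last by split.
by have <- : M = proj U by apply: funext => a; apply: propext; apply: MU.
Qed.

(** Invariance concerns vectors along the axes, whereas lifts are chosen on a basis of [M]. For the
    basis of [Lat2_basis] the condition separates into one torsion condition for each basis
    vector. *)
Lemma counts_ext_tors c b j d1 d2 cL bL jL (M L : R^o * R^o -> Prop) :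
  Lat2 c b j M -> Lat2 cL bL jL L ->
  counts (fun U : (R^o * R^o) * (R^o * R^o) -> Prop => [/\ submod U, tail U = L,
      (forall a, M a <-> exists z, U (a, z)) &
      U ((pi ^+ (c + j + d1) : R, 0), 0) /\ U ((0, pi ^+ (b + j + d2) : R), 0)])
    (q ^ tors cL bL jL (j + maxn d1 d2) * q ^ tors cL bL jL (minn d1 d2)).
Proof.
move=> LM LL; have [m1 [m2 [span indep adapted]]] := Lat2_basis Rdvr d1 d2 LM.
have sL := Lat2_submod LL.
have torsD k z l : L (pi ^+ k *: z) -> L l -> L (pi ^+ k *: (z + l)).
  by move=> Lz Ll; rewrite scalerDr; apply: submodD => //; apply: submodZ.
have := counts_ext2 span indep sL (torsD (j + maxn d1 d2)%N) (torsD (minn d1 d2))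
  (idx_tors Rdvr (j + maxn d1 d2) LL) (idx_tors Rdvr (minn d1 d2) LL).
apply: eq_counts => U.
have liftE m k : submod U -> tail U = L -> (exists z, U (m, z)) ->
    (forall z, U (m, z) -> L (pi ^+ k *: z)) <-> U (pi ^+ k *: m, 0).
  move=> sU tU [z0 Uz0]; rewrite -tU; split=> [/(_ z0 Uz0) Lz|U0 z Uz].
    have := submodB sU (submodZ sU (pi ^+ k) Uz0) Lz; congr U; congr (_, _).
      by rewrite /= subr0.
    by rewrite /= subrr.
  have := submodB sU (submodZ sU (pi ^+ k) Uz) U0; congr U; congr (_, _).
    by rewrite /= subrr.
  by rewrite /= subr0.
have adU (sU : submod U) := adapted (fun a => U (a, 0)) (submod_comp
   (f := fun a => (a, 0) : (R^o * R^o) * (R^o * R^o))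
   (fun u v => f_equal2 pair erefl (esym (addr0 0)))
   (fun a u => f_equal2 pair erefl (esym (scaler0 _ a))) sU).
have M1 : M m1 by apply/span; exists 1, 0; rewrite scale1r scale0r addr0.
have M2 : M m2 by apply/span; exists 0, 1; rewrite scale1r scale0r add0r.
split=> [[sU tU MU U1 U2]|[sU tU MU U12]]; split=> //.
- by apply/adU => //; split; apply/liftE => //; apply/MU.
- by apply/liftE => //; [apply/MU|have /adU[] := U12].
- by apply/liftE => //; [apply/MU|have /adU[] := U12].
Qed.

Lemma counts_ext_lift (B : lmodType R) c b j M (L D : B -> Prop) m :
  Lat2 c b j M -> submod L -> submod D -> (forall z, L z -> D z) -> idx L D m ->
  counts (fun U : (R^o * R^o) * B -> Prop => [/\ submod U, tail U = L,
      (forall a, M a <-> exists z, U (a, z)) & (forall a z, U (a, z) -> D z)]) (m * m).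
Proof.
(* Only some basis of [M] is wanted, so the adapted exponents are set to [0]. *)
move=> LM sL sD LD iD; have [m1 [m2 [span indep _]]] := Lat2_basis Rdvr 0 0 LM.
have DL z l : D z -> L l -> D (z + l) by move=> Dz /LD Dl; apply: submodD.
have := counts_ext2 span indep sL DL DL iD iD.
apply: eq_counts => U; split=> [[sU tU MU U1 U2]|[sU tU MU UD]]; split=> //; last 2 first.
- by move=> z; apply: UD.
- by move=> z; apply: UD.
move=> a z Uz.
have [r1 [r2 e]] : exists r1 r2, a = r1 *: m1 + r2 *: m2 by apply/span/MU; exists z.
have [z1 Uz1] : exists z, U (m1, z).
  by apply/MU/span; exists 1, 0; rewrite scale1r scale0r addr0.
have [z2 Uz2] : exists z, U (m2, z).
  by apply/MU/span; exists 0, 1; rewrite scale1r scale0r add0r.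
have Uz12 := submodD sU (submodZ sU r1 Uz1) (submodZ sU r2 Uz2).
rewrite -(subrK (r1 *: z1 + r2 *: z2) z); apply: submodD => //; last first.
  by apply: submodD => //; apply: submodZ => //; [apply: U1|apply: U2].
apply: LD; rewrite -tU; have := submodB sU Uz Uz12; congr U; congr (_, _).
by rewrite /= e subrr.
Qed.

(** The layers of [(e_1, g_1)], [(e_2, g_2)] and [(e_3, g_3)] have gaps [j1], [j2] and [j]. The
    excesses [i1], [i2] compare the middle projection with the axes of the bottom lattice, and [d1],
    [d2] compare the top projection with the axes of the middle one. *)
Definition class33 (t : seq nat) (U : V33 -> Prop) : Prop :=
  if t is [:: j1; i1; i2; c; b; j; d1; d2; j2] then
    let a1 := (c + j + i1 + j2 + d1)%N in let a2 := (b + j + i2 + j2 + d2)%N in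
    [/\ submod U, Lat2 a1 a2 j1 (proj U),
        (forall a z, U (a, z) -> pdiv (c + j) z.1.1 /\ pdiv (b + j) z.1.2) &
        [/\ submod (tail U), Lat2 (c + j + i1) (b + j + i2) j2 (proj (tail U)),
            tail U ((pi ^+ a1 : R, 0), 0) /\ tail U ((0, pi ^+ a2 : R), 0) &
            Lat2 c b j (tail (tail U))]]
  else False.

(** [m] is the number of admissible lifts of one top basis vector modulo [tail U]. It enters squared
    because the top layer has rank two. *)
Definition num33 (t : seq nat) : nat :=
  if t is [:: j1; i1; i2; c; b; j; d1; d2; j2] then
    let m := (q ^ (i1 + (i2 + j2)) * q ^ (c + b + j))%N in
    (phi q j * (phi q j2 * (q ^ tors c b j (j2 + maxn d1 d2) * q ^ tors c b j (minn d1 d2))) *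
      (phi q j1 * (m * m)))%N
  else 0%N.

Definition wt33 (t : seq nat) : nat :=
  if t is [:: j1; i1; i2; c; b; j; d1; d2; j2] then
    ((c + j + i1 + j2 + d1) + (b + j + i2 + j2 + d2) + j1 +
     ((c + j + i1 + (b + j + i2) + j2) + (c + b + j)))%N
  else 0%N.

Lemma zeta33 : exists c : nat -> nat,
  [/\ forall m, zeta_coef R [:: 3; 3]%N (q ^ m) (c m),
      forall m, (forall i, m <> (q ^ i)%N) -> zeta_coef R [:: 3; 3]%N m 0 &
      (fun m => (c m)%:R) =
        msum 9 (fun t => fpsC (num33 t)%:R * fpsX _ ^+ wt33 t) :> fps rat].
Proof.
apply: (zeta_coef_classes Rdvr row33D row33Z vec33K row33K inv33P (S := class33)).
- case=> [|j1 [|i1 [|i2 [|c [|b [|j [|d1 [|d2 [|j2 []]]]]]]]]] //= _.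
  set a1 := (c + j + i1 + j2 + d1)%N; set a2 := (b + j + i2 + j2 + d2)%N.
  pose QW (W : (R^o * R^o) * (R^o * R^o) -> Prop) :=
    [/\ submod W, Lat2 (c + j + i1) (b + j + i2) j2 (proj W),
        W ((pi ^+ a1 : R, 0), 0) /\ W ((0, pi ^+ a2 : R), 0) & Lat2 c b j (tail W)].
  pose D (z : (R^o * R^o) * (R^o * R^o)) := pdiv (c + j) z.1.1 /\ pdiv (b + j) z.1.2.
  have sD : submod D.
    apply: submodI.
      by apply: (submod_comp (f := fun z : (R^o * R^o) * (R^o * R^o) => z.1.1)) (submod_pdiv pi _).
    by apply: (submod_comp (f := fun z : (R^o * R^o) * (R^o * R^o) => z.1.2)) (submod_pdiv pi _).
  have cW : counts QW (phi q j * (phi q j2 *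
      (q ^ tors c b j (j2 + maxn d1 d2) * q ^ tors c b j (minn d1 d2)))).
    apply: (counts_fib (f := @tail _ _) _ (counts_Lat2 Rdvr c b j)) => [W []//|L LL].
    have := counts_over_Lat2 (c := (c + j + i1)%N) (b := (b + j + i2)%N) (j := j2)
      (fun M LM => counts_ext_tors d1 d2 LM LL).
    apply: eq_counts => W; split=> [[sW tW pW PW]|[[sW pW PW _] tW]]; last by split.
    by split=> //; split=> //; rewrite tW.
  apply: (counts_fib (f := @tail _ _) _ cW) => [U []//|W [sW pW PW tW]].
  have WD z : W z -> D z.
    case: z => -[r s] x Wz; have [_ pdW _ _ _] := pW.
    have [|pr ps] := pdW r s; first by exists x.
    by split; [apply: pdiv_leq pr|apply: pdiv_leq ps]; apply: leq_addr.
  have iD : idx W D (q ^ (i1 + (i2 + j2)) * q ^ (c + b + j)).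
    have h1 a z : W (a, z) -> proj W a by exists z.
    have h2 a : proj W a -> exists2 z, True & W (a, z) by move=> [z Wz]; exists z.
    have := idx_Lat2 Rdvr pW (leq_addr i1 (c + j)) (leq_addr i2 (b + j)).
    rewrite addKn -[(b + j + i2 + j2)%N]addnA addKn => i1'.
    have := idx_ext sW (submodT _) h1 h2 i1' (idx_Lat2T Rdvr tW).
    by apply: eq_idx => // z; split=> // -[].
  have := counts_over_Lat2 (fun M LM => counts_ext_lift LM sW sD WD iD) (c := a1) (b := a2) (j := j1).
  apply: eq_counts => U; split=> [[sU tU pU PU]|[[sU pU PU _] tU]]; last by split.
  by split=> //; split=> //; rewrite tU.
- case=> [|j1 [|i1 [|i2 [|c [|b [|j [|d1 [|d2 [|j2 []]]]]]]]]] //= U _.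
  set a1 := (c + j + i1 + j2 + d1)%N; set a2 := (b + j + i2 + j2 + d2)%N.
  move=> [sU pU UD [sW pW [W1 W2] L2]]; split=> //.
    move=> r1 s1 r2 s2 x Ux; have [_ _ L1 L1' _] := L2.
    have [_ pdU _ _ _] := pU; have [|p1 p1'] := pdU r1 s1; first by exists ((r2, s2), x).
    have [p2 p2'] := UD _ _ Ux; split; split.
    + have [t ->] := p1; have := submodZ sW t W1; congr (tail U _); congr (_, _); last exact: scaler0.
      by congr (_, _); rewrite /= scaler0.
    + have [t ->] := p1'; have := submodZ sW t W2; congr (tail U _); congr (_, _); last exact: scaler0.
      by congr (_, _); rewrite /= scaler0.
    + by apply/L1; apply: pdiv_leq p1; rewrite /a1; lia.
    + by apply/L1'; apply: pdiv_leq p1'; rewrite /a2; lia.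
    + exact/L1.
    + exact/L1'.
  rewrite expnD (expnD _ (c + j + i1 + (b + j + i2) + j2)).
  apply: (idx_projT sU (idx_Lat2T Rdvr pU)).
  exact: (idx_projT sW (idx_Lat2T Rdvr pW) (idx_Lat2T Rdvr L2)).
- move=> U sU fU iU.
  have [sW fW] := (submod_tail sU, full_tail fU).
  have [a1 [a2 [j1 pU]]] := Lat2_exists Rdvr (submod_proj sU) (full_proj fU).
  have [c2 [b2 [j2 pW]]] := Lat2_exists Rdvr (submod_proj sW) (full_proj fW).
  have [c [b [j L2]]] := Lat2_exists Rdvr (submod_tail sW) (full_tail fW).
  have [_ _ L1 L1' _] := L2.
  have [le1 le2] : (c + j <= c2)%N /\ (b + j <= b2)%N.
    have [_ _ _ _ [u Uu [x Wx]]] := pW; have [_ _ [H H']] := iU _ _ _ _ _ Wx.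
    by split; [apply/(pdivX Rdvr)/L1|apply/(pdiv_unitX Rdvr _ _ Uu)/L1'].
  have [W1 W2] : tail U ((pi ^+ a1 : R, 0), 0) /\ tail U ((0, pi ^+ a2 : R), 0).
    have [_ _ _ _ [u Uu [[[r s] x] Ux]]] := pU; have [[H H'] _ _] := iU _ _ _ _ _ Ux.
    split=> //; have := submodZ sW u^-1 H'; congr (tail U _); congr (_, _); last exact: scaler0.
    by congr (_, _); rewrite /= ?scaler0 // /GRing.scale /= mulKr.
  have [_ _ M1 M2 _] := pW.
  have le3 : (c2 + j2 <= a1)%N by apply/(pdivX Rdvr)/M1; exists 0.
  have le4 : (b2 + j2 <= a2)%N by apply/(pdivX Rdvr)/M2; exists 0.
  exists [:: j1; (c2 - (c + j))%N; (b2 - (b + j))%N; c; b; j; (a1 - (c2 + j2))%N;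
            (a2 - (b2 + j2))%N; j2] => //=.
  rewrite !subnKC //; split=> // -[r1 s1] [[r2 s2] x] Ux.
  by have [_ _ [H H']] := iU _ _ _ _ _ Ux; split; [apply/L1|apply/L1'].
- case=> [|j1 [|i1 [|i2 [|c [|b [|j [|d1 [|d2 [|j2 []]]]]]]]]] //.
  case=> [|j1' [|i1' [|i2' [|c' [|b' [|j' [|d1' [|d2' [|j2' []]]]]]]]]] // U _ _.
  move=> [_ pU _ [_ pW _ L2]] [_ pU' _ [_ pW' _ L2']].
  have [ec eb ej] := Lat2_inj Rdvr L2 L2'; have [e1 e2 e3] := Lat2_inj Rdvr pW pW'.
  have [e4 e5 e6] := Lat2_inj Rdvr pU pU'.
  by do ![congr (_ :: _)] => //; lia.
- case=> [|j1 [|i1 [|i2 [|c [|b [|j [|d1 [|d2 [|j2 []]]]]]]]]] //= _; lia.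
Qed.

End Cases.

(** * Evaluation of the sums over exponents *)

Section Sums.
Variable K : comNzRingType.
Implicit Types (x y u v w z : fps K) (f G H : nat -> fps K).

Fixpoint gsums (xs : seq (fps K)) (G : seq nat -> fps K) : fps K :=
  if xs is x :: xs' then gsum x (fun i => gsums xs' (fun t => G (i :: t))) else G [::].

Fixpoint monom (xs : seq (fps K)) (t : seq nat) : fps K :=
  match xs, t with
  | x :: xs', i :: t' => x ^+ i * monom xs' t'
  | _, _ => 1
  end.

Lemma eq_msum k (F F' : seq nat -> fps K) :
  (forall t, size t = k -> F t = F' t) -> msum k F = msum k F'.
Proof.
elim: k F F' => [|k IHk] F F' eF; first exact: eF.
apply: funext => m /=; apply: eq_bigr => i _; congr (_ m).
by apply: IHk => t st; apply: eF; rewrite /= st.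
Qed.

Definition smalls (xs : seq (fps K)) := foldr (fun x P => fps_small x /\ P) True xs.

Lemma msum_gsums xs (G : seq nat -> fps K) : smalls xs ->
  msum (size xs) (fun t => monom xs t * G t) = gsums xs G.
Proof.
move=> sxs; rewrite -[RHS]mul1r.
(* The monomials of the outer indices are carried along as [a]: [msum] truncates the full product,
   whereas [gsum] multiplies its inner sums by [x ^+ i] from outside. *)
suff gen a : msum (size xs) (fun t => a * (monom xs t * G t)) = a * gsums xs G.
  by rewrite -gen; apply: eq_msum => t _; rewrite mul1r.
elim: xs sxs a G => [|x xs IHxs] /= => [_|[x0 sxs]] a G; first by rewrite mul1r.
rewrite -gsumZ //; apply: funext => m; apply: eq_bigr => i _.
have -> : x ^+ i * (a * gsums xs (fun t => G (nat_of_ord i :: t))) =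
    (a * x ^+ i) * gsums xs (fun t => G (nat_of_ord i :: t)) by ring.
rewrite -IHxs //; congr (_ m); apply: eq_msum => t _.
by rewrite !mulrA.
Qed.

Definition geo x := gsum x (fun=> 1).

Lemma geoP x : fps_small x -> (1 - x) * geo x = 1.
Proof. by move=> x0; rewrite -[x in 1 - x]mulr1; apply: gsum_geo => // n; rewrite mulr1. Qed.

Lemma gsum_const x a : fps_small x -> gsum x (fun=> a) = a * geo x.
Proof. by move=> x0; rewrite -gsumZ //; apply: eq_gsum => n; rewrite mulr1. Qed.

Lemma small0 : fps_small (0 : fps K). Proof. by []. Qed.

Lemma gsum0 G : gsum 0 G = G 0%N.
Proof. by rewrite (gsum_recl _ small0) mul0r addr0. Qed.

Lemma gsumN x G : gsum x (fun n => - G n) = - gsum x G.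
Proof.
apply: funext => m; rewrite fpsN /gsum -sumrN; apply: eq_bigr => i _.
by rewrite mulrN.
Qed.

Lemma gsumB x G H : gsum x (fun n => G n - H n) = gsum x G - gsum x H.
Proof. by rewrite gsumD gsumN. Qed.

Lemma lreg_1sub x : fps_small x -> GRing.lreg (1 - x).
Proof. by move=> x0 a b; apply: fps_unitK. Qed.

Lemma lreg_fpsX : GRing.lreg (fpsX K). Proof. exact: fpsX_inj. Qed.

(** * Functionals attached to rank-two lattices *)

Variable Q : fps K.

Definition phiQ (j : nat) : fps K := if j is j'.+1 then Q ^+ j - Q ^+ j' else 1.

(** [Q * phiQ j] is [(Q - 1) * Q ^+ j], with a correction of [1] at [j = 0]. *)
Lemma gsum_phi w f : fps_small w ->
  Q * gsum w (fun j => phiQ j * f j) = (Q - 1) * gsum (Q * w) f + f 0%N.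
Proof.
move=> w0; rewrite -gsumZ //.
have Qw0 : fps_small (Q * w) by apply: smallM.
rewrite gsum_recl // [gsum (Q * w) f]gsum_recl // mul1r.
have -> : gsum w (fun n => Q * (phiQ n.+1 * f n.+1)) =
    Q * (Q - 1) * gsum w (fun n => Q ^+ n * f n.+1).
  by rewrite -gsumZ //; apply: eq_gsum => n; rewrite /phiQ exprS; ring.
suff -> : gsum w (fun n => Q ^+ n * f n.+1) = gsum (Q * w) (fun n => f n.+1) by ring.
apply: funext => m; apply: eq_bigr => i _.
by rewrite mulrA exprMn [w ^+ i * _]mulrC.
Qed.

Lemma gsum_phi1 w : fps_small w -> (1 - Q * w) * gsum w phiQ = 1 - w.
Proof.
move=> w0; have Qw0 : fps_small (Q * w) by apply: smallM.
have -> : gsum w phiQ = 1 + w * (Q - 1) * geo (Q * w).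
  rewrite gsum_recl // -mulrA; congr (_ + _ * _); rewrite -gsum_const //.
  apply: funext => m; apply: eq_bigr => n _; rewrite exprMn /= exprS.
  have -> : w ^+ n * (Q * Q ^+ n - Q ^+ n) = Q ^+ n * w ^+ n * (Q - 1) by ring.
  by [].
have -> : (1 - Q * w) * (1 + w * (Q - 1) * geo (Q * w)) =
  (1 - Q * w) + w * (Q - 1) * ((1 - Q * w) * geo (Q * w)) by ring.
by rewrite geoP //; ring.
Qed.

(** Here [l] is the difference of [c] and [b]. The two elementary divisors of the lattice have
    exponents [minn c b] and [j + maxn c b], so [l] and [j] matter only through their sum. *)
Definition Lam v w f := gsum v (fun l => gsum w (fun j => phiQ j * f (l + j)%N)).

(** The partial fraction identity [(v - z) * (v^n + v^(n-1) z + ... + z^n) = v^(n+1) - z^(n+1)],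
    summed over [n]. It comes from eliminating [S'] between the recursions in [l] and in [j]. *)
Lemma gsum_add v z f : fps_small v -> fps_small z ->
  (v - z) * gsum v (fun l => gsum z (fun j => f (l + j)%N)) = v * gsum v f - z * gsum z f.
Proof.
move=> v0 z0; set S := gsum v _; pose S' := gsum v (fun l => gsum z (fun j => f (l + j).+1)).
have e1 : S = gsum z f + v * S' by rewrite /S gsum_recl.
have e2 : S = gsum v f + z * S'.
  rewrite -gsumZ // -gsumD; apply: eq_gsum => l; rewrite gsum_recl // addn0.
  by congr (_ + z * _); apply: eq_gsum => j; rewrite addnS.
have -> : (v - z) * S = v * S - z * S by ring.
by rewrite {1}e2 e1; ring.
Qed.

Lemma LamE v w f : fps_small v -> fps_small w ->
  Q * (v - Q * w) * Lam v w f =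
  (Q * v - Q * w) * gsum v f - (Q - 1) * (Q * w) * gsum (Q * w) f.
Proof.
move=> v0 w0; have Qw0 : fps_small (Q * w) by apply: smallM.
have -> : Q * (v - Q * w) * Lam v w f = (v - Q * w) * (Q * Lam v w f) by ring.
rewrite /Lam -gsumZ //.
have -> : gsum v (fun l => Q * gsum w (fun j => phiQ j * f (l + j)%N)) =
    (Q - 1) * gsum v (fun l => gsum (Q * w) (fun j => f (l + j)%N)) + gsum v f.
  rewrite -gsumZ // -gsumD; apply: eq_gsum => l.
  by rewrite (gsum_phi (fun j => f (l + j)%N)) // addn0.
rewrite mulrDr mulrCA gsum_add //; ring.
Qed.

(** Inclusion and exclusion over the cases [b <= c] and [c <= b]: the weight [0] keeps only the
    diagonal term [l = 0]. *)
Definition Lam3 v1 v2 w f := Lam v1 w f + Lam v2 w f - Lam 0 w f.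

Lemma gsum_Lam u v w (F : nat -> nat -> fps K) : fps_small u -> fps_small v -> fps_small w ->
  gsum u (fun a => Lam v w (F a)) = Lam v w (fun B => gsum u (fun a => F a B)).
Proof.
move=> u0 v0 w0; rewrite /Lam gsum_exchange //; apply: eq_gsum => l.
rewrite gsum_exchange //; apply: eq_gsum => j.
by rewrite gsumZ.
Qed.

Lemma gsum_Lam3 u v1 v2 w (F : nat -> nat -> fps K) : fps_small u -> fps_small v1 ->
  fps_small v2 -> fps_small w ->
  gsum u (fun a => Lam3 v1 v2 w (F a)) = Lam3 v1 v2 w (fun B => gsum u (fun a => F a B)).
Proof. by move=> u0 v10 v20 w0; rewrite /Lam3 gsumB gsumD !gsum_Lam. Qed.

(* Summing over [c] and [b] amounts to summing over [A = minn c b] and over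
   the difference of [c] and [b], which is merged with [j]. *)
Lemma gsum_lattice x y w (F : nat -> nat -> fps K) : fps_small x -> fps_small y ->
  fps_small w ->
  gsum x (fun c => gsum y (fun b => gsum w (fun j =>
    phiQ j * F (minn c b) (j + (maxn c b - minn c b))%N))) =
  Lam3 x y w (fun B => gsum (x * y) (fun A => F A B)).
Proof.
move=> x0 y0 w0; rewrite -gsum_Lam3 //; last exact: smallM.
rewrite gsum_minmax //; apply: eq_gsum => a; rewrite /Lam3 -addrA; congr (_ + _).
  apply: eq_gsum => l; apply: eq_gsum => j; congr (_ * F _ _); lia.
rewrite /Lam gsum0 [gsum y _ in RHS]gsum_recl // addrC addKr.
congr (y * _); apply: eq_gsum => l; apply: eq_gsum => j; congr (_ * F _ _); lia.
Qed.

Lemma Lam3E v w f : fps_small v -> fps_small w ->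
  Q * (v - Q * w) * Lam3 v v w f =
  (Q * v - Q * w) *+ 2 * gsum v f - (Q - 1) * (v + Q * w) * gsum (Q * w) f -
  (v - Q * w) * gsum 0 f.
Proof.
move=> v0 w0; have L0 : Q * Lam 0 w f = (Q - 1) * gsum (Q * w) f + gsum 0 f.
  by rewrite /Lam !gsum0 gsum_phi.
have -> : Q * (v - Q * w) * Lam3 v v w f =
    (Q * (v - Q * w) * Lam v w f) *+ 2 - (v - Q * w) * (Q * Lam 0 w f).
  by rewrite /Lam3; ring.
by rewrite L0 LamE //; ring.
Qed.

Lemma Lam3E2 v1 v2 w f : fps_small v1 -> fps_small v2 -> fps_small w ->
  Q * (v1 - Q * w) * (v2 - Q * w) * Lam3 v1 v2 w f =
  (v2 - Q * w) * (Q * v1 - Q * w) * gsum v1 f +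
  (v1 - Q * w) * (Q * v2 - Q * w) * gsum v2 f -
  (Q - 1) * (v1 * v2 - Q * w * (Q * w)) * gsum (Q * w) f -
  (v1 - Q * w) * (v2 - Q * w) * gsum 0 f.
Proof.
move=> v10 v20 w0; have L0 : Q * Lam 0 w f = (Q - 1) * gsum (Q * w) f + gsum 0 f.
  by rewrite /Lam !gsum0 gsum_phi.
have -> : Q * (v1 - Q * w) * (v2 - Q * w) * Lam3 v1 v2 w f =
    (v2 - Q * w) * (Q * (v1 - Q * w) * Lam v1 w f) +
    (v1 - Q * w) * (Q * (v2 - Q * w) * Lam v2 w f) -
    (v1 - Q * w) * (v2 - Q * w) * (Q * Lam 0 w f).
  by rewrite /Lam3; ring.
by rewrite L0 !LamE //; ring.
Qed.

(** In these three sums the target is [R/pi^(A+B) + R/pi^A]. [sum_min] is the slice [A = 0],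
    [sum_min2] counts [pi ^+ m]-torsion, and [sum_min4] counts homomorphisms from
    [R/pi^(N+m) + R/pi^N]. *)
Definition sum_min v y := gsum v (fun B => gsum y (fun m => Q ^+ minn m B)).

Definition sum_min2 u v y := gsum v (fun B => gsum u (fun A => gsum y (fun m =>
  Q ^+ (minn m (A + B) + minn m A)))).

Definition sum_min4 u v x y := gsum v (fun B => gsum u (fun A => gsum y (fun m =>
  gsum x (fun N => Q ^+ ((minn (N + m) (A + B) + minn (N + m) A) +
                        (minn N (A + B) + minn N A)))))).

Lemma sum_minE v y : fps_small v -> fps_small y ->
  (1 - v) * (1 - y) * (1 - v * y * Q) * sum_min v y = 1 - v * y.
Proof.
move=> v0 y0; have D : (1 - v * y * Q) * sum_min v y = geo v + geo y - 1.
  rewrite /sum_min gsum_diag // => [|a n]; last by rewrite minnSS exprS.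
  rewrite minnn expr0 /geo; congr (_ + _ - _); apply: eq_gsum => n.
  by rewrite min0n.
rewrite -mulrA D.
have -> : (1 - v) * (1 - y) * (geo v + geo y - 1) =
  (1 - y) * ((1 - v) * geo v) + (1 - v) * ((1 - y) * geo y) - (1 - v) * (1 - y) by ring.
by rewrite !geoP //; ring.
Qed.

Lemma sum_min2_rec u v y : fps_small u -> fps_small v -> fps_small y ->
  (1 - u * y * Q ^+ 2) * sum_min2 u v y = geo u * geo v + sum_min v y - geo v.
Proof.
move=> u0 v0 y0; rewrite -gsumZ // -gsum_const // -gsumD -gsumB; apply: eq_gsum => B.
rewrite gsum_diag // => [|a n]; last first.
  by rewrite -exprD; congr (_ ^+ _); lia.
congr (_ + _ - _); rewrite ?min0n //; apply: eq_gsum => n.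
  by rewrite /= !min0n.
by rewrite /= minn0 addn0.
Qed.

Lemma sum_min2E u v y : fps_small u -> fps_small v -> fps_small y ->
  (1 - u) * (1 - v) * (1 - y) * (1 - v * y * Q) * (1 - u * y * Q ^+ 2) * sum_min2 u v y =
  u * (1 - y) * (1 - v * y * Q) + (1 - u) * (1 - v * y).
Proof.
move=> u0 v0 y0; rewrite -mulrA sum_min2_rec //.
have -> : (1 - u) * (1 - v) * (1 - y) * (1 - v * y * Q) *
    (geo u * geo v + sum_min v y - geo v) =
  (1 - y) * (1 - v * y * Q) * ((1 - u) * geo u) * ((1 - v) * geo v) +
  (1 - u) * ((1 - v) * (1 - y) * (1 - v * y * Q) * sum_min v y) -
  (1 - u) * (1 - y) * (1 - v * y * Q) * ((1 - v) * geo v) by ring.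
by rewrite !geoP // sum_minE //; ring.
Qed.

(** Raising [A] and [N] together adds one to each of the four minima, whence [Q ^+ 4]. On the axes
    [N = 0] and [A = 0] one of the two modules is cyclic, which leaves [sum_min2] with the roles of
    source and target exchanged. *)
Lemma sum_min4_rec u v x y : fps_small u -> fps_small v -> fps_small x -> fps_small y ->
  (1 - u * x * Q ^+ 4) * sum_min4 u v x y =
  sum_min2 u v y + sum_min2 x y v - sum_min v y.
Proof.
move=> u0 v0 x0 y0.
have -> : sum_min2 x y v = gsum v (fun B => gsum y (fun m => gsum x (fun N =>
    Q ^+ (minn B (N + m) + minn B N)))).
  rewrite /sum_min2; under eq_gsum => m do rewrite gsum_exchange //.
  by rewrite gsum_exchange.
have -> : sum_min2 u v y = gsum v (fun B => gsum y (fun m => gsum u (fun A =>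
    Q ^+ (minn m (A + B) + minn m A)))).
  by apply: eq_gsum => B; rewrite gsum_exchange.
rewrite -gsumD -gsumB -gsumZ //; apply: eq_gsum => B.
rewrite -gsumD -gsumB gsum_exchange // -gsumZ //; apply: eq_gsum => m.
rewrite gsum_diag // => [|a n]; last by rewrite -exprD; congr (_ ^+ _); lia.
have E (f g : nat -> nat) x' : f =1 g -> gsum x' (fun n => Q ^+ f n) = gsum x' (fun n => Q ^+ g n).
  by move=> fg; apply: eq_gsum => n; rewrite fg.
congr (_ + _ - _ ^+ _); [apply: E => n| apply: E => n|]; lia.
Qed.

Definition den4 u v x y := (1 - u) * (1 - v) * (1 - x) * (1 - y) * (1 - v * y * Q) *
  (1 - u * y * Q ^+ 2) * (1 - x * v * Q ^+ 2) * (1 - u * x * Q ^+ 4).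

Definition num4 u v x y :=
  (1 - x) * (1 - x * v * Q ^+ 2) * (u * (1 - y) * (1 - v * y * Q) + (1 - u) * (1 - v * y)) +
  (1 - u) * (1 - u * y * Q ^+ 2) * (x * (1 - v) * (1 - v * y * Q) + (1 - x) * (1 - v * y)) -
  (1 - u) * (1 - x) * (1 - u * y * Q ^+ 2) * (1 - x * v * Q ^+ 2) * (1 - v * y).

Lemma sum_min4E u v x y : fps_small u -> fps_small v -> fps_small x -> fps_small y ->
  den4 u v x y * sum_min4 u v x y = num4 u v x y.
Proof.
move=> u0 v0 x0 y0; rewrite /den4 -[LHS]mulrA sum_min4_rec //.
have e2 := sum_min2E x0 y0 v0; rewrite (mulrC y v) in e2.
have -> : (1 - u) * (1 - v) * (1 - x) * (1 - y) * (1 - v * y * Q) * (1 - u * y * Q ^+ 2) *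
    (1 - x * v * Q ^+ 2) * (sum_min2 u v y + sum_min2 x y v - sum_min v y) =
  (1 - x) * (1 - x * v * Q ^+ 2) * ((1 - u) * (1 - v) * (1 - y) * (1 - v * y * Q) *
     (1 - u * y * Q ^+ 2) * sum_min2 u v y) +
  (1 - u) * (1 - u * y * Q ^+ 2) * ((1 - x) * (1 - y) * (1 - v) * (1 - v * y * Q) *
     (1 - x * v * Q ^+ 2) * sum_min2 x y v) -
  (1 - u) * (1 - x) * (1 - u * y * Q ^+ 2) * (1 - x * v * Q ^+ 2) *
    ((1 - v) * (1 - y) * (1 - v * y * Q) * sum_min v y) by ring.
by rewrite e2 sum_min2E // sum_minE // (mulrC y v).
Qed.

Lemma sum_tors x y w t : fps_small x -> fps_small y -> fps_small w -> fps_small t ->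
  gsum x (fun c => gsum y (fun b => gsum w (fun j => gsum t (fun k =>
    phiQ j * Q ^+ tors c b j k)))) =
  Lam3 x y w (fun B => gsum (x * y) (fun A => gsum t (fun k =>
    Q ^+ (minn k (A + B) + minn k A)))).
Proof.
move=> x0 y0 w0 t0.
pose F A B := gsum t (fun k => Q ^+ (minn k (A + B) + minn k A)).
rewrite -(gsum_lattice F) //.
do 3!(apply: eq_gsum => ?); rewrite -gsumZ //; apply: eq_gsum => k.
by congr (_ * _ ^+ _); rewrite /tors; lia.
Qed.

Lemma sum_tors2 x y w x' y' w' : fps_small x -> fps_small y -> fps_small w ->
  fps_small x' -> fps_small y' -> fps_small w' ->
  gsum x (fun c => gsum y (fun b => gsum w (fun j =>
    gsum x' (fun d1 => gsum y' (fun d2 => gsum w' (fun j2 => phiQ j * (phiQ j2 *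
      Q ^+ (tors c b j (j2 + maxn d1 d2) + tors c b j (minn d1 d2))))))))) =
  Lam3 x y w (fun B => gsum (x * y) (fun A =>
    Lam3 x' y' w' (fun m => gsum (x' * y') (fun N =>
      Q ^+ ((minn (N + m) (A + B) + minn (N + m) A) + (minn N (A + B) + minn N A)))))).
Proof.
move=> x0 y0 w0 x'0 y'0 w'0.
pose G A B N m := Q ^+ ((minn (N + m) (A + B) + minn (N + m) A) +
  (minn N (A + B) + minn N A)).
rewrite -(gsum_lattice (fun A B => Lam3 x' y' w' (fun m => gsum (x' * y')
  (fun N => G A B N m)))) //.
apply: eq_gsum => c; apply: eq_gsum => b; apply: eq_gsum => j.
rewrite -gsum_lattice // -gsumZ //; apply: eq_gsum => d1.
rewrite -gsumZ //; apply: eq_gsum => d2.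
rewrite -gsumZ //; apply: eq_gsum => j2.
by congr (_ * (_ * _ ^+ _)); rewrite /tors; lia.
Qed.

Lemma sum_min4_Lam u v x y w : fps_small u -> fps_small v -> fps_small x ->
  fps_small y -> fps_small w ->
  Q * (y - Q * w) * gsum v (fun B => gsum u (fun A => Lam3 y y w (fun m => gsum x (fun N =>
      Q ^+ ((minn (N + m) (A + B) + minn (N + m) A) + (minn N (A + B) + minn N A)))))) =
  (Q * y - Q * w) *+ 2 * sum_min4 u v x y - (Q - 1) * (y + Q * w) * sum_min4 u v x (Q * w) -
  (y - Q * w) * sum_min4 u v x 0.
Proof.
move=> u0 v0 x0 y0 w0; rewrite -!gsumZ // -!gsumB; apply: eq_gsum => B.
rewrite -!gsumZ // -!gsumB; apply: eq_gsum => A.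
exact: Lam3E.
Qed.

(** A common denominator of [sum_min4] at last arguments [y], [z] and [0], where [z] stands for
    [Q * w]. *)
Definition den43 u v x y z := (1 - u) * (1 - v) * (1 - x) * (1 - x * v * Q ^+ 2) *
  (1 - u * x * Q ^+ 4) * ((1 - y) * (1 - v * y * Q) * (1 - u * y * Q ^+ 2)) *
  ((1 - z) * (1 - v * z * Q) * (1 - u * z * Q ^+ 2)).

Definition num43 u v x y z :=
  (Q * y - z) *+ 2 * ((1 - z) * (1 - v * z * Q) * (1 - u * z * Q ^+ 2)) * num4 u v x y -
  (Q - 1) * (y + z) * ((1 - y) * (1 - v * y * Q) * (1 - u * y * Q ^+ 2)) * num4 u v x z -
  (y - z) * ((1 - y) * (1 - v * y * Q) * (1 - u * y * Q ^+ 2)) *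
    ((1 - z) * (1 - v * z * Q) * (1 - u * z * Q ^+ 2)) * num4 u v x 0.

Lemma sum_min4_LamE u v x y w : fps_small u -> fps_small v -> fps_small x ->
  fps_small y -> fps_small w ->
  den43 u v x y (Q * w) * (Q * (y - Q * w) *
    gsum v (fun B => gsum u (fun A => Lam3 y y w (fun m => gsum x (fun N =>
      Q ^+ ((minn (N + m) (A + B) + minn (N + m) A) + (minn N (A + B) + minn N A))))))) =
  num43 u v x y (Q * w).
Proof.
move=> u0 v0 x0 y0 w0; have z0 : fps_small (Q * w) by apply: smallM.
rewrite sum_min4_Lam // /num43 -(sum_min4E u0 v0 x0 y0) -(sum_min4E u0 v0 x0 z0).
rewrite -(sum_min4E u0 v0 x0 small0) /den43 /den4.
by move: (Q * w) (sum_min4 u v x y) (sum_min4 _ _ _ (Q * w)) (sum_min4 _ _ _ 0) => z h1 h2 h3; ring.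
Qed.

Lemma gsumsZ xs a (G : seq nat -> fps K) : smalls xs ->
  gsums xs (fun t => a * G t) = a * gsums xs G.
Proof.
elim: xs G => [|x xs IHxs] G //= [x0 sxs].
by rewrite -gsumZ //; apply: eq_gsum => i; rewrite IHxs.
Qed.

End Sums.

(* [(c, a, b)] stands for the term [c X^a Y^b]. *)
Definition poly_terms (l : seq (int * nat * nat)) : {poly {poly rat}} :=
  foldr (fun t P => t.1.1%:~R * mon t.1.2 t.2 + P) 0 l.

(* [row b a l] is the part of degree [b] in [Y], with coefficients [l] from
   [X^a] upwards. *)
Definition row (b a : nat) (l : seq int) : seq (int * nat * nat) :=
  [seq (nth 0 l k, (a + k)%N, b) | k <- iota 0 (size l)].
Arguments row b%_N a%_N l%_Z.

Definition terms33 : seq (int * nat * nat) := flatten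
  [:: row 0 0 [:: 1]; row 4 2 [:: -4; 3]; row 5 2 [:: 1; -4; 1]; row 6 2 [:: 2; -4; 3; -4; 1];
      row 7 2 [:: -1; 3; -5; 4; -3]; row 8 5 [:: 3; -5; 1]; row 9 4 [:: 2; 1; 3; -4; -1];
      row 10 4 [:: -1; 3; 0; 2; 2; -3]; row 11 5 [:: -3; 6; 1; 4; -1; -1];
      row 12 6 [:: 1; -4; 6; 6; -4; 1]; row 13 6 [:: -2; 3; -8; 9; 6; 2; -3];
      row 14 7 [:: 1; -6; 4; -4; 6; 4; -1]; row 15 8 [:: 1; -13; 11; -10; 8; 2; 1];
      row 16 8 [:: 2; -7; 2; -19; 21; -6; 0; 2]; row 17 9 [:: 4; -10; 16; -40; 14; 9; -2];
      row 18 10 [:: 2; 7; -19; 9; -32; 19; 1; -1]; row 19 11 [:: -8; 30; -32; 10; -18; 0; 5];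
      row 20 11 [:: 3; -2; -2; 26; -42; 15; -14; 5]; row 21 13 [:: 13; -18; 31; -29; 0; -5; 2];
      row 22 14 [:: 3; 23; -17; 20; -33; 9; -2];
      row 23 13 [:: -1; 0; -2; 30; -20; 20; -15; -1; -1];
      row 24 14 [:: -1; -3; 1; 12; 34; -34; 17; -10];
      row 25 15 [:: -3; 0; 4; -9; 48; -18; -5; 3; -1];
      row 26 16 [:: 1; -12; -1; 14; 4; 36; -26; 3];
      row 27 16 [:: -3; 7; -13; -13; 20; -3; 21; 0; -4];
      row 28 17 [:: -1; -4; 4; -20; 2; 22; -8; 15; -5];
      row 29 18 [:: 5; -15; 8; -22; -2; 20; -4; 4; 1];
      row 30 19 [:: 4; 0; -21; 3; -20; 13; 13; -7; 3];
      row 31 20 [:: -3; 26; -36; -4; -14; 1; 12; -1];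
      row 32 20 [:: 1; -3; 5; 18; -48; 9; -4; 0; 3];
      row 33 22 [:: 10; -17; 34; -34; -12; -1; 3; 1];
      row 34 22 [:: 1; 1; 15; -20; 20; -30; 2; 0; 1];
      row 35 23 [:: 2; -9; 33; -20; 17; -23; -3]; row 36 24 [:: -2; 5; 0; 29; -31; 18; -13];
      row 37 25 [:: -5; 14; -15; 42; -26; 2; 2; -3]; row 38 26 [:: -5; 0; 18; -10; 32; -30; 8];
      row 39 26 [:: 1; -1; -19; 32; -9; 19; -7; -2]; row 40 28 [:: 2; -9; -14; 40; -16; 10; -4];
      row 41 28 [:: -2; 0; 6; -21; 19; -2; 7; -2]; row 42 29 [:: -1; -2; -8; 10; -11; 13; -1];
      row 43 30 [:: 1; -4; -6; 4; -4; 6; -1]; row 44 31 [:: 3; -2; -6; -9; 8; -3; 2];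
      row 45 32 [:: -1; 4; -6; -6; 4; -1]; row 46 33 [:: 1; 1; -4; -1; -6; 3];
      row 47 34 [:: 3; -2; -2; 0; -3; 1]; row 48 35 [:: 1; 4; -3; -1; -2];
      row 49 36 [:: -1; 5; -3]; row 50 37 [:: 3; -4; 5; -3; 1]; row 51 37 [:: -1; 4; -3; 4; -2];
      row 52 39 [:: -1; 4; -1]; row 53 40 [:: -3; 4]; row 57 43 [:: -1]].

Definition N33 : {poly {poly rat}} := poly_terms terms33.
Definition D33 : {poly {poly rat}} :=
  fac 2 3 * fac 3 5 * fac 2 2 ^+ 2 * fac 0 1 * fac 3 3 * fac 8 8 * fac 3 4 * fac 4 6 *
  fac 6 6 * fac 6 7 * fac 9 9 * fac 4 5 * fac 5 7 * fac 1 1.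

(** The left side is the numerator obtained by expanding the two nested [Lam3]. On the right, the
    first two differences are the apparent poles of the partial fractions, and the next three
    factors cancel from the combined denominator. *)
Lemma terms33_identity (Q T v w x u : fps rat) :
  v = Q ^+ 2 * T ^+ 3 -> w = Q ^+ 2 * T ^+ 5 -> x = T * T -> u = v * v ->
  (1 - T) * ((Q * v - Q * w) *+ 2 *
    ((1 - Q * w) * (1 - x * (Q * w) * Q ^+ 2) * (1 - Q * w * T * Q) * (1 - Q * w * (Q * v) * Q)) *
    num43 Q u v x T (Q * v) -
  (Q - 1) * (v + Q * w) *
    ((1 - v) * (1 - x * v * Q ^+ 2) * (1 - v * T * Q) * (1 - v * (Q * v) * Q)) *
    num43 Q u (Q * w) x T (Q * v) -
  (v - Q * w) *
    ((1 - v) * (1 - x * v * Q ^+ 2) * (1 - v * T * Q) * (1 - v * (Q * v) * Q)) *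
    ((1 - Q * w) * (1 - x * (Q * w) * Q ^+ 2) * (1 - Q * w * T * Q) * (1 - Q * w * (Q * v) * Q)) *
    num43 Q u 0 x T (Q * v)) =
  Q * (v - Q * w) * (Q * (T - Q * v)) * (1 - u) * (1 - x) * (1 - Q ^+ 7 * T ^+ 8) *
  foldr (fun t P => t.1.1%:~R * (Q ^+ t.1.2 * T ^+ t.2) + P) 0 terms33.
Proof.
move=> -> -> -> ->; rewrite /num43 /num4 /=.
ring.
Qed.

(** * Specialisation at a residue field size and the four rational functions *)

Section Evaluation.
Variable q : nat.
Hypothesis q1 : (1 < q)%N.

Local Notation F := (fps rat).
Let Q : F := q%:R.
Let T : F := fpsX rat.

Definition ev (P : {poly {poly rat}}) : F := fps_poly (map_poly (horner_eval q%:R) P).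

Lemma evE P : fps_poly (evalX q P) = ev P. Proof. by []. Qed.

Lemma evD P P' : ev (P + P') = ev P + ev P'.
Proof. by rewrite /ev !rmorphD. Qed.
Lemma evN P : ev (- P) = - ev P.
Proof. by rewrite /ev !rmorphN. Qed.
Lemma evM P P' : ev (P * P') = ev P * ev P'.
Proof. by rewrite /ev !rmorphM. Qed.
Lemma ev1 : ev 1 = 1.
Proof. by rewrite /ev !rmorph1. Qed.
Lemma evX P n : ev (P ^+ n) = ev P ^+ n.
Proof. by rewrite /ev !rmorphXn. Qed.
Lemma ev_nat n : ev n%:R = n%:R.
Proof. by rewrite /ev !rmorph_nat. Qed.
Lemma ev_mon a b : ev (mon a b) = Q ^+ a * T ^+ b.
Proof.
rewrite /mon evM !evX; congr (_ ^+ _ * _ ^+ _); rewrite /ev /Xb /Yb.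
  by rewrite map_polyC /= /horner_eval hornerX !rmorph_nat.
by rewrite map_polyX.
Qed.

Lemma fpsC_nat n : fpsC n%:R = n%:R :> F.
Proof. by rewrite /fpsC !rmorph_nat. Qed.

Lemma phi_nat j : (phi q j)%:R = phiQ Q j.
Proof.
case: j => [|j] //=; rewrite natrB ?natrX // leq_exp2l //.
Qed.

Lemma small_T n a : fps_small (a * T ^+ n.+1).
Proof.
rewrite exprSr; do 2!apply: smallM; rewrite /fps_small /T /fpsX /fps_poly coefX //.
Qed.

Lemma T_small : fps_small T. Proof. by have := small_T 0 1; rewrite mul1r. Qed.

Ltac small := repeat split; first [exact: T_small | exact: small_T
  | by apply: smallM; exact: T_small | by apply: smallM; exact: small_T].

Lemma sum22 : ev D22 * msum 5 (fun t => fpsC (num22 q t)%:R * T ^+ wt22 t) = ev N22.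
Proof.
(* Each weight collects the powers of [q] in [num22] and of [T] in [wt22] contributed by one unit of
   the corresponding exponent. *)
have -> : msum 5 (fun t => fpsC (num22 q t)%:R * T ^+ wt22 t) =
    gsums [:: T; Q * T; Q ^+ 2 * T ^+ 2; Q ^+ 2 * T ^+ 2; Q ^+ 2 * T ^+ 3]
      (fun t => phiQ Q (nth 0%N t 4)).
  rewrite -msum_gsums; last by small.
  apply: (eq_msum (k := 5)); case=> [|i1 [|i2 [|c [|b [|j []]]]]] //= _.
  by rewrite fpsC_nat !natrM phi_nat !natrX -/Q !exprMn !exprD; ring.
rewrite /= !gsum_const; do ?small.
set P := gsum _ _; have DP : (1 - Q * (Q ^+ 2 * T ^+ 3)) * P = 1 - Q ^+ 2 * T ^+ 3.
  by apply: gsum_phi1; small.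
have D1 := geoP (small_T 0 1); have D2 := geoP (small_T 0 Q).
have D3 := geoP (small_T 1 (Q ^+ 2)).
rewrite mul1r in D1.
rewrite /D22 /N22 /fac !(evM, evX, evD, evN, ev1, ev_mon).
set g2 := geo _ in D3 *; set g1 := geo _ in D2 *; set g0 := geo _ in D1 *.
transitivity (((1 - Q * (Q ^+ 2 * T ^+ 3)) * P) * ((1 - Q ^+ 2 * T ^+ 2) * g2) ^+ 2 *
  ((1 - Q * T ^+ 1) * g1) * ((1 - T ^+ 1) * g0)); first by ring.
by rewrite DP D1 D2 D3; ring.
Qed.

Lemma lregQ : GRing.lreg Q.
Proof.
move=> f g e; apply: funext => m; have := congr1 (fun h : F => h m) e.
rewrite /= /Q -fpsC_nat !fpsCM_coef; apply: mulfI.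
by rewrite pnatr_eq0; lia.
Qed.

Lemma lregT : GRing.lreg T. Proof. exact: lreg_fpsX. Qed.

Lemma lreg_1subT n a : GRing.lreg (1 - a * T ^+ n.+1).
Proof. by apply: lreg_1sub; apply: small_T. Qed.

Lemma lreg_monom a b : GRing.lreg (Q ^+ a * T ^+ b).
Proof. by apply: lregM; apply: lregX; [exact: lregQ|exact: lregT]. Qed.

Lemma sum222 : ev D222 * msum 7 (fun t => fpsC (num222 q t)%:R * T ^+ wt222 t) = ev A_poly.
Proof.
have -> : msum 7 (fun t => fpsC (num222 q t)%:R * T ^+ wt222 t) =
    gsums [:: Q ^+ 3 * T ^+ 2; Q * T; Q ^+ 2 * T; Q ^+ 3 * T ^+ 2; Q ^+ 3 * T ^+ 2;
             Q ^+ 3 * T ^+ 3; T]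
      (fun t => phiQ Q (nth 0%N t 5) *
        Q ^+ tors (nth 0%N t 3) (nth 0%N t 4) (nth 0%N t 5) (nth 0%N t 6)).
  rewrite -msum_gsums; last by small.
  apply: (eq_msum (k := 7)); case=> [|d [|i2 [|i3 [|c [|b [|j [|k []]]]]]]] //= _.
  by rewrite fpsC_nat !natrM phi_nat !natrX -/Q !exprMn !exprD; ring.
rewrite /= !gsum_const; do ?small.
rewrite sum_tors; do ?small.
set v := Q ^+ 3 * T ^+ 2; set w := Q ^+ 3 * T ^+ 3; set f := (X in Lam3 _ _ _ _ X).
have sv : fps_small v by small.
have sw : fps_small w by small.
have suv : fps_small (v * v) by apply: smallM.
have sw' : fps_small (Q * w) by apply: smallM.
have HS := Lam3E Q f sv sw.
have K1 : _ * gsum v f = _ := sum_min2E Q suv sv T_small.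
have K2 : _ * gsum (Q * w) f = _ := sum_min2E Q suv sw' T_small.
have K3 : _ * gsum 0 f = _ := sum_min2E Q suv (small0 _) T_small.
have G1 := geoP (small_T 0 Q); have G2 := geoP (small_T 0 (Q ^+ 2)).
have G3 := geoP sv.
rewrite /D222 /A_poly /fac !(evM, evX, evD, evN, ev1, ev_mon, ev_nat).
move: HS K1 K2 K3 G1 G2 G3.
move: (Lam3 _ _ _ _ _) (gsum v f) (gsum (Q * w) f) (gsum 0 f) (geo (Q * T ^+ 1)) (geo (Q ^+ 2 * T ^+ 1)) (geo v).
move=> S H1 H2 H3 g1 g2 g3 HS K1 K2 K3 G1 G2 G3.
(* The factor cleared in [Lam3E], together with the two factors of the common denominator [D] that
   do not survive in [D222]. *)
have regE : GRing.lreg (Q * (v - Q * w) * (1 - v * v) * (1 - Q * w)).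
  have -> : Q * (v - Q * w) = Q ^+ 4 * T ^+ 2 * (1 - Q * T ^+ 1) by rewrite /v /w; ring.
  apply: lregM; last exact: lreg_1sub.
  apply: lregM; last exact: lreg_1sub.
  by apply: lregM; [exact: lreg_monom|exact: lreg_1subT].
apply: regE.
pose D := (1 - v * v) * (1 - v) * (1 - T) * (1 - v * T * Q) * (1 - v * v * T * Q ^+ 2) *
  (1 - Q * w) * (1 - Q * w * T * Q).
transitivity ((1 - v) * ((1 - Q * T ^+ 1) * g1) * ((1 - Q ^+ 2 * T ^+ 1) * g2) *
  ((1 - v) * g3) * D * (Q * (v - Q * w) * S)); first by rewrite /D /v /w; ring.
rewrite HS G1 G2 G3 /D.
transitivity ((1 - v) * ((Q * v - Q * w) *+ 2 * (1 - Q * w) * (1 - Q * w * T * Q) *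
    ((1 - v * v) * (1 - v) * (1 - T) * (1 - v * T * Q) * (1 - v * v * T * Q ^+ 2) * H1) -
  (Q - 1) * (v + Q * w) * (1 - v) * (1 - v * T * Q) *
    ((1 - v * v) * (1 - Q * w) * (1 - T) * (1 - Q * w * T * Q) * (1 - v * v * T * Q ^+ 2) * H2) -
  (v - Q * w) * (1 - v) * (1 - v * T * Q) * (1 - Q * w) * (1 - Q * w * T * Q) *
    ((1 - v * v) * (1 - 0) * (1 - T) * (1 - 0 * T * Q) * (1 - v * v * T * Q ^+ 2) * H3))).
  by move: v w {sv sw suv sw' f HS K1 K2 K3 G3 D} => v w; ring.
rewrite K1 K2 K3 /v /w; ring.
Qed.

Lemma sum32 : ev D32 * msum 6 (fun t => fpsC (num32 q t)%:R * T ^+ wt32 t) = ev B_poly.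
Proof.
have -> : msum 6 (fun t => fpsC (num32 q t)%:R * T ^+ wt32 t) =
    gsums [:: Q ^+ 2 * T ^+ 2; Q * T; Q ^+ 2 * T ^+ 3; Q ^+ 2 * T ^+ 2; Q ^+ 2 * T ^+ 4; T]
      (fun t => phiQ Q (nth 0%N t 4) *
        Q ^+ tors (nth 0%N t 2) (nth 0%N t 3) (nth 0%N t 4) (nth 0%N t 5)).
  rewrite -msum_gsums; last by small.
  apply: (eq_msum (k := 6)); case=> [|i [|i' [|c [|b [|j [|k []]]]]]] //= _.
  by rewrite fpsC_nat !natrM phi_nat !natrX -/Q !exprMn !exprD; ring.
rewrite /= !gsum_const; do ?small.
rewrite sum_tors; do ?small.
set v1 := Q ^+ 2 * T ^+ 3; set v2 := Q ^+ 2 * T ^+ 2; set w := Q ^+ 2 * T ^+ 4.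
set f := (X in Lam3 _ _ _ _ X).
have sv1 : fps_small v1 by small.
have sv2 : fps_small v2 by small.
have sw : fps_small w by small.
have su : fps_small (v1 * v2) by apply: smallM.
have sw' : fps_small (Q * w) by apply: smallM.
have HS := Lam3E2 Q f sv1 sv2 sw.
have K1 : _ * gsum v1 f = _ := sum_min2E Q su sv1 T_small.
have K2 : _ * gsum v2 f = _ := sum_min2E Q su sv2 T_small.
have K3 : _ * gsum (Q * w) f = _ := sum_min2E Q su sw' T_small.
have K4 : _ * gsum 0 f = _ := sum_min2E Q su (small0 _) T_small.
have G1 := geoP (small_T 0 Q); have G2 := geoP sv2.
rewrite /D32 /B_poly /fac !(evM, evX, evD, evN, ev1, ev_mon, ev_nat).
move: HS K1 K2 K3 K4 G1 G2.
move: (Lam3 _ _ _ _ _) (gsum v1 f) (gsum v2 f) (gsum (Q * w) f) (gsum 0 f)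
  (geo (Q * T ^+ 1)) (geo v2).
move=> S H1 H2 H3 H4 g1 g2 HS K1 K2 K3 K4 G1 G2.
have regE : GRing.lreg (Q * (v1 - Q * w) * (v2 - Q * w) * (1 - Q * w) * (1 - v1 * v2)).
  have -> : Q * (v1 - Q * w) * (v2 - Q * w) = Q ^+ 5 * T ^+ 5 * (1 - Q * T ^+ 1) *
    (1 - Q * T ^+ 2) by rewrite /v1 /v2 /w; ring.
  apply: lregM; last exact: lreg_1sub.
  apply: lregM; last exact: lreg_1sub.
  apply: lregM; last exact: lreg_1subT.
  by apply: lregM; [exact: lreg_monom|exact: lreg_1subT].
apply: regE.
pose D := (1 - v1 * v2) * (1 - T) * (1 - v1 * v2 * T * Q ^+ 2) * (1 - v1) * (1 - v1 * T * Q) *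
  (1 - v2) * (1 - v2 * T * Q) * (1 - Q * w) * (1 - Q * w * T * Q).
transitivity (((1 - Q * T ^+ 1) * g1) * ((1 - v2) * g2) * D *
  (Q * (v1 - Q * w) * (v2 - Q * w) * S)); first by rewrite /D /v1 /v2 /w; ring.
rewrite HS G1 G2 /D.
transitivity (
  (v2 - Q * w) * (Q * v1 - Q * w) * (1 - v2) * (1 - v2 * T * Q) * (1 - Q * w) *
    (1 - Q * w * T * Q) * ((1 - v1 * v2) * (1 - v1) * (1 - T) * (1 - v1 * T * Q) *
       (1 - v1 * v2 * T * Q ^+ 2) * H1) +
  (v1 - Q * w) * (Q * v2 - Q * w) * (1 - v1) * (1 - v1 * T * Q) * (1 - Q * w) *
    (1 - Q * w * T * Q) * ((1 - v1 * v2) * (1 - v2) * (1 - T) * (1 - v2 * T * Q) *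
       (1 - v1 * v2 * T * Q ^+ 2) * H2) -
  (Q - 1) * (v1 * v2 - Q * w * (Q * w)) * (1 - v1) * (1 - v1 * T * Q) * (1 - v2) *
    (1 - v2 * T * Q) * ((1 - v1 * v2) * (1 - Q * w) * (1 - T) * (1 - Q * w * T * Q) *
       (1 - v1 * v2 * T * Q ^+ 2) * H3) -
  (v1 - Q * w) * (v2 - Q * w) * (1 - v1) * (1 - v1 * T * Q) * (1 - v2) *
    (1 - v2 * T * Q) * (1 - Q * w) * (1 - Q * w * T * Q) *
    ((1 - v1 * v2) * (1 - 0) * (1 - T) * (1 - 0 * T * Q) *
       (1 - v1 * v2 * T * Q ^+ 2) * H4)).
  by move: v1 v2 w {sv1 sv2 sw su sw' f HS K1 K2 K3 K4 G2 D} => v1 v2 w; ring.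
rewrite K1 K2 K3 K4 /v1 /v2 /w; ring.
Qed.

Lemma ev_terms l : ev (poly_terms l) =
  foldr (fun t P => t.1.1%:~R * (Q ^+ t.1.2 * T ^+ t.2) + P) 0 l.
Proof.
elim: l => [|t l IHl] /=; first by rewrite /ev !rmorph0.
by rewrite evD evM ev_mon IHl /ev !rmorph_int.
Qed.

Lemma sum33 : ev D33 * msum 9 (fun t => fpsC (num33 q t)%:R * T ^+ wt33 t) = ev N33.
Proof.
have -> : msum 9 (fun t => fpsC (num33 q t)%:R * T ^+ wt33 t) =
    gsums [:: T; Q ^+ 2 * T ^+ 2; Q ^+ 2 * T ^+ 2; Q ^+ 2 * T ^+ 3; Q ^+ 2 * T ^+ 3;
             Q ^+ 2 * T ^+ 5; T; T; Q ^+ 2 * T ^+ 3]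
      (fun t => phiQ Q (nth 0%N t 0) * (phiQ Q (nth 0%N t 5) * (phiQ Q (nth 0%N t 8) *
        Q ^+ (tors (nth 0%N t 3) (nth 0%N t 4) (nth 0%N t 5)
                   (nth 0%N t 8 + maxn (nth 0%N t 6) (nth 0%N t 7)) +
              tors (nth 0%N t 3) (nth 0%N t 4) (nth 0%N t 5)
                   (minn (nth 0%N t 6) (nth 0%N t 7)))))).
  rewrite -msum_gsums; last by small.
  apply: (eq_msum (k := 9)).
  case=> [|j1 [|i1 [|i2 [|c [|b [|j [|d1 [|d2 [|j2 []]]]]]]]]] //= _.
  rewrite fpsC_nat !natrM !phi_nat !natrX -/Q !exprMn.
  rewrite [Q ^+ (tors _ _ _ _ + _)]exprD.
  move: (Q ^+ tors _ _ _ _) (Q ^+ tors _ _ _ _) => t1 t2.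
  by rewrite !exprD; ring.
pose G t := phiQ Q (nth 0%N t 4) * (phiQ Q (nth 0%N t 7) *
  Q ^+ (tors (nth 0%N t 2) (nth 0%N t 3) (nth 0%N t 4)
             (nth 0%N t 7 + maxn (nth 0%N t 5) (nth 0%N t 6)) +
        tors (nth 0%N t 2) (nth 0%N t 3) (nth 0%N t 4)
             (minn (nth 0%N t 5) (nth 0%N t 6)))).
set xs := [:: Q ^+ 2 * T ^+ 2; _; _; _; _; _; _; _].
have sxs : smalls xs by small.
(* No torsion exponent involves [j1], so its sum splits off as a factor. *)
transitivity (ev D33 * (gsums xs G * gsum T (phiQ Q))).
  congr (_ * _); rewrite -gsumZ; last exact: T_small.
  by apply: eq_gsum => j1; rewrite [RHS]mulrC -gsumsZ.
rewrite {}/G {sxs}/xs /= !gsum_const; do ?small.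
rewrite sum_tors2; do ?small.
set v := Q ^+ 2 * T ^+ 3; set w := Q ^+ 2 * T ^+ 5; set P := gsum T _.
set g := geo _; set f := (X in Lam3 _ _ _ _ X); set x := T * T; set u := v * v.
have sT : fps_small T by exact: T_small.
have sv : fps_small v by small.
have sw : fps_small w by small.
have su : fps_small u by apply: smallM.
have sx : fps_small x by apply: smallM.
have sw' : fps_small (Q * w) by apply: smallM.
have HS := Lam3E Q f sv sw.
(* The final [sv] is the weight of [j2] in the inner sum, which happens to equal [v]. *)
have K1 := sum_min4_LamE Q su sv sx sT sv.
have K2 := sum_min4_LamE Q su sw' sx sT sv.
have K3 := sum_min4_LamE Q su (small0 _) sx sT sv.
have G1 := gsum_phi1 Q sT.
have G2 : (1 - Q ^+ 2 * T ^+ 2) * g = 1 by apply: geoP; small.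
rewrite -/P in G1.
rewrite /N33 ev_terms; set N := foldr _ _ _.
have facE a b : ev (fac a b) = 1 - Q ^+ a * T ^+ b.
  by rewrite /fac evD evN ev1 ev_mon.
have -> : ev D33 = (1 - v) * (1 - Q * w) * (1 - Q ^+ 2 * T ^+ 2) ^+ 2 * (1 - T) *
    (1 - Q * v) * (1 - u * x * Q ^+ 4) * (1 - v * T * Q) * (1 - Q * w * T * Q) *
    (1 - v * (Q * v) * Q) * (1 - u * T * Q ^+ 2) * (1 - u * (Q * v) * Q ^+ 2) *
    (1 - x * v * Q ^+ 2) * (1 - x * (Q * w) * Q ^+ 2) * (1 - Q * T).
  rewrite /D33 !evM !facE /u /x /v /w; move: Q T => A B.
  by do ![congr (_ * _)]; rewrite ?expr1 //; ring.
have e78 : 1 - Q ^+ 7 * T ^+ 8 = 1 - Q * w * (Q * v) * Q by rewrite /w /v; ring.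
move: HS K1 K2 K3 G1 G2; rewrite -/f.
move: (Lam3 _ _ _ _ _) (gsum v f) (gsum (Q * w) f) (gsum 0 f) g P.
move=> S H1 H2 H3 g P HS K1 K2 K3 G1 G2.
have regE : GRing.lreg (Q * (v - Q * w) * (Q * (T - Q * v)) * (1 - u) * (1 - x) *
    (1 - Q ^+ 7 * T ^+ 8)).
  have -> : Q * (v - Q * w) * (Q * (T - Q * v)) = Q ^+ 4 * T ^+ 4 * (1 - Q * T ^+ 2) *
    (1 - Q ^+ 3 * T ^+ 2) by rewrite /v /w; ring.
  apply: lregM; last exact: lreg_1subT.
  apply: lregM; last exact: lreg_1sub.
  apply: lregM; last exact: lreg_1sub.
  apply: lregM; last exact: lreg_1subT.
  by apply: lregM; [exact: lreg_monom|exact: lreg_1subT].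
apply: regE.
pose D := (1 - u) * (1 - x) * (1 - u * x * Q ^+ 4) *
  ((1 - T) * (1 - u * T * Q ^+ 2)) * ((1 - Q * v) * (1 - u * (Q * v) * Q ^+ 2)) *
  ((1 - v) * (1 - x * v * Q ^+ 2) * (1 - v * T * Q) * (1 - v * (Q * v) * Q)) *
  ((1 - Q * w) * (1 - x * (Q * w) * Q ^+ 2) * (1 - Q * w * T * Q) * (1 - Q * w * (Q * v) * Q)).
transitivity (((1 - Q * T) * P) * ((1 - Q ^+ 2 * T ^+ 2) * g) ^+ 2 * D *
  (Q * (T - Q * v) * (Q * (v - Q * w) * S))).
  rewrite e78 {}/D.
  (* Both sides agree as products of these factors; generalising them keeps [ring] from expanding
     everything. *)
  move: (1 - u) (1 - x) (1 - T) (1 - v) (1 - Q * w) (1 - Q * v) => ? ? ? ? ? ?.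
  move: (1 - u * x * Q ^+ 4) (1 - u * T * Q ^+ 2) (1 - u * (Q * v) * Q ^+ 2) => ? ? ?.
  move: (1 - x * v * Q ^+ 2) (1 - v * T * Q) (1 - v * (Q * v) * Q) => ? ? ?.
  move: (1 - x * (Q * w) * Q ^+ 2) (1 - Q * w * T * Q) (1 - Q * w * (Q * v) * Q) => ? ? ?.
  move: (1 - Q * T) (1 - Q ^+ 2 * T ^+ 2) (T - Q * v) (v - Q * w) => ? ? ? ?.
  ring.
rewrite HS G1 G2 expr1n mulr1 {}/D.
transitivity ((1 - T) * ((Q * v - Q * w) *+ 2 *
    ((1 - Q * w) * (1 - x * (Q * w) * Q ^+ 2) * (1 - Q * w * T * Q) * (1 - Q * w * (Q * v) * Q)) *
    (den43 Q u v x T (Q * v) * (Q * (T - Q * v) * H1)) -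
  (Q - 1) * (v + Q * w) *
    ((1 - v) * (1 - x * v * Q ^+ 2) * (1 - v * T * Q) * (1 - v * (Q * v) * Q)) *
    (den43 Q u (Q * w) x T (Q * v) * (Q * (T - Q * v) * H2)) -
  (v - Q * w) *
    ((1 - v) * (1 - x * v * Q ^+ 2) * (1 - v * T * Q) * (1 - v * (Q * v) * Q)) *
    ((1 - Q * w) * (1 - x * (Q * w) * Q ^+ 2) * (1 - Q * w * T * Q) * (1 - Q * w * (Q * v) * Q)) *
    (den43 Q u 0 x T (Q * v) * (Q * (T - Q * v) * H3)))).
  rewrite /den43.
  move: (1 - u) (1 - x) (1 - T) (1 - v) (1 - Q * w) (1 - Q * v) => ? ? ? ? ? ?.
  move: (1 - u * x * Q ^+ 4) (1 - u * T * Q ^+ 2) (1 - u * (Q * v) * Q ^+ 2) => ? ? ?.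
  move: (1 - x * v * Q ^+ 2) (1 - v * T * Q) (1 - v * (Q * v) * Q) => ? ? ?.
  move: (1 - x * (Q * w) * Q ^+ 2) (1 - Q * w * T * Q) (1 - Q * w * (Q * v) * Q) => ? ? ?.
  ring.
rewrite K1 K2 K3; exact: terms33_identity.
Qed.

End Evaluation.

(** * Functional equations *)

(* [phi] and [psi] stand for the substitutions (X, Y) and (X^-1, Y^-1); working
   in an abstract field keeps [field] fast. *)
Section Reciprocal.
Variables (F : fieldType) (phi psi : {rmorphism {poly {poly rat}} -> F}) (x y : F).
Hypotheses (x0 : x != 0) (y0 : y != 0) (phiX : phi Xb = x) (phiY : phi Yb = y).
Hypotheses (psiX : psi Xb = x^-1) (psiY : psi Yb = y^-1).

Definition recip_eq (N D eps : {poly {poly rat}}) (a b : nat) : Prop :=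
  psi N / psi D = phi (eps * mon a b) * (phi N / phi D).

Lemma phi_mon a b : phi (mon a b) = x ^+ a * y ^+ b.
Proof. by rewrite rmorphM !rmorphXn phiX phiY. Qed.

Lemma psi_mon a b : psi (mon a b) = x^-1 ^+ a * y^-1 ^+ b.
Proof. by rewrite rmorphM !rmorphXn psiX psiY. Qed.

(** Each denominator factor is reciprocal up to sign, so a whole denominator contributes one
    monomial, with exponents added up and sign given by the number of factors. *)
Lemma psi_fac a b : psi (fac a b) = - (x^-1 ^+ a * y^-1 ^+ b) * phi (fac a b).
Proof.
rewrite /fac !rmorphB !rmorph1 phi_mon psi_mon !exprVn; field.
by rewrite !expf_neq0.
Qed.

Lemma recip_monomial N D eps a b k l : psi N = k * phi N -> psi D = l * phi D ->
  k / l = phi (eps * mon a b) -> recip_eq N D eps a b.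
Proof. by move=> eN eD ekl; rewrite /recip_eq eN eD -ekl mulf_div. Qed.

Lemma recip22 : recip_eq N22 D22 1 6 6.
Proof.
apply: (recip_monomial (psi_fac 2 3) (l := - (x^-1 ^+ 8 * y^-1 ^+ 9))).
  rewrite /D22 !rmorphM !psi_fac ?rmorphM.
  move: (phi (fac 3 3)) (phi (fac 2 2)) (phi (fac 1 1)) (phi (fac 0 1)) => ? ? ? ?.
  ring.
rewrite mul1r phi_mon; field.
by rewrite ?oppr_eq0 ?oner_eq0 x0 y0.
Qed.

Lemma recip222 : recip_eq A_poly D222 1 15 9.
Proof.
(* [k] comes from the top monomial of [A_poly], which is paired with the constant term; [29] and
   [21] are the exponent sums of the nine factors of [D222]. *)
apply: (recip_monomial (k := - (x^-1 ^+ 14 * y^-1 ^+ 12)) (l := - (x^-1 ^+ 29 * y^-1 ^+ 21))).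
- rewrite /A_poly !(psi_mon, rmorphD psi, rmorphN psi, rmorphM psi, rmorph1 psi, rmorph_nat psi).
  rewrite !(phi_mon, rmorphD phi, rmorphN phi, rmorphM phi, rmorph1 phi, rmorph_nat phi); field.
  by rewrite ?oppr_eq0 ?oner_eq0 x0 y0.
- rewrite /D222 !rmorphM !psi_fac ?rmorphM.
  move: (phi (fac 8 5)) (phi (fac 5 4)) (phi (fac 4 3)) (phi (fac 3 2)) (phi (fac 2 1))
    (phi (fac 1 1)) (phi (fac 0 1)) => ? ? ? ? ? ? ?.
  ring.
- rewrite mul1r phi_mon; field.
  by rewrite ?oppr_eq0 ?oner_eq0 x0 y0.
Qed.

Lemma recip32 : recip_eq B_poly D32 (-1) 10 9.
Proof.
apply: (recip_monomial (k := x^-1 ^+ 13 * y^-1 ^+ 18) (l := - (x^-1 ^+ 23 * y^-1 ^+ 27))).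
- rewrite /B_poly !(psi_mon, rmorphD psi, rmorphN psi, rmorphM psi, rmorph1 psi, rmorph_nat psi).
  rewrite !(phi_mon, rmorphD phi, rmorphN phi, rmorphM phi, rmorph1 phi, rmorph_nat phi); field.
  by rewrite ?oppr_eq0 ?oner_eq0 x0 y0.
- rewrite /D32 !rmorphM !psi_fac ?rmorphM.
  move: (phi (fac 6 6)) (phi (fac 4 5)) (phi (fac 3 4)) (phi (fac 3 3)) (phi (fac 2 3))
    (phi (fac 2 2)) (phi (fac 1 1)) (phi (fac 0 1)) => ? ? ? ? ? ? ? ?.
  ring.
- rewrite mulN1r rmorphN phi_mon; field.
  by rewrite ?oppr_eq0 ?oner_eq0 x0 y0.
Qed.

Lemma psi_terms l : psi (poly_terms l) =
  \sum_(t <- l) t.1.1%:~R * (x^-1 ^+ t.1.2 * y^-1 ^+ t.2).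
Proof.
elim: l => [|t l IHl] /=; first by rewrite big_nil rmorph0.
by rewrite rmorphD rmorphM rmorph_int psi_mon IHl big_cons.
Qed.

Lemma phi_terms l : phi (poly_terms l) =
  \sum_(t <- l) t.1.1%:~R * (x ^+ t.1.2 * y ^+ t.2).
Proof.
elim: l => [|t l IHl] /=; first by rewrite big_nil rmorph0.
by rewrite rmorphD rmorphM rmorph_int phi_mon IHl big_cons.
Qed.

(* The coefficients of [N33] are antisymmetric under the exchange of
   [X^a Y^b] and [X^(43 - a) Y^(57 - b)]. *)
Lemma psi_N33 : psi N33 = - (x^-1 ^+ 43 * y^-1 ^+ 57) * phi N33.
Proof.
pose opp (t : int * nat * nat) := (- t.1.1, (43 - t.1.2)%N, (57 - t.2)%N).
have sym : perm_eq terms33 (map opp terms33) by vm_compute.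
have bnd : all (fun t => (t.1.2 <= 43)%N && (t.2 <= 57)%N) terms33 by vm_compute.
rewrite /N33 psi_terms phi_terms (perm_big _ sym) big_map mulr_sumr.
rewrite !big_seq; apply: eq_bigr => t /(allP bnd)/andP[a43 b57] /=.
have -> : x^-1 ^+ 43 = x^-1 ^+ (43 - t.1.2) * x^-1 ^+ t.1.2 by rewrite -exprD subnK.
have -> : y^-1 ^+ 57 = y^-1 ^+ (57 - t.2) * y^-1 ^+ t.2 by rewrite -exprD subnK.
rewrite !exprVn intrN; field.
by rewrite !expf_neq0.
Qed.

Lemma recip33 : recip_eq N33 D33 1 15 12.
Proof.
apply: (recip_monomial psi_N33 (l := - (x^-1 ^+ 58 * y^-1 ^+ 69))).
- rewrite /D33 !rmorphM !psi_fac ?rmorphM.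
  move: (phi (fac 2 3)) (phi (fac 3 5)) (phi (fac 2 2)) (phi (fac 0 1)) (phi (fac 3 3))
    (phi (fac 8 8)) (phi (fac 3 4)) (phi (fac 4 6)) (phi (fac 6 6)) (phi (fac 6 7))
    (phi (fac 9 9)) (phi (fac 4 5)) (phi (fac 5 7)) (phi (fac 1 1))
    => ? ? ? ? ? ? ? ? ? ? ? ? ? ?.
  ring.
- rewrite mul1r phi_mon; field.
  by rewrite ?oppr_eq0 ?oner_eq0 x0 y0.
Qed.

End Reciprocal.

(** [psi] repackages [inv_sub] as a composite of ring morphisms, so that the abstract identity
    becomes [funeq] by conversion. *)
Lemma funeq_recip N D eps a b :
  (forall (F : fieldType) (phi psi : {rmorphism {poly {poly rat}} -> F}) (x y : F),
    x != 0 -> y != 0 -> phi Xb = x -> phi Yb = y -> psi Xb = x^-1 -> psi Yb = y^-1 ->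
    recip_eq phi psi N D eps a b) -> funeq N D eps a b.
Proof.
set x : QXY := tofr Xb; set y : QXY := tofr Yb.
pose psi : {rmorphism {poly {poly rat}} -> QXY} :=
  horner_eval y^-1 \o map_poly (horner_eval x^-1 \o
    map_poly (@FracField.tofrac _ \o polyC \o polyC)).
move=> /(_ _ (@FracField.tofrac _) psi x y); apply=> //.
- by rewrite /x /tofr tofrac_eq0 polyC_eq0 polyX_eq0.
- by rewrite /y /tofr tofrac_eq0 polyX_eq0.
- by rewrite /psi /= map_polyC /= /horner_eval hornerC map_polyX hornerX.
- by rewrite /psi /= map_polyX /horner_eval hornerX.
Qed.

Lemma ev_fac_coef0 q a b : ev q (fac a b.+1) 0%N = 1.
Proof.
rewrite /fac evD evN ev1 ev_mon fpsD fpsN fps1 fpsM_coef0 fpsXn_coef mulr0.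
exact: subr0.
Qed.

(** The convolution required by [zeta_eq] is the coefficient of a product of power series; the
    constant term [1] shows that the evaluated denominator is nonzero. *)
Lemma zeta_eqI (R : comNzRingType) s q N D (F : fps rat) : ev q D 0%N = 1 ->
  (exists c : nat -> nat, [/\ forall m, zeta_coef R s (q ^ m) (c m),
    forall m, (forall i, m <> (q ^ i)%N) -> zeta_coef R s m 0 &
    (fun m => (c m)%:R) = F]) -> ev q D * F = ev q N -> zeta_eq R s q N D.
Proof.
move=> D0 [c [c1 c2 cF]] DF; split.
  apply/eqP => e; move: D0; rewrite -evE e => /eqP.
  by rewrite /fps_poly coef0 eq_sym oner_eq0.
exists c; split=> // m.
by have := congr1 (fun f : fps rat => f m) DF; rewrite -cF.
Qed.

Theorem mainTheorem12 :
  [/\ (* formulas for almost all p *)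
      (exists P0 : nat, forall p : nat, prime p -> (P0 < p)%N ->
         forall (R : idomainType) (q : nat), padic_int_ring R p q ->
           [/\ zeta_eq R [:: 2%N; 2%N] q N22 D22,
               zeta_eq R [:: 2%N; 2%N; 2%N] q A_poly D222 &
               zeta_eq R [:: 3%N; 2%N] q B_poly D32]),
      (* functional equations *)
      funeq N22 D22 1 6 6,
      funeq A_poly D222 1 15 9,
      funeq B_poly D32 (-1) 10 9 &
      (* U_3^2 acting on O_K^6 *)
      exists Nm Dn : {poly {poly rat}},
        funeq Nm Dn 1 15 12 /\
        exists P0 : nat, forall p : nat, prime p -> (P0 < p)%N ->
          forall (R : idomainType) (q : nat), padic_int_ring R p q ->
            zeta_eq R [:: 3%N; 3%N] q Nm Dn].
Proof.
split; [|exact: (funeq_recip recip22)|exact: (funeq_recip recip222)|exact: (funeq_recip recip32)|].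
  (* No prime is exceptional: the counts hold over any discrete valuation ring whose residue field
     has [q] elements. *)
  exists 0%N => p _ _ R q /padic_int_ring_dvr[pi Rdvr].
  have q1 := dvr_gt1 Rdvr; split.
  - apply: zeta_eqI (zeta22 Rdvr) (sum22 q1).
    by rewrite /D22 !evM !fpsM_coef0 !ev_fac_coef0 !mulr1.
  - apply: zeta_eqI (zeta222 Rdvr) (sum222 q1).
    by rewrite /D222 !evM !fpsM_coef0 !ev_fac_coef0 !mulr1.
  - apply: zeta_eqI (zeta32 Rdvr) (sum32 q1).
    by rewrite /D32 !evM !fpsM_coef0 !ev_fac_coef0 !mulr1.
exists N33, D33; split; first exact: (funeq_recip recip33).
exists 0%N => p _ _ R q /padic_int_ring_dvr[pi Rdvr].
apply: zeta_eqI (zeta33 Rdvr) (sum33 (dvr_gt1 Rdvr)).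
by rewrite /D33 !evM !fpsM_coef0 !ev_fac_coef0 !mulr1.
Qed.
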